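(* Let $k\ge 2$. For any $a>0$ there exists a set $C\subset\mathbb{T}^k=\mathbb{R}^k/\mathbb{Z}^k$ of second Baire category such that: (i) for every $\alpha\in C$ the components of $(\alpha,1)\in\mathbb{R}^{k+1}$ are linearly independent over $\mathbb{Q}$; (ii) for every $\alpha\in C$ there are arbitrarily large $X$ with $$R_2[-a,a](X)\ge\begin{cases}\dfrac{\log X}{\log\log\log X}&(k=2),\\[6pt] \dfrac{X^{(k-2)/k}}{\log\log\log X}&(k>2);\end{cases}$$ (iii) for every $\alpha\in C$ there is an infinite sequence $L_1<L_2<\cdots\to\infty$ with $$\lim_{j\to\infty}R_2[-a,a](L_j)=2aB_k.$$
   Context: Let $\|\cdot\|$ be the euclidean norm on $\mathbb{R}^k$ and $B_k$ the volume of the $k$-dimensional unit ball. For $\alpha\in\mathbb{R}^k$ (the quantities below depend only on $\alpha$ modulo $\mathbb{Z}^k$), let $0\le\lambda_1\le\lambda_2\le\cdots$ be the values $\|m-\alpha\|^2$, $m\in\mathbb{Z}^k$, listed with multiplicity, and $X_j=\lambda_j^{k/2}$. Define $$R_2[a,b](X)=\frac{1}{B_kX}\#\{(i,j):\ i\neq j,\ X_i,X_j\in[X,2X],\ X_i-X_j\in[a,b]\}.$$ A set of second Baire category is one that is not meager (not a countable union of nowhere dense sets). *)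

(* Defs.v *)
From HB Require Import structures.
From mathcomp Require Import all_boot all_order all_algebra finmap.
From mathcomp Require Import all_classical all_reals all_analysis.

Set Implicit Arguments.
Unset Strict Implicit.
Unset Printing Implicit Defensive.

Import Order.TTheory GRing.Theory Num.Theory.
Import numFieldNormedType.Exports.

Local Open Scope classical_set_scope.
Local Open Scope ring_scope.
Local Open Scope quotient_scope.

Section Torus.
Variables (R : realType) (k : nat).

Definition eqmodZ (x y : 'rV[R]_k) : bool :=
  [forall i, (x 0 i - y 0 i) \is a Num.int].

Lemma eqmodZ_refl : reflexive eqmodZ.
Proof. by move=> x; apply/forallP => i; rewrite subrr rpred0. Qed.

Lemma eqmodZ_sym : symmetric eqmodZ.
Proof.
by move=> x y; apply: eq_forallb => i; rewrite -opprB rpredN.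
Qed.

Lemma eqmodZ_trans : transitive eqmodZ.
Proof.
move=> y x z /forallP xy /forallP yz; apply/forallP => i.
by rewrite -(subrKA (y 0 i)) rpredD.
Qed.

Canonical eqmodZ_equiv := EquivRel eqmodZ eqmodZ_refl eqmodZ_sym eqmodZ_trans.

Definition torus : Type := quotient_topology {eq_quot eqmodZ}.


End Torus.

Section Category.
Variable T : topologicalType.

Definition nowhere_dense (A : set T) : Prop := (closure A)° = set0.

Definition meager (A : set T) : Prop :=
  exists2 F : nat -> set T,
    forall n, nowhere_dense (F n) & A = \bigcup_n F n.

Definition second_category (A : set T) : Prop := ~ meager A.

End Category.

Section Euclidean.
Variable R : realType.

Definition euclidean_norm k (x : 'rV[R]_k) : R :=
  Num.sqrt (\sum_i x 0 i ^+ 2).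

(* The k-fold product of the Lebesgue measure, as an iterated integral of
   sections (this is how the library defines the product of two measures). *)
Fixpoint lebesgue_volume k : set 'rV[R]_k -> \bar R :=
  match k with
  | 0 => fun A => (\1_A 0)%:E
  | k'.+1 => fun A =>
      (\int[@lebesgue_measure R]_x
         lebesgue_volume [set y : 'rV[R]_k' | A (row_mx x%:M y)])%E
  end.

Definition unit_ball_volume k : R :=
  fine (lebesgue_volume [set x : 'rV[R]_k | euclidean_norm x <= 1]).

Definition lin_indep_over_rat n (v : 'rV[R]_n) : Prop :=
  forall q : 'rV[rat]_n, \sum_i ratr (q 0 i) * v 0 i = 0 -> q = 0.

End Euclidean.

Section PairCorrelation.
Variables (R : realType) (k : nat).
Implicit Type alpha : 'rV[R]_k.

Definition sqdist alpha (m : 'rV[int]_k) : R :=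
  euclidean_norm (map_mx intr m - alpha) ^+ 2.

Definition lists_in_order (T : Type) (f : T -> R) (l : nat -> R) : Prop :=
  {homo l : i j / (i <= j)%N >-> i <= j} /\
  exists2 e : nat -> T, bijective e & forall j, l j = f (e j).

(* Indexed from 0.  For k > 0 such a listing exists by [lambdaP], so the
   default value is never used. *)
Definition lambda alpha : nat -> R :=
  xget (fun=> 0) [set l | lists_in_order (sqdist alpha) l].

Definition Xseq alpha (j : nat) : R := lambda alpha j `^ (k%:R / 2).

Definition close_pairs alpha (a b X : R) : set (nat * nat) :=
  [set p | [/\ p.1 <> p.2,
     Xseq alpha p.1 \in `[X, 2 * X], Xseq alpha p.2 \in `[X, 2 * X]
   & Xseq alpha p.1 - Xseq alpha p.2 \in `[a, b]]].

(* [fset_set] of an infinite set is empty, but [close_pairs] is finite for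
   k > 0, see [finite_close_pairs]. *)
Definition R2 alpha (a b X : R) : R :=
  (#|` fset_set (close_pairs alpha a b X)|)%:R / (unit_ball_volume R k * X).

End PairCorrelation.

Section Existence.
Variable R : realType.

Lemma lists_in_order_exists (T : countType) (f : T -> R) :
  (forall t, finite_set [set m | f m <= t]) -> infinite_set [set: T] ->
  exists l, lists_in_order f l.
Proof.
move=> fin inf.
pose lt m n := (f m < f n) || (f m == f n) && (choice.pickle m < choice.pickle n)%N.
have lt_tr m n p : lt m n -> lt n p -> lt m p.
  move=> /orP[mn|/andP[/eqP mn mn']] /orP[np|/andP[/eqP np np']]; apply/orP.
  - by left; exact: lt_trans np.
  - by left; rewrite -np.
  - by left; rewrite mn.
  - by right; rewrite mn np eqxx (ltn_trans mn').
have lt_irr m : lt m m = false by rewrite /lt ltxx ltnn andbF.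
have lt_tot m n : m != n -> lt m n || lt n m.
  move=> mn; rewrite /lt; case: ltgtP => //= _.
  by rewrite -neq_ltn; apply: contra_neq mn => /(pcan_inj choice.pickleK).
have finD n : finite_set [set m | lt m n].
  apply: sub_finite_set (fin (f n)) => m /= /orP[/ltW//|/andP[/eqP-> _]] //.
pose D n := fset_set [set m | lt m n].
have inD m n : (m \in D n) = lt m n.
  by rewrite /D in_fset_set//; apply/idP/idP; rewrite inE.
pose rk n := #|` D n|.
have rk_lt m n : lt m n -> (rk m < rk n)%N.
  move=> mn; apply: fproper_ltn_card; rewrite fproperE; apply/andP; split.
    by apply/fsubsetP => p; rewrite !inD => /lt_tr; apply.
  by apply/fsubsetPn; exists m; rewrite !inD ?lt_irr.
have rk_inj : injective rk.
  move=> m n eq_rk; apply/eqP/negPn/negP => /lt_tot /orP[] /rk_lt;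
  by rewrite eq_rk ltnn.
have rk_big r : exists n, (r < rk n)%N.
  apply: contrapT => H; apply: inf.
  suff <- : rk @^-1` `I_r.+1 = setT.
    by apply: finite_preimage (finite_II _) => m n _ _; exact: rk_inj.
  apply/seteqP; split => // n _ /=; rewrite ltnS leqNgt.
  by apply/negP => rn; apply: H; exists n.
have rk_surj r : exists n, rk n == r.
  have [n rn] := rk_big r.
  pose I := [fset i in iota 0 (rk n)]%fset.
  pose A := [fset rk m | m in D n]%fset.
  have AI : (A `<=` I)%fset.
    apply/fsubsetP => _ /imfsetP[m /= mD ->].
    by rewrite !inE mem_iota /= rk_lt // -inD.
  have cI : #|` I| = rk n by rewrite card_fseq undup_id ?iota_uniq// size_iota.
  have cA : #|` A| = rk n by rewrite card_imfset.
  have /eqP AE : A == I by rewrite eqEfcard AI cI cA leqnn.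
  have : r \in A by rewrite AE !inE mem_iota.
  by move=> /imfsetP[m _ ->]; exists m.
pose e r := xchoose (rk_surj r).
have eK : cancel e rk by move=> r; exact/eqP/(xchooseP (rk_surj r)).
have rkK : cancel rk e by move=> n; apply: rk_inj; rewrite eK.
exists (f \o e); split => [i j ij|]; last by exists e => //; exists rk.
rewrite leNgt; apply/negP => /= fji.
have : lt (e j) (e i) by rewrite /lt fji.
by move=> /rk_lt; rewrite !eK ltnNge ij.
Qed.

Lemma finite_sqdist_le k (alpha : 'rV[R]_k) t :
  finite_set [set m | sqdist alpha m <= t].
Proof.
pose c := \sum_i `|alpha 0 i| + (1 + `|t|).
pose N := Num.bound c.
pose g (h : {ffun 'I_k -> 'I_(N + N)}) : 'rV[int]_k :=
  \row_i ((h i)%:Z - N%:Z).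
have /sub_finite_set : [set m | sqdist alpha m <= t] `<=` range g; last first.
  by apply; apply: finite_image; exact: finite_finset.
move=> m /= mt.
have mi i : `|m 0 i| < N%:Z.
  have c0 : 0 <= c by rewrite !addr_ge0// sumr_ge0.
  have cN : c < N%:R by exact: archi_boundP.
  rewrite -(ltr_int R); apply: le_lt_trans cN.
  have ai : `|alpha 0 i| <= \sum_i `|alpha 0 i|.
    by rewrite (bigD1 i)//= lerDl sumr_ge0.
  rewrite intr_norm.
  have -> : (m 0 i)%:~R = alpha 0 i + ((m 0 i)%:~R - alpha 0 i) :> R.
    by rewrite addrC subrK.
  apply: le_trans (ler_normD _ _) _; apply: lerD => //.
  set d := _ - _.
  have d2 : `|d| ^+ 2 <= `|t|.
    rewrite real_normK ?num_real//.
    apply: le_trans (le_trans mt (ler_norm t)).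
    rewrite /sqdist /euclidean_norm sqr_sqrtr; last first.
      by apply: sumr_ge0 => j _; exact: sqr_ge0.
    rewrite (bigD1 i)//= !mxE lerDl; apply: sumr_ge0 => j _; exact: sqr_ge0.
  have [d1|d1] := leP `|d| 1; first by rewrite (le_trans d1)// lerDl.
  rewrite (le_trans _ (le_trans d2 _)) ?lerDr//.
  by rewrite expr2 ler_peMr// ltW.
have mN i : (`|(m 0 i + N%:Z)%R| < N + N)%N.
  have := mi i; rewrite ltr_norml => /andP[l u].
  rewrite -ltz_nat gez0_abs; last by rewrite -lerBlDr sub0r ltW.
  by rewrite PoszD ltrD2r.
exists [ffun i => Ordinal (mN i)] => //.
apply/rowP => i; rewrite !mxE ffunE /= gez0_abs ?addrK//.
by have := mi i; rewrite ltr_norml => /andP[/ltW l _]; rewrite -lerBlDr sub0r.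
Qed.

Lemma lambdaP k (alpha : 'rV[R]_k) : (0 < k)%N ->
  lists_in_order (sqdist alpha) (lambda alpha).
Proof.
move=> k0; suff [l ll] : exists l, lists_in_order (sqdist alpha) l.
  exact: (xgetPex (fun=> 0) (ex_intro _ l ll)).
apply: lists_in_order_exists; first exact: finite_sqdist_le.
move=> fin; apply: infinite_nat.
pose g (n : nat) : 'rV[int]_k := const_mx n%:Z.
rewrite -(preimage_setT g); apply: finite_preimage fin => m n _ _.
by move=> /rowP/(_ (Ordinal k0)); rewrite !mxE => -[].
Qed.

Lemma finite_close_pairs k (alpha : 'rV[R]_k) (a b X : R) : (0 < k)%N ->
  finite_set (close_pairs alpha a b X).
Proof.
move=> k0; have [_ [e e_bij le]] := lambdaP alpha k0.
pose t := `|2 * X| `^ (2 / k%:R).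
have finJ : finite_set [set j | lambda alpha j <= t].
  rewrite (_ : mkset _ = e @^-1` [set m | sqdist alpha m <= t]).
    apply: finite_preimage (finite_sqdist_le alpha t) => m n _ _.
    exact: bij_inj.
  by apply/seteqP; split => j /=; rewrite le.
have small j : Xseq alpha j <= 2 * X -> lambda alpha j <= t.
  have l0 : 0 <= lambda alpha j by rewrite le sqr_ge0.
  have kE : k%:R / 2 * (2 / k%:R) = 1 :> R.
    by rewrite mulrA divfK ?pnatr_eq0// divff// pnatr_eq0 -lt0n.
  move=> /le_trans/(_ (ler_norm _)).
  have k2 : 0 <= 2 / k%:R :> R by rewrite divr_ge0.
  move=> /(ge0_ler_powR k2); rewrite !nnegrE powR_ge0 normr_ge0 => /(_ isT isT).
  by rewrite -powRrM kE powRr1.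
apply: sub_finite_set (finite_setX finJ finJ) => -[i j] [_ /=].
by rewrite !in_itv /= => /andP[_ /small ?] /andP[_ /small ?] _.
Qed.

End Existence.

(* Main.v *)
From HB Require Import structures.
Require Import Defs.
From mathcomp Require Import all_boot all_order all_algebra finmap.
From mathcomp Require Import all_classical all_reals all_analysis measurable_realfun.
From mathcomp Require Import ring lra zify.

Set Implicit Arguments.
Unset Strict Implicit.
Unset Printing Implicit Defensive.

Import Order.TTheory GRing.Theory Num.Theory.
Import numFieldNormedType.Exports.

Local Open Scope classical_set_scope.
Local Open Scope ring_scope.

(** Write [r_m = |m - alpha|], so that R_2 counts pairs of lattice points by their
    values [r_m ^ k].  By the Baire category theorem, applied upstairs in R^k, it is
    enough to find for each N dense open sets of [alpha] for which, at some scale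
    beyond N, the correlation is large (high scales), respectively at most
    [2 a B_k + 1 / N] (low scales), together with the complements of the rational
    hyperplanes.

    High scales: near a rational point many distances coincide exactly, and the
    coincidences survive small perturbations of [alpha].  For k > 2 the values
    [|q m - p|^2] are integers below a multiple of [X ^ (2 / k)], and Cauchy-Schwarz
    gives [X ^ (2 - 2 / k)] coincidences.  For k = 2 and [alpha = - p / q], factorisations
    of Gaussian integers produce [X log X] of them.

    Low scales: the pair count at scale X is averaged over [alpha] in a small cube.
    For a difference [d = n - m] the condition confines [alpha . d] to a short
    interval depending on [m].  For most [d] a lattice vector moves this interval by
    a small step, so that the [m] equidistribute and the averaged count is
    asymptotically [2 a (B_k)^2 X]; the other [d] are few by Dirichlet approximation.

    Finally, if [(alpha, 1)] is linearly independent over Q then the [r_m] are distinct, so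
    the pair count drops by O(X ^ (1 - 1 / k)) only when the window passes a point, and
    between a high and a later low scale R_2 comes arbitrarily close to [2 a B_k]. *)

(** * Lattice points and pair counts *)

(** Only one-sided estimates are needed. The level $2aB_k$ is crossed downwards, so an upper bound
    suffices at low scales; it rests on closed conditions and persists near a given $\alpha$, as do
    the lower bounds given by coincidences strictly inside the window.

    The upper bound avoids computing for each $d$ the volume of a slab cut out of a shell. The
    window for $|m+d-\alpha|^2-|m-\alpha|^2$ is compared with one of half-width $K\rho$, where
    $\rho$ is the inner radius. By equidistribution the counts are in the ratio of the widths, and
    the wide count is summed over all $d$ at once as a number of lattice points in shells. These
    have bounded thickness, where the error of the lattice count is of the order of the main term;
    hence $K$ must be large.

    The mean over the cube is a finite mean over a grid whose mesh is chosen after the scale, which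
    absorbs all rounding errors.

    The constant in the high counts depends on the rational point and is not controlled; the factor
    $\log\log\log X$ swallows it. For $k=2$ Cauchy-Schwarz would give only a multiple of $X$; the
    logarithm comes from the dyadic sizes of one Gaussian factor. *)

Section EuclideanNorm.
Variable R : realType.

Lemma sum_sqr_ge0 (I : finType) (f : I -> R) : 0 <= \sum_i f i ^+ 2.
Proof. by apply: sumr_ge0 => i _; exact: sqr_ge0. Qed.

Lemma enorm_ge0 k (x : 'rV[R]_k) : 0 <= euclidean_norm x.
Proof. exact: sqrtr_ge0. Qed.

Lemma enorm_sqr k (x : 'rV[R]_k) : euclidean_norm x ^+ 2 = \sum_i x 0 i ^+ 2.
Proof. by rewrite sqr_sqrtr ?sum_sqr_ge0. Qed.

Lemma cauchy_schwarz (I : finType) (f g : I -> R) :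
  (\sum_i f i * g i) ^+ 2 <= (\sum_i f i ^+ 2) * (\sum_i g i ^+ 2).
Proof.
set p := \sum_i _ * _; set u := \sum_i f i ^+ 2; set v := \sum_i g i ^+ 2.
have u0 : 0 <= u := sum_sqr_ge0 f.
have : 0 <= \sum_i (u * g i - p * f i) ^+ 2 by exact: sum_sqr_ge0.
have -> : \sum_i (u * g i - p * f i) ^+ 2 = u ^+ 2 * v - 2 * u * p * p + p ^+ 2 * u.
  rewrite (eq_bigr (fun i => u ^+ 2 * g i ^+ 2 - 2 * u * p * (f i * g i)
                             + p ^+ 2 * f i ^+ 2)); last by move=> i _; ring.
  by rewrite big_split /= sumrB -!mulr_sumr.
move=> h; have {h} : 0 <= u * (u * v - p ^+ 2) by apply: le_trans h _; lra.
have [u00|u_gt0] := eqVneq u 0.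
  have f0 i : f i = 0.
    by apply/eqP; move/eqP: u00; rewrite psumr_eq0 => [/allP/(_ i (mem_index_enum _))|j _];
      rewrite ?sqrf_eq0 ?sqr_ge0.
  by rewrite /p big1 ?expr0n ?u00 ?mul0r // => i _; rewrite f0 mul0r.
by rewrite pmulr_rge0 ?lt_neqAle 1?eq_sym ?u_gt0 // subr_ge0.
Qed.

Lemma enormD k (x y : 'rV[R]_k) :
  euclidean_norm (x + y) <= euclidean_norm x + euclidean_norm y.
Proof.
rewrite -(@ler_pXn2r R 2) ?nnegrE ?addr_ge0 ?enorm_ge0 // sqrrD !enorm_sqr.
rewrite (eq_bigr (fun i => x 0 i ^+ 2 + 2 * (x 0 i * y 0 i) + y 0 i ^+ 2)); last first.
  by move=> i _; rewrite !mxE; ring.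
rewrite !big_split /= -mulr_sumr.
suff : \sum_i x 0 i * y 0 i <= euclidean_norm x * euclidean_norm y by lra.
apply: le_trans (ler_norm _) _.
rewrite -(@ler_pXn2r R 2) ?nnegrE ?mulr_ge0 ?enorm_ge0 // exprMn !enorm_sqr.
by rewrite real_normK ?num_real // cauchy_schwarz.
Qed.

Lemma enormN k (x : 'rV[R]_k) : euclidean_norm (- x) = euclidean_norm x.
Proof. by congr Num.sqrt; apply: eq_bigr => i _; rewrite !mxE sqrrN. Qed.

Lemma enorm_coord k (x : 'rV[R]_k) i : `|x 0 i| <= euclidean_norm x.
Proof.
rewrite -(@ler_pXn2r R 2) ?nnegrE ?enorm_ge0 // enorm_sqr real_normK ?num_real //.
by rewrite (bigD1 i) //= lerDl sumr_ge0 // => j _; exact: sqr_ge0.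
Qed.

Lemma enorm_le_sum k (x : 'rV[R]_k) : euclidean_norm x <= \sum_i `|x 0 i|.
Proof.
have s0 : 0 <= \sum_i `|x 0 i| by exact: sumr_ge0.
rewrite -(@ler_pXn2r R 2) ?nnegrE ?enorm_ge0 // enorm_sqr expr2 big_distrl /=.
apply: ler_sum => i _; rewrite -[x 0 i ^+ 2]real_normK ?num_real // expr2.
by rewrite ler_wpM2l // (bigD1 i) //= lerDl sumr_ge0.
Qed.

Lemma enorm_dist k (x y : 'rV[R]_k) :
  `|euclidean_norm x - euclidean_norm y| <= euclidean_norm (x - y).
Proof.
have h1 := enormD (x - y) y; have h2 := enormD (y - x) x.
rewrite !subrK in h1 h2; rewrite -[euclidean_norm (y - x)]enormN opprB in h2.
by rewrite ler_norml; apply/andP; split; lra.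
Qed.

Definition ldist k (alpha : 'rV[R]_k) (m : 'rV[int]_k) : R :=
  euclidean_norm (map_mx intr m - alpha).

Lemma ldist_ge0 k (alpha : 'rV[R]_k) m : 0 <= ldist alpha m.
Proof. exact: enorm_ge0. Qed.

Lemma ldist_sqr k (alpha : 'rV[R]_k) (m : 'rV[int]_k) :
  ldist alpha m ^+ 2 = \sum_i ((m 0 i)%:~R - alpha 0 i) ^+ 2.
Proof. by rewrite enorm_sqr; apply: eq_bigr => i _; rewrite !mxE. Qed.

(** Two lattice points and two centres are allowed at once, so that this serves both for moving
    [alpha] and for shifting [m]. The $\ell^1$ bound is crude, but only constants are affected. *)
Lemma ldist_lip k (alpha beta : 'rV[R]_k) (m n : 'rV[int]_k) :
  `|ldist alpha m - ldist beta n| <=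
  \sum_i `|((m 0 i)%:~R - (n 0 i)%:~R) - (alpha 0 i - beta 0 i)|.
Proof.
apply: le_trans (enorm_dist _ _) _; apply: le_trans (enorm_le_sum _) _.
by apply: ler_sum => i _; rewrite !mxE le_eqVlt; apply/orP/or_introl/eqP; congr (`|_|); ring.
Qed.

Lemma ldist_coord k (alpha : 'rV[R]_k) (m : 'rV[int]_k) i :
  `|(m 0 i)%:~R - alpha 0 i| <= ldist alpha m.
Proof. by have := enorm_coord (map_mx intr m - alpha) i; rewrite !mxE. Qed.

End EuclideanNorm.

(** * Cardinalities of finite sets *)

Section Counting.

Definition cnt (T : choiceType) (A : set T) : nat := #|` fset_set A|.

Lemma cnt_sub (T : choiceType) (A B : set T) :
  finite_set B -> A `<=` B -> (cnt A <= cnt B)%N.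
Proof.
move=> fB AB; apply: fsubset_leq_card; apply/fsubsetP => x.
have fA := sub_finite_set AB fB.
by rewrite !in_fset_set // !inE; exact: AB.
Qed.

Lemma cnt_inj (T U : choiceType) (f : T -> U) (A : set T) (B : set U) :
  finite_set B -> (forall x, A x -> B (f x)) ->
  (forall x y, A x -> A y -> f x = f y -> x = y) ->
  (cnt A <= cnt B)%N.
Proof.
move=> fB AB fI.
have fAB : f @` A `<=` B by move=> _ [x Ax <-]; exact: AB.
have fi : {in A &, injective f} by move=> x y; rewrite !inE; exact: fI.
have fA : finite_set A.
  by rewrite -(eq_finite_set (inj_card_eq fi)); exact: sub_finite_set fAB fB.
apply: leq_trans (cnt_sub fB fAB).
rewrite /cnt fset_set_image // card_in_imfset //= => x y.
by rewrite !in_fset_set // !inE; exact: fI.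
Qed.

Lemma finite_inj (T U : choiceType) (f : T -> U) (A : set T) (B : set U) :
  finite_set B -> (forall x, A x -> B (f x)) ->
  (forall x y, A x -> A y -> f x = f y -> x = y) -> finite_set A.
Proof.
move=> fB AB fI.
have fi : {in A &, injective f} by move=> x y; rewrite !inE; exact: fI.
rewrite -(eq_finite_set (inj_card_eq fi)); apply: sub_finite_set fB.
by move=> _ [x Ax <-]; exact: AB.
Qed.

Lemma ler_sum_inj (R : numDomainType) (T U : choiceType) (F : {fset T}) (F' : {fset U})
    (h : T -> U) (g : U -> R) :
  {in F &, injective h} -> {in F, forall x, h x \in F'} ->
  (forall y, y \in F' -> 0 <= g y) ->
  \sum_(x <- F) g (h x) <= \sum_(y <- F') g y.
Proof.
move=> hI hF g0; set G := [fset h x | x in F]%fset.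
have -> : \sum_(x <- F) g (h x) = \sum_(y <- G) g y.
  by rewrite big_imfset.
have GF : (G `<=` F')%fset by apply/fsubsetP => _ /imfsetP[x /= xF ->]; exact: hF.
rewrite [leRHS](big_fsetID _ (mem G)) /=.
have -> : [fset x in F' | x \in G]%fset = G.
  by apply/fsetP => x; rewrite !inE /=; have [/(fsubsetP GF)->|] := boolP (x \in G);
    rewrite ?andbF.
rewrite lerDl big_seq; apply: sumr_ge0 => y; rewrite !inE => /andP[yF _]; exact: g0.
Qed.

Lemma sum_fset_indic (R : pzSemiRingType) (T : choiceType) (F : {fset T}) (P : pred T) :
  \sum_(x <- F) (P x)%:R = (cnt [set x | x \in F /\ P x])%:R :> R.
Proof.
rewrite -natr_sum; congr _%:R.
have fin : finite_set [set x | x \in F /\ P x].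
  by apply: sub_finite_set (finite_fset F) => x [].
rewrite /cnt (_ : fset_set _ = [fset x in F | P x]%fset); last first.
  apply/fsetP => x; rewrite in_fset_set // !inE /=.
  by apply/idP/idP => [|/andP//]; rewrite inE /= => -[-> ->].
by rewrite -sum1_size big_fset /= -big_mkcond.
Qed.

Lemma sum_fin_indic (R : pzSemiRingType) (T : finType) (P : pred T) :
  \sum_x (P x)%:R = (cnt [set x | P x])%:R :> R.
Proof.
rewrite (perm_big (fset_set [set: T])) /=; last first.
  apply: uniq_perm; rewrite ?index_enum_uniq ?fset_uniq // => x.
  by rewrite mem_index_enum in_fset_set ?in_setT //; exact: finite_finset.
rewrite sum_fset_indic; congr (cnt _)%:R; apply/seteqP; split => x /= => [[] //|Px].
by rewrite in_fset_set ?in_setT //; exact: finite_finset.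
Qed.

End Counting.

(** * From indices to lattice points *)

Section PairsR2.
Variables (R : realType) (k : nat).
Hypothesis k0 : (0 < k)%N.

Definition lpairs (alpha : 'rV[R]_k) (a b X : R) : set ('rV[int]_k * 'rV[int]_k) :=
  [set p | [/\ p.1 <> p.2,
     ldist alpha p.1 ^+ k \in `[X, 2 * X], ldist alpha p.2 ^+ k \in `[X, 2 * X]
   & ldist alpha p.1 ^+ k - ldist alpha p.2 ^+ k \in `[a, b]]].

(** The increasing listing matters only as a bijection with $\mathbb{Z}^k$, and $\lambda^{k/2}$
    becomes the integral power $r_m^k$. From here on the listing can be forgotten. *)
Lemma XseqE (alpha : 'rV[R]_k) : exists2 e : nat -> 'rV[int]_k, bijective e &
  forall j, Xseq alpha j = ldist alpha (e j) ^+ k.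
Proof.
have [_ [e eb le]] := lambdaP alpha k0; exists e => // j.
rewrite /Xseq le /sqdist -/(ldist _ _) -(powR_mulrn _ (ldist_ge0 _ _)) -powRrM.
by rewrite mulrC divfK // powR_mulrn // ldist_ge0.
Qed.

Lemma cnt_close_pairs alpha a b X :
  finite_set (lpairs alpha a b X) /\
  cnt (close_pairs alpha a b X) = cnt (lpairs alpha a b X).
Proof.
have [e [e' eK e'K] XE] := XseqE alpha.
have fc : finite_set (close_pairs alpha a b X) by exact: finite_close_pairs.
have h1 x : lpairs alpha a b X x -> close_pairs alpha a b X (e' x.1, e' x.2).
  case: x => m n [/= mn h2 h3 h4]; split => /=; rewrite ?XE ?e'K //.
  by move=> /(can_inj e'K).
have h2 x : close_pairs alpha a b X x -> lpairs alpha a b X (e x.1, e x.2).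
  by case: x => m n [/= mn]; rewrite !XE => ? ? ?; split => //= /(can_inj eK).
have i1 (x y : 'rV[int]_k * 'rV[int]_k) : (e' x.1, e' x.2) = (e' y.1, e' y.2) -> x = y.
  by case: x y => [? ?] [? ?] /= [/(can_inj e'K) -> /(can_inj e'K) ->].
have i2 (x y : nat * nat) : (e x.1, e x.2) = (e y.1, e y.2) -> x = y.
  by case: x y => [? ?] [? ?] /= [/(can_inj eK) -> /(can_inj eK) ->].
have fl : finite_set (lpairs alpha a b X).
  by apply: (finite_inj fc h1) => x y _ _; exact: i1.
split => //; apply/eqP; rewrite eqn_leq.
rewrite (cnt_inj fl h2) ?(cnt_inj fc h1) // => x y _ _; [exact: i1|exact: i2].
Qed.

Lemma R2E alpha a b X :
  R2 alpha a b X = (cnt (lpairs alpha a b X))%:R / (unit_ball_volume R k * X).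
Proof. by rewrite -(cnt_close_pairs _ _ _ _).2. Qed.

End PairsR2.

(** * Lattice points in balls *)

Section Riemann.
Variable R : realType.
Notation mu := (@lebesgue_measure R).

Lemma integral_step n (p c : nat -> R) (h : R) : 0 <= h ->
  (forall j, p j.+1 = p j + h) -> (forall j, 0 <= c j) ->
  (\int[mu]_x (\sum_(j < n) c j * \1_(`[p j, p j.+1[%classic : set R) x)%:E)%E
  = (h * \sum_(j < n) c j)%:E.
Proof.
move=> h0 ph c0.
under eq_integral do rewrite -sumEFin.
rewrite ge0_integral_sum //; first last.
- by move=> j x _; rewrite lee_fin mulr_ge0.
- move=> j; apply/measurable_EFinP; apply: measurable_funM => //.
rewrite mulr_sumr -sumEFin; apply: eq_bigr => j _.
under eq_integral do rewrite EFinM.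
rewrite ge0_integralZl; [|by []|by apply/measurable_EFinP|by move=> x _; rewrite lee_fin
  |by rewrite lee_fin].
have muE : mu (`[p j, p j.+1[%classic : set R) = h%:E.
  rewrite lebesgue_measure_itv /= lte_fin ph.
  have [h_gt0|h_le0] := ltP (p j) (p j + h); first by rewrite -EFinD; congr (_%:E); lra.
  by congr (_%:E); lra.
rewrite integral_indic // setIT mulrC EFinM; congr (_ * _)%E; exact: muE.
Qed.

Variables (g : R -> R) (rho : R).
Hypothesis g_ge0 : forall x, 0 <= g x.
Hypothesis g_supp : forall x, rho < `|x| -> g x = 0.
Hypothesis g_mono : forall x y, `|x| <= `|y| -> g y <= g x.
Hypothesis mg : measurable_fun [set: R] g.

(* Off the cell that contains 0, the oscillation of [g] on a cell is the
   difference of the values at the end points; [phi] makes it telescope. *)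
Lemma riemann_unimodal : exists2 I : R, (\int[mu]_x (g x)%:E)%E = I%:E &
  forall (p : nat -> R) (h : R) n, 0 < h -> (forall j, p j.+1 = p j + h) ->
    p 0%N < - rho -> rho < p n -> `|h * (\sum_(j < n) g (p j)) - I| <= 3 * h * g 0.
Proof.
pose phi (p : nat -> R) j := if 0 <= p j then g (p j) else 3 * g 0 - g (p j).
have g_le0 x : g x <= g 0 by apply: g_mono; rewrite normr0.
have phi_cell (p : nat -> R) (h : R) j (x : R) : 0 < h -> (forall j, p j.+1 = p j + h) ->
    x \in `[p j, p j.+1[ -> `|g x - g (p j)| <= phi p j - phi p j.+1.
  move=> h0 ph; rewrite in_itv /= => /andP[px xp]; rewrite /phi.
  have := g_le0 x; have := g_le0 (p j); have := g_le0 (p j.+1).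
  have := g_ge0 x; have := g_ge0 (p j); have := g_ge0 (p j.+1).
  case: (leP 0 (p j)) => pj.
    have pj1 : 0 <= p j.+1 by rewrite ph; lra.
    have h1 : g x <= g (p j) by apply: g_mono; rewrite !ger0_norm; lra.
    have h2 : g (p j.+1) <= g x by apply: g_mono; rewrite !ger0_norm; lra.
    by rewrite pj1 => *; rewrite ler_norml; apply/andP; split; lra.
  case: (leP 0 (p j.+1)) => pj1.
    by move=> *; rewrite ler_norml; apply/andP; split; lra.
  have h1 : g (p j) <= g x by apply: g_mono; rewrite !ler0_norm; lra.
  have h2 : g x <= g (p j.+1) by apply: g_mono; rewrite !ler0_norm; lra.
  by move=> *; rewrite ler_norml; apply/andP; split; lra.
have phi0 (p : nat -> R) j : 0 <= phi p j <= 3 * g 0.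
  by rewrite /phi; have := g_le0 (p j); have := g_ge0 (p j); case: ifP => _ ? ?; lra.
have dphi (p : nat -> R) (h : R) j : 0 < h -> (forall j, p j.+1 = p j + h) -> 0 <= phi p j - phi p j.+1.
  move=> h0 ph; apply: le_trans (phi_cell p h j (p j) h0 ph _) => //.
  by rewrite in_itv /= lexx ph; lra.
have tele p n : \sum_(j < n) (phi p j - phi p j.+1) <= 3 * g 0.
  rewrite -(big_mkord xpredT (fun j => phi p j - phi p j.+1)).
  rewrite (telescope_sumr_eq (fun j => - phi p j)) //; last by move=> j _; ring.
  by have /andP[? ?] := phi0 p 0%N; have /andP[? ?] := phi0 p n; lra.
have meas_step n (p c : nat -> R) : measurable_fun [set: R]
   (fun x => \sum_(j < n) c j * \1_(`[p j, p j.+1[%classic : set R) x).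
  by apply: measurable_sum => j; apply: measurable_funM.
have pE (p : nat -> R) (h : R) j : (forall j, p j.+1 = p j + h) -> p j = p 0%N + j%:R * h.
  by move=> ph; elim: j => [|j IH]; [rewrite mul0r addr0|rewrite ph IH -natr1; ring].
(* Since the grid covers $[-\rho,\rho]$, a point lies either in exactly one cell or where [g]
   vanishes. The coefficients [c] are quantified inside, so that one cell serves several step
   functions at the same point. *)
have cell (p : nat -> R) (h : R) n (x : R) : 0 < h -> (forall j, p j.+1 = p j + h) ->
    p 0%N < - rho -> rho < p n ->
    (exists2 i : 'I_n, x \in `[p i, p i.+1[ &
      forall c : nat -> R, \sum_(j < n) c j * \1_(`[p j, p j.+1[%classic : set R) x = c i)
    \/ (g x = 0 /\
      forall c : nat -> R, \sum_(j < n) c j * \1_(`[p j, p j.+1[%classic : set R) x = 0).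
  move=> h0 ph p0 pn.
  have [xp|xp] := boolP ((p 0%N <= x) && (x < p n)); last first.
    right; split.
      apply: g_supp; move: xp; rewrite negb_and -ltNge -leNgt => /orP[|] xp.
        by rewrite lter_normr; apply/orP; right; lra.
      by rewrite lter_normr; apply/orP; left; lra.
    move=> c'; apply: big1 => j _; rewrite indicE memNset ?mulr0 //= in_itv /=.
    move=> /andP[h1 h2]; move/negP: xp; apply; apply/andP; split.
      by apply: le_trans h1; rewrite (pE p h j) // lerDl mulr_ge0 // ltW.
    apply: lt_le_trans h2 _; rewrite (pE p h j.+1) // (pE p h n) // lerD2l.
    by rewrite ler_pM2r // ler_nat.
  left; case/andP: xp => xp0 xpn.
  pose i := Num.truncn ((x - p 0%N) / h).
  have /andP[i1 i2] : i%:R <= (x - p 0%N) / h < i.+1%:R.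
    by apply: Num.Theory.truncn_itv; rewrite divr_ge0 ?subr_ge0 // ltW.
  rewrite ler_pdivlMr // in i1; rewrite ltr_pdivrMr // in i2.
  have iE j : x \in `[p j, p j.+1[ = (j == i).
    rewrite in_itv /= (pE p h j) // (pE p h j.+1) //; apply/idP/eqP => [/andP[j1 j2]|->].
      have h1 : (j%:R : R) < i.+1%:R by rewrite -(ltr_pM2r h0); lra.
      have h2 : (i%:R : R) < j.+1%:R by rewrite -(ltr_pM2r h0); lra.
      by rewrite !ltr_nat in h1 h2; apply/eqP; rewrite eqn_leq; lia.
    by apply/andP; split; lra.
  have i_n : (i < n)%N.
    by rewrite -(ltr_nat R) -(ltr_pM2r h0); rewrite (pE p h n) // in xpn; lra.
  exists (Ordinal i_n) => /= [|c']; first by rewrite iE.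
  rewrite (bigD1 (Ordinal i_n)) //= indicE mem_set /= ?iE // mulr1.
  rewrite big1 ?addr0 // => j /negP ji; rewrite indicE memNset ?mulr0 //= iE.
  by apply: contra_not ji => /eqP ji; apply/eqP/val_inj.
have key (p : nat -> R) (h : R) n : 0 < h -> (forall j, p j.+1 = p j + h) -> p 0%N < - rho -> rho < p n ->
   (\int[mu]_x (g x)%:E <= (h * (\sum_(j < n) g (p j)) + 3 * h * g 0)%:E)%E /\
   ((h * (\sum_(j < n) g (p j)))%:E <= \int[mu]_x (g x)%:E + (3 * h * g 0)%:E)%E.
  move=> h0 ph p0 pn; have h0' := ltW h0.
  have le3 : h * \sum_(j < n) (phi p j - phi p j.+1) <= 3 * h * g 0.
    by have := tele p n; rewrite -(ler_pM2l h0) => ?; lra.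
  split.
    apply: (@le_trans _ _ (h * (\sum_(j < n) (g (p j) + (phi p j - phi p j.+1))))%:E); last first.
      by rewrite lee_fin big_split /= mulrDr; lra.
    rewrite -(@integral_step n p (fun j => g (p j) + (phi p j - phi p j.+1)) h h0' ph) => [|j];
      last by rewrite addr_ge0 // (dphi p h).
    apply: ge0_le_integral; [by []|by move=> x _; exact: g_ge0|by apply/measurable_EFinP
      |apply/measurable_EFinP; exact: (meas_step n p (fun j => g (p j) + (phi p j - phi p j.+1)))|].
    move=> x _; rewrite lee_fin.
    case: (cell p h n x h0 ph p0 pn) => [[i xi cE]|[-> cE]];
      rewrite (cE (fun j => g (p j) + (phi p j - phi p j.+1))) //.
    by have := phi_cell p h i x h0 ph xi; rewrite ler_norml => /andP[_ ?]; lra.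
  apply: (@le_trans _ _ (\int[mu]_x (g x)%:E + (h * \sum_(j < n) (phi p j - phi p j.+1))%:E)%E);
    last by apply: leeD => //; rewrite lee_fin.
  rewrite -(@integral_step n p (fun j => g (p j)) h h0' ph) //.
  rewrite -(@integral_step n p (fun j => phi p j - phi p j.+1) h h0' ph) => [|j];
    last by rewrite (dphi p h).
  have ms1 := meas_step n p (fun j => g (p j)).
  have ms2 := meas_step n p (fun j => phi p j - phi p j.+1).
  rewrite -ge0_integralD; [|by []|by move=> x _; exact: g_ge0|by apply/measurable_EFinP| |
    by apply/measurable_EFinP]; last first.
    move=> x _; rewrite lee_fin; apply: sumr_ge0 => i _; rewrite mulr_ge0 //.
    by rewrite (dphi p h).
  apply: ge0_le_integral; [by []| |by apply/measurable_EFinP| |].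
  - by move=> x _; rewrite lee_fin; apply: sumr_ge0 => i _; rewrite mulr_ge0.
  - by apply: emeasurable_funD; apply/measurable_EFinP.
  move=> x _; rewrite -EFinD lee_fin.
  case: (cell p h n x h0 ph p0 pn) => [[i xi cE]|[-> cE]]; rewrite (cE (fun j => g (p j)))
    (cE (fun j => phi p j - phi p j.+1)) ?addr0 //.
  by have := phi_cell p h i x h0 ph xi; rewrite ler_norml => /andP[? _]; lra.
have I0 : (0 <= \int[mu]_x (g x)%:E)%E by apply: integral_ge0 => x _; exact: g_ge0.
(* Finiteness follows from the upper half of [key] at mesh 1: the integral is at most a finite
   Riemann sum. *)
have fin : (\int[mu]_x (g x)%:E)%E \is a fin_num.
  pose q (j : nat) : R := - (`|rho| + 1) + j%:R * 1.
  rewrite ge0_fin_numE //.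
  have [n hn] : exists n : nat, `|rho| + (`|rho| + 1) < n%:R.
    by exists (Num.bound (`|rho| + (`|rho| + 1))); apply: archi_boundP; rewrite !addr_ge0.
  have := ler_norm rho => ?.
  have qS j : q j.+1 = q j + 1 by rewrite /q -natr1; ring.
  have q0 : q 0%N < - rho by rewrite /q mul0r; lra.
  have qn : rho < q n by rewrite /q mulr1; lra.
  have [/le_lt_trans h _] := key q 1 n ltr01 qS q0 qn.
  by apply: h; rewrite ltry.
exists (fine (\int[mu]_x (g x)%:E)) => [|p h n h0 ph p0 pn]; first by rewrite fineK.
have [] := key p h n h0 ph p0 pn.
rewrite -(fineK fin) lee_fin -EFinD lee_fin => h1 h2.
by rewrite ler_norml; apply/andP; split; lra.
Qed.

End Riemann.

Section CountingTools.

Lemma cnt_II n : cnt `I_n = n.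
Proof. by apply: card_fset_set; exact: card_eqxx. Qed.

Lemma cnt0 (T : choiceType) : cnt (set0 : set T) = 0%N.
Proof. by rewrite /cnt fset_set0. Qed.

Lemma cnt_fiber (T : choiceType) (A : set T) (h : T -> nat) n : finite_set A ->
  (forall x, A x -> (h x < n)%N) ->
  cnt A = (\sum_(j < n) cnt [set x | A x /\ h x = j])%N.
Proof.
move=> fA hn; rewrite {1}/cnt -sum1_size.
rewrite [LHS](_ : _ = \sum_(x <- fset_set A) \sum_(j < n) (h x == j)%N)%N; last first.
  rewrite big_seq [RHS]big_seq; apply: eq_bigr => x xA.
  have hx : (h x < n)%N by apply: hn; move: xA; rewrite in_fset_set // inE.
  rewrite (bigD1 (Ordinal hx)) //= eqxx big1 // => j /negP ji.
  by apply/eqP; rewrite eqb0; apply/negP => /eqP hj; apply: ji; apply/eqP/val_inj.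
rewrite exchange_big /=; apply: eq_bigr => j _.
have := @sum_fset_indic int T (fset_set A) (fun x => h x == j).
rewrite -natr_sum => /eqP; rewrite eqr_nat => /eqP ->; congr (cnt _).
by apply/seteqP; split => x /=; rewrite in_fset_set // inE => -[? /eqP].
Qed.

Lemma int_count (R : realType) (T : choiceType) (A : set T) (f : T -> int) (x l : R) :
  0 <= l -> (forall t, A t -> x <= (f t)%:~R <= x + l) ->
  (forall s t, A s -> A t -> f s = f t -> s = t) ->
  finite_set A /\ (cnt A)%:R <= l + 1.
Proof.
move=> l0 Ax fI; pose c := Num.ceil x; pose n := (Num.truncn l).+1.
have h1 t : A t -> (c <= f t)%R by move=> /Ax /andP[h _]; rewrite ceil_le_int.
have h2 t : A t -> (`|f t - c|%N < n)%N.
  move=> At; have /andP[_ h] := Ax t At; rewrite /n ltnS.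
  have := h1 t At; rewrite -subr_ge0 => h3.
  rewrite truncn_ge_nat // pmulrn gez0_abs // intrB.
  by have := ceil_ge x; rewrite -/c; lra.
have i s t : A s -> A t -> `|f s - c|%N = `|f t - c|%N -> s = t.
  move=> As At; have := h1 s As; have := h1 t At; move=> ? ? e; apply: fI => //; lia.
split; first exact: (finite_inj (finite_II n) h2 i).
apply: (@le_trans _ _ n%:R); last first.
  by rewrite /n -natr1 lerD2r truncn_le.
by rewrite ler_nat -[n]cnt_II; exact: (cnt_inj (finite_II n) h2 i).
Qed.

End CountingTools.

(** * Slices of a ball *)

Section LatticeVolume.
Variable R : realType.
Notation mu := (@lebesgue_measure R).

Lemma enorm_row_mx k (x : R) (y : 'rV[R]_k) :
  euclidean_norm (row_mx (x%:M : 'rV[R]_1) y) ^+ 2 = x ^+ 2 + euclidean_norm y ^+ 2.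
Proof.
rewrite !enorm_sqr big_split_ord big_ord1 /= row_mxEl mxE eqxx mulr1n; congr (_ + _).
by apply: eq_bigr => i _; rewrite row_mxEr.
Qed.

Lemma enorm_row_mx_le k (x rho : R) (y : 'rV[R]_k) : 0 <= rho -> `|x| <= rho ->
  (euclidean_norm (row_mx (x%:M : 'rV[R]_1) y) <= rho) =
  (euclidean_norm y <= Num.sqrt (rho ^+ 2 - x ^+ 2)).
Proof.
move=> rho0 xr; have h : 0 <= rho ^+ 2 - x ^+ 2.
  by rewrite subr_ge0 -[x ^+ 2]real_normK ?num_real // ler_pXn2r ?nnegrE.
rewrite -(@ler_pXn2r R 2) ?nnegrE ?enorm_ge0 // enorm_row_mx.
rewrite -[RHS](@ler_pXn2r R 2) ?nnegrE ?enorm_ge0 ?sqrtr_ge0 //.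
rewrite [X in _ = (_ <= X)]sqr_sqrtr //.
by rewrite lerBrDl.
Qed.

Lemma enorm_row_mx_gt k (x rho : R) (y : 'rV[R]_k) : rho < `|x| ->
  rho < euclidean_norm (row_mx (x%:M : 'rV[R]_1) y).
Proof.
move=> h; apply: lt_le_trans h _.
by have := enorm_coord (row_mx (x%:M : 'rV[R]_1) y) (lshift k ord0); rewrite row_mxEl mxE eqxx mulr1n.
Qed.

(** If [b] is the volume of the unit ball in dimension [k], this is the volume of the slice at
    height [x] of the ball of radius [rho] in dimension [k + 1]. *)
Definition slice_fun k (b rho x : R) : R :=
  if `|x| <= rho then b * Num.sqrt (rho ^+ 2 - x ^+ 2) ^+ k else 0.

Section SliceFun.
Variables (k : nat) (b rho : R).
Hypothesis b0 : 0 <= b.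
Local Notation g := (slice_fun k b rho).

Lemma slice_fun_ge0 x : 0 <= g x.
Proof. by rewrite /slice_fun; case: ifP => // _; rewrite mulr_ge0 // exprn_ge0 ?sqrtr_ge0. Qed.

Lemma slice_fun_supp x : rho < `|x| -> g x = 0.
Proof. by rewrite /slice_fun ltNge => /negbTE ->. Qed.

Lemma slice_fun_mono x y : `|x| <= `|y| -> g y <= g x.
Proof.
move=> xy; rewrite {1}/slice_fun; case: ifP => [yr|_]; last exact: slice_fun_ge0.
rewrite /slice_fun (le_trans xy yr) ler_wpM2l // lerXn2r ?nnegrE ?sqrtr_ge0 //.
rewrite ler_wsqrtr // lerD2l lerN2.
by rewrite -[x ^+ 2]real_normK ?num_real // -[y ^+ 2]real_normK ?num_real // ler_pXn2r ?nnegrE.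
Qed.

Lemma slice_fun_measurable : measurable_fun [set: R] g.
Proof.
have -> : g = fun x => \1_(`[- rho, rho]%classic : set R) x *
    (b * Num.sqrt (rho ^+ 2 - x ^+ 2) ^+ k).
  apply/funext => x; rewrite /slice_fun indicE ler_norml.
  case: ifP => h; first by rewrite mem_set ?mul1r //= in_itv.
  by rewrite memNset ?mul0r //= in_itv /= h.
apply: measurable_funM => //; apply: measurable_funM => //.
apply: measurable_funX; apply: continuous_measurable_fun => x.
apply: (@continuous_comp _ _ _ (fun x : R => rho ^+ 2 - x ^+ 2) Num.sqrt).
  by apply: cvgB; [exact: cvg_cst|exact: exprn_continuous].
exact: sqrt_continuous.
Qed.

Lemma slice_fun0 : 0 <= rho -> g 0 = b * rho ^+ k.
Proof. by move=> r0; rewrite /slice_fun normr0 r0 expr0n /= subr0 sqrtr_sqr ger0_norm. Qed.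

End SliceFun.

Lemma slice_fun_scale k b rho x : 0 < rho ->
  slice_fun k b rho (rho * x) = rho ^+ k * slice_fun k b 1 x.
Proof.
move=> r0; rewrite /slice_fun normrM (gtr0_norm r0) -[X in _ <= X]mulr1 ler_pM2l //.
case: ifP => _; last by rewrite mulr0.
rewrite mulrCA -exprMn; congr (_ * _ ^+ _).
have -> : rho ^+ 2 - (rho * x) ^+ 2 = rho ^+ 2 * (1 ^+ 2 - x ^+ 2) by ring.
by rewrite sqrtrM ?sqr_ge0 // sqrtr_sqr gtr0_norm.
Qed.

Lemma eq0_small (A C : R) : (forall h, 0 < h -> `|A| <= C * h) -> A = 0.
Proof.
move=> H; apply/eqP/negPn/negP => A0.
have nA : 0 < `|A| by rewrite normr_gt0.
have C0 : 0 < C by have := H 1 ltr01; rewrite mulr1; apply: lt_le_trans.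
have h0 : 0 < `|A| / (2 * C) by rewrite divr_gt0 ?mulr_gt0.
have := H _ h0; have -> : C * (`|A| / (2 * C)) = `|A| / 2 by field; rewrite ?gt_eqF.
lra.
Qed.

Lemma grid_exists (rho h s : R) : 0 < h -> exists p : nat -> R, exists n,
  [/\ forall j, p j.+1 = p j + h, p 0%N < - rho & rho < p n].
Proof.
move=> h0; exists (fun j => - (`|rho| + 1) + j%:R * h).
exists (Num.bound ((`|rho| + (`|rho| + 1)) / h)).
have := ler_norm rho => ?; split => [j||]; first by rewrite -natr1; ring.
  by rewrite mul0r; lra.
have : (`|rho| + (`|rho| + 1)) / h < (Num.bound ((`|rho| + (`|rho| + 1)) / h))%:R.
  by apply: archi_boundP; rewrite divr_ge0 // ?ltW // !addr_ge0.
by rewrite ltr_pdivrMr //; lra.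
Qed.

(** Homogeneity in [rho] needs no change of variables: mesh [h] on radius [rho] and mesh [h / rho]
    on radius 1 give the same Riemann sum up to the factor $\rho^{k+1}$, and [h] is arbitrary. The
    estimate with mesh 1 is the one that compares slices at integral heights with the volume. *)
Lemma slice_integral k (b : R) : 0 < b -> exists2 b' : R, 0 < b' & forall rho, 0 <= rho ->
  [/\ (\int[mu]_x (slice_fun k b rho x)%:E)%E = (b' * rho ^+ k.+1)%:E &
   forall (p : nat -> R) n, (forall j, p j.+1 = p j + 1) ->
    p 0%N < - rho -> rho < p n ->
    `|\sum_(j < n) slice_fun k b rho (p j) - b' * rho ^+ k.+1| <= 3 * b * rho ^+ k].
Proof.
move=> b0; have b0' := ltW b0.
have rie rho := riemann_unimodal (slice_fun_ge0 k rho b0') (@slice_fun_supp k b rho)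
  (slice_fun_mono k rho b0') (slice_fun_measurable k b rho).
have [I I1 IR] := rie 1.
have main rho : 0 <= rho -> (\int[mu]_x (slice_fun k b rho x)%:E)%E = (I * rho ^+ k.+1)%:E.
  rewrite le_eqVlt => /orP[/eqP r0|r0].
    (* For radius 0 a single cell around 0 is used; its left end point is outside the support, so
       the Riemann sum vanishes. *)
    rewrite -r0 expr0n mulr0; have [J -> JR] := rie 0.
    congr (_%:E); apply: (@eq0_small _ (3 * slice_fun k b 0 0)) => h h0.
    have ph (j : nat) : - (h / 2) + j.+1%:R * h = - (h / 2) + j%:R * h + h by rewrite -natr1; ring.
    have := JR (fun j => - (h / 2) + j%:R * h) h 1%N h0 ph.
    rewrite big_ord1 !mul0r mul1r slice_fun_supp; last first.
      by rewrite addr0 normrN gtr0_norm; lra.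
    by rewrite mulr0 sub0r normrN => /(_ _ _) H; have := H ltac:(lra) ltac:(lra); lra.
  have [J -> JR] := rie rho; congr (_%:E); apply/eqP; rewrite -subr_eq0; apply/eqP.
  apply: (@eq0_small _ (3 * slice_fun k b rho 0 + rho ^+ k * (3 * slice_fun k b 1 0))) => h h0.
  have hr : 0 < h / rho by rewrite divr_gt0.
  have [p [n [ph p0 pn]]] := @grid_exists 1 (h / rho) 0 hr.
  have H1 := IR p (h / rho) n hr ph p0 pn.
  have H2 : `|h * (\sum_(j < n) slice_fun k b rho (rho * p j)) - J| <=
            3 * h * slice_fun k b rho 0.
    apply: (JR (fun j => rho * p j) h n h0) => [j||].
    - by rewrite ph mulrDr; congr (_ + _); rewrite mulrC divfK ?gt_eqF.
    - by rewrite -[X in _ < X]mulN1r mulrC ltr_pM2r.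
    - by rewrite -[X in X < _]mulr1 ltr_pM2l.
  have e1 : h * (\sum_(j < n) slice_fun k b rho (rho * p j)) =
       rho ^+ k.+1 * (h / rho * (\sum_(j < n) slice_fun k b 1 (p j))).
    under eq_bigr do rewrite slice_fun_scale //.
    by rewrite -mulr_sumr exprS; field; rewrite gt_eqF.
  rewrite e1 in H2.
  have H3 : `|rho ^+ k.+1 * (h / rho * (\sum_(j < n) slice_fun k b 1 (p j))) - rho ^+ k.+1 * I|
     <= rho ^+ k * (3 * h * slice_fun k b 1 0).
    rewrite -mulrBr normrM ger0_norm; last by rewrite exprn_ge0 // ltW.
    have r0' : 0 <= rho ^+ k.+1 by rewrite exprn_ge0 // ltW.
    apply: (le_trans (ler_wpM2l r0' H1)).
    by rewrite exprSr le_eqVlt; apply/orP/or_introl/eqP; field; rewrite gt_eqF.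
  move: H2 H3; rewrite !ler_norml => /andP[? ?] /andP[? ?].
  by apply/andP; split; lra.
exists I.
  (* Positivity: on the unit interval around 0 the integrand is at least its value at 1/2. *)
  have s0 : 0 < b * Num.sqrt (1 - 2^-1 ^+ 2) ^+ k.
    rewrite mulr_gt0 // exprn_gt0 // sqrtr_gt0.
    by rewrite expr2; lra.
  rewrite -lte_fin; apply: (@lt_le_trans _ _ (b * Num.sqrt (1 - 2^-1 ^+ 2) ^+ k)%:E);
    first by rewrite lte_fin.
  rewrite -I1.
  have ph (j : nat) : - 2^-1 + j.+1%:R = - 2^-1 + j%:R + 1 :> R by rewrite -natr1; ring.
  have := @integral_step R 1 (fun j => - 2^-1 + j%:R) (fun=> b * Num.sqrt (1 - 2^-1 ^+ 2) ^+ k)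
    1 ler01 ph (fun=> ltW s0).
  rewrite big_ord1 mul1r => <-.
  apply: ge0_le_integral; [by []| | | |].
  - move=> x _; rewrite lee_fin; apply: sumr_ge0 => i _; rewrite mulr_ge0 //; exact: ltW.
  - apply/measurable_EFinP; apply: measurable_sum => j; exact: measurable_funM.
  - by apply/measurable_EFinP; exact: slice_fun_measurable.
  move=> x _; rewrite lee_fin big_ord1 indicE /= addr0.
  have [|] := boolP (x \in _); last by rewrite mulr0 slice_fun_ge0.
  rewrite inE /= in_itv /= => /andP[x1 x2].
  have -> : b * Num.sqrt (1 - 2^-1 ^+ 2) ^+ k * true%:R = slice_fun k b 1 (2^-1).
    by rewrite /slice_fun mulr1 expr1n ifT // ger0_norm; lra.
  by apply: slice_fun_mono => //; rewrite (@ger0_norm _ 2^-1) // ler_norml; apply/andP; split; lra.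
move=> rho r0; split; first exact: main.
move=> p n ph p0 pn; have [J JE JR] := rie rho.
have := JR p 1 n ltr01 ph p0 pn; rewrite mul1r mulr1 slice_fun0 //.
have -> : J = I * rho ^+ k.+1 by have := main rho r0; rewrite JE => -[].
lra.
Qed.

End LatticeVolume.

Section LatticeCount.
Variable R : realType.

Lemma lebesgue_volume_set0 k : lebesgue_volume (set0 : set 'rV[R]_k) = 0%E.
Proof.
elim: k => [|k IH] /=; first by rewrite indicE memNset.
rewrite (_ : (fun x : R => _) = cst 0%E) ?integral0 //.
by apply/funext => x; rewrite -[RHS]IH; congr lebesgue_volume.
Qed.

Definition nball k (alpha : 'rV[R]_k) (rho : R) : set 'rV[int]_k :=
  [set m | ldist alpha m <= rho].

Lemma finite_nball k (alpha : 'rV[R]_k) rho : finite_set (nball alpha rho).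
Proof.
apply: sub_finite_set (finite_sqdist_le alpha (rho ^+ 2)) => m /= h.
by rewrite /sqdist ler_pXn2r ?nnegrE ?enorm_ge0 // (le_trans (enorm_ge0 _) h).
Qed.

Lemma ldist_row_mx k (a : R) (alpha : 'rV[R]_k) (z : int) (m : 'rV[int]_k) :
  map_mx intr (row_mx (z%:M : 'rV[int]_1) m) - row_mx (a%:M : 'rV[R]_1) alpha =
  row_mx ((z%:~R - a)%:M : 'rV[R]_1) (map_mx intr m - alpha).
Proof.
rewrite map_row_mx opp_row_mx add_row_mx; congr row_mx; apply/matrixP => i j.
by rewrite !mxE !ord1 eqxx !mulr1n.
Qed.

Lemma row_mx_split (T : pzRingType) k (x : 'rV[T]_(1 + k)) :
  x = row_mx ((x 0 0)%:M : 'rV[T]_1) (rsubmx x).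
Proof.
rewrite -[LHS]hsubmxK [lsubmx x]mx11_scalar; congr (row_mx _%:M _).
by rewrite mxE; congr (x _ _); apply: val_inj.
Qed.

Lemma sum_near_count (p : nat -> R) n (rho : R) : (forall j, p j.+1 = p j + 1) ->
  0 <= rho -> \sum_(j < n) (`|p j| <= rho)%R%:R <= 2 * rho + 1 :> R.
Proof.
move=> ph r0; rewrite sum_fin_indic.
have pE j : p j = p 0%N + j%:R by elim: j => [|j IH]; rewrite ?addr0 // ph IH -natr1 addrA.
apply: (@int_count R _ _ (fun j : 'I_n => j%:Z) (- rho - p 0%N) (2 * rho) _ _ _).2.
- lra.
- move=> j /=; rewrite pE ler_norml -pmulrn => /andP[? ?]; apply/andP; split; lra.
- by move=> s t _ _ [/val_inj].
Qed.

(** Induction on the dimension, slicing along the first coordinate. The slices at integral heights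
    are balls one dimension lower; the errors of at most $2\rho+1$ slices and the Riemann error are
    both of order $(1+\rho)^k$. The factor [k%:R] lets the exact count in dimension 0 fit the same
    formula. Uniformity in [alpha] is essential later, where [alpha] is averaged. *)
Theorem lattice_count k : exists b C : R, [/\ 0 < b, 0 <= C,
  forall rho, 0 <= rho ->
    lebesgue_volume [set x : 'rV[R]_k | euclidean_norm x <= rho] = (b * rho ^+ k)%:E &
  forall (alpha : 'rV[R]_k) rho, 0 <= rho ->
    `|(cnt (nball alpha rho))%:R - b * rho ^+ k| <= C * k%:R * (1 + rho) ^+ k.-1].
Proof.
elim: k => [|k [b [C [b0 C0 vol IH]]]].
  exists 1, 0; split => // [rho r0|alpha rho r0] /=.
    by rewrite indicE mem_set ?expr0 ?mulr1 //= /euclidean_norm big_ord0 sqrtr0.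
  rewrite expr0 mulr1 mulr0 mul0r (_ : cnt _ = 1%N) ?subrr ?normr0 //.
  rewrite -[RHS](cardfs1 (0 : 'rV[int]_0)) /cnt; congr (size (enum_fset _)).
  apply/fsetP => m; rewrite in_fset_set ?in_fset1; last exact: finite_nball.
  rewrite [m]thinmx0 eqxx; apply: mem_set.
  by rewrite /nball /= /ldist /euclidean_norm big_ord0 sqrtr0.
have [I I0 HI] := slice_integral k b0.
exists I, (2 * C + 3 * b); split => // [|rho r0|alpha rho r0]; first by lra.
  rewrite -(HI rho r0).1 /=; apply: eq_integral => x _.
  rewrite /slice_fun; case: (leP `|x| rho) => xr.
    rewrite -vol ?sqrtr_ge0 //; congr lebesgue_volume; apply/seteqP; split => y /=;
    by rewrite enorm_row_mx_le.
  rewrite -[RHS](lebesgue_volume_set0 k); congr lebesgue_volume; apply/seteqP; split => y //=.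
  by rewrite leNgt enorm_row_mx_gt.
pose a : R := alpha 0 0; pose alpha' : 'rV[R]_k := rsubmx (alpha : 'rV[R]_(1 + k)).
have aE : alpha = row_mx (a%:M : 'rV[R]_1) alpha' by exact: (@row_mx_split R k alpha).
have a0 : 0 <= `|a| by [].
pose M := Num.bound (rho + `|a| + 1).
have hM : rho + `|a| + 1 < M%:R by apply: archi_boundP; rewrite !addr_ge0.
(* Heights of the slices relative to [alpha]; [M] is so large that they reach beyond the ball on
   both sides. *)
pose p (j : nat) : R := j%:R - M%:R - a.
have ph j : p j.+1 = p j + 1 by rewrite /p -natr1; ring.
have := ler_norm a; have := ler_norm (- a); rewrite normrN => aN aP.
have p0 : p 0%N < - rho by rewrite /p; lra.
have pn : rho < p (2 * M)%N by rewrite /p natrM; lra.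
have [_ /(_ p (2 * M)%N ph p0 pn) HS] := HI rho r0.
pose r j : R := Num.sqrt (rho ^+ 2 - p j ^+ 2).
have ldistE z m : ldist alpha (row_mx ((z%:Z - M%:Z)%:M : 'rV[int]_1) m) =
    euclidean_norm (row_mx ((p z)%:M : 'rV[R]_1) (map_mx intr m - alpha')).
  by rewrite /ldist aE ldist_row_mx intrB -!pmulrn.
have fin := finite_nball alpha rho.
pose h (m : 'rV[int]_k.+1) := absz (m 0 0 + M%:Z).
have mE (m : 'rV[int]_k.+1) : nball alpha rho m ->
    exists j : nat, exists y, [/\ (j < 2 * M)%N, h m = j, `|p j| <= rho &
      m = row_mx ((j%:Z - M%:Z)%:M : 'rV[int]_1) y].
  move=> mb; have := le_trans (ldist_coord alpha m 0) mb; rewrite ler_norml => /andP[h1 h2].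
  rewrite -/a in h1 h2.
  have h3 : (0 <= m 0 0 + M%:Z)%R.
    by rewrite -(ler_int R) intrD -[(M%:Z)%:~R]pmulrn; lra.
  have h4 : (m 0 0 + M%:Z < (2 * M)%N%:Z)%R.
    by rewrite -(ltr_int R) intrD -[(M%:Z)%:~R]pmulrn -[((2 * M)%N%:Z)%:~R]pmulrn natrM; lra.
  have h5 : (h m)%:Z = m 0 0 + M%:Z by rewrite /h gez0_abs.
  have m0 : m 0 0 = (h m)%:Z - M%:Z by rewrite h5; ring.
  exists (h m), (rsubmx (m : 'rV[int]_(1 + k))); split => //.
  - by rewrite -ltz_nat h5.
  - by rewrite /p pmulrn h5 intrD -[(M%:Z)%:~R]pmulrn ler_norml; apply/andP; split; lra.
  - by rewrite -m0; exact: (@row_mx_split int k m).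
rewrite (@cnt_fiber _ _ h (2 * M)%N fin); last first.
  by move=> m /mE[j [y [jM -> _ _]]].
rewrite natr_sum.
have slice (j : 'I_(2 * M)) : `|p j| <= rho ->
    cnt [set m | nball alpha rho m /\ h m = j] = cnt (nball alpha' (r j)).
  move=> pj; apply/eqP; rewrite eqn_leq; apply/andP; split.
    apply: (@cnt_inj _ _ (fun m : 'rV[int]_k.+1 => rsubmx (m : 'rV[int]_(1 + k)))).
    + exact: finite_nball.
    + move=> m [mb hm]; have [j' [y [_ hj' _ mE']]] := mE m mb.
      move: mb; rewrite /nball /= mE' row_mxKr ldistE -hj' hm enorm_row_mx_le //.
    + move=> m m' [/mE[j1 [y1 [_ h1 _ m1E]]] hm] [/mE[j2 [y2 [_ h2 _ m2E]]] hm'].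
      by rewrite m1E m2E !row_mxKr -h1 -h2 hm hm' => ->.
  apply: (@cnt_inj _ _ (fun y => row_mx ((j%:Z - M%:Z)%:M : 'rV[int]_1) y)).
  + by apply: sub_finite_set fin => m [].
  + move=> y yb; split; first by rewrite /nball /= ldistE enorm_row_mx_le.
    have := @row_mxEl int 1 1 k ((j%:Z - M%:Z)%:M) y 0 0.
    rewrite [in RHS]mxE eqxx mulr1n (_ : lshift k 0 = 0); last exact: val_inj.
    by rewrite /h => ->; rewrite subrK absz_nat.
  + by move=> y y' _ _ /eq_row_mx[].
have slice0 (j : 'I_(2 * M)) : ~~ (`|p j| <= rho) ->
    cnt [set m | nball alpha rho m /\ h m = j] = 0%N.
  move=> pj; rewrite -[RHS](cnt0 'rV[int]_k.+1); congr cnt; apply/seteqP; split => m //=.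
  by move=> [/mE[j' [y [_ <- pj' _]]] hm]; move: pj; rewrite -hm pj'.
have pos1 : 0 <= (1 + rho) ^+ k.-1 by rewrite exprn_ge0 // addr_ge0.
have step1 : `|\sum_(j < 2 * M) ((cnt [set m | nball alpha rho m /\ h m = j])%:R : R) -
    \sum_(j < 2 * M) slice_fun k b rho (p j)| <= C * k%:R * (1 + rho) ^+ k.-1 * (2 * rho + 1).
  rewrite -sumrB; apply: le_trans (ler_norm_sum _ _ _) _.
  apply: (@le_trans _ _ (\sum_(j < 2 * M) (C * k%:R * (1 + rho) ^+ k.-1) * (`|p j| <= rho)%R%:R)).
    apply: ler_sum => j _; have [pj|pj] := boolP (`|p j| <= rho); last first.
      by rewrite slice0 // slice_fun_supp ?subrr ?normr0 ?mulr0 // ltNge.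
    rewrite slice // /slice_fun pj -/(r j) mulr1.
    apply: le_trans (IH alpha' (r j) (sqrtr_ge0 _)) _.
    rewrite ler_wpM2l ?mulr_ge0 // lerXn2r ?nnegrE ?addr_ge0 ?sqrtr_ge0 // lerD2l.
    by rewrite -[leRHS](ger0_norm r0) -sqrtr_sqr ler_wsqrtr // gerBl sqr_ge0.
  by rewrite -mulr_sumr ler_wpM2l ?mulr_ge0 ?sum_near_count.
have step2 : rho ^+ k <= (1 + rho) ^+ k by rewrite lerXn2r ?nnegrE ?addr_ge0 // lerDr.
have step3 : C * k%:R * (1 + rho) ^+ k.-1 * (2 * rho + 1) <= 2 * C * k%:R * (1 + rho) ^+ k.
  case: (k) => [|k']; first by rewrite !(mulr0, mul0r).
  have pos2 : 0 <= (1 + rho) ^+ k' by rewrite exprn_ge0 // addr_ge0.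
  have pos3 : 0 <= C * k'.+1%:R * (1 + rho) ^+ k' by rewrite !mulr_ge0.
  by rewrite /= exprS; have := mulr_ge0 pos3 r0; lra.
have step4 : 3 * b * rho ^+ k <= 3 * b * (1 + rho) ^+ k by rewrite ler_wpM2l // ltW; lra.
have pos4 : 0 <= (1 + rho) ^+ k by rewrite exprn_ge0 // addr_ge0.
rewrite -(subrKA (\sum_(j < 2 * M) slice_fun k b rho (p j))).
apply: le_trans (ler_normD _ _) _; apply: le_trans (lerD step1 HS) _.
apply: le_trans (lerD step3 step4) _.
rewrite /= -[k.+1%:R]natr1 -subr_ge0.
have -> : (2 * C + 3 * b) * (k%:R + 1) * (1 + rho) ^+ k -
   (2 * C * k%:R * (1 + rho) ^+ k + 3 * b * (1 + rho) ^+ k) =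
   (2 * C + 3 * b * k%:R) * (1 + rho) ^+ k by ring.
by rewrite mulr_ge0 // addr_ge0 // mulr_ge0 //; lra.
Qed.

Lemma lattice_count_ball k : 0 < unit_ball_volume R k /\ exists2 C : R, 0 < C &
  forall (alpha : 'rV[R]_k) rho, 0 <= rho ->
    `|(cnt (nball alpha rho))%:R - unit_ball_volume R k * rho ^+ k| <= C * (1 + rho) ^+ k.-1.
Proof.
have [b [C [b0 C0 vol H]]] := lattice_count k.
have -> : unit_ball_volume R k = b.
  by rewrite /unit_ball_volume vol // expr1n mulr1.
split => //; exists (C * k%:R + 1); first by rewrite ltr_wpDl ?mulr_ge0.
move=> alpha rho r0; apply: le_trans (H alpha rho r0) _.
by rewrite ler_wpM2r ?lerDl // exprn_ge0 // addr_ge0.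
Qed.

End LatticeCount.

(** * Equidistribution tools *)

Section ProgressionCounting.
Variable R : realType.

Lemma cntU (T : choiceType) (A B : set T) : finite_set A -> finite_set B ->
  (cnt (A `|` B) <= cnt A + cnt B)%N.
Proof. by move=> fA fB; rewrite /cnt fset_setU // cardfsU leq_subr. Qed.

Lemma cnt_fiber_fin (T : choiceType) (U : finType) (A : set T) (h : T -> U) :
  finite_set A -> cnt A = (\sum_u cnt [set x | A x /\ h x = u])%N.
Proof.
move=> fA; rewrite (@cnt_fiber _ A (enum_rank \o h) #|U|) //=.
rewrite (reindex enum_rank) /=; last by exists enum_val => x _; rewrite ?enum_rankK ?enum_valK.
apply: eq_bigr => u _; congr cnt; apply/seteqP; split => x /= [Ax].
  by move=> /val_inj /enum_rank_inj.
by move=> ->.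
Qed.

Lemma cnt_fiber_le (T : choiceType) (U : finType) (A : set T) (h : T -> U) (b : R) :
  finite_set A -> (forall u, (cnt [set x | A x /\ h x = u])%:R <= b) ->
  (cnt A)%:R <= #|U|%:R * b.
Proof.
move=> fA H; rewrite (cnt_fiber_fin h fA) natr_sum.
by rewrite mulr_natl -sumr_const; exact: ler_sum.
Qed.

(** Integers of absolute value at most [U] are coded by ['I_(U.*2.+1)], centred by subtracting [U],
    so that translations range over a finite type; the hypotheses keep the interval inside that
    range. *)
Lemma int_count_ge (U : nat) (x y : R) : - U%:R <= x -> y <= U%:R ->
  y - x - 1 <= (cnt [set u : 'I_(U.*2.+1) | x <= (u%:Z - U%:Z)%:~R <= y])%:R.
Proof.
move=> Ux yU; set A := [set _ | _].
pose c := Num.ceil x; have cx := ceil_ge x; have /andP[xc _] := ceil_itv x.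
rewrite -/c intrB in cx xc.
have [yc|yc] := ltP y c%:~R; first by apply: (@le_trans _ _ 0) => //; lra.
pose n := (Num.truncn (y - c%:~R)).+1.
have /andP[n1 n2] : (Num.truncn (y - c%:~R))%:R <= y - c%:~R < n%:R.
  by apply: truncn_itv; rewrite subr_ge0.
have cU : (- U%:Z <= c)%R by rewrite -(ler_int R) mulrNz -pmulrn; lra.
apply: (@le_trans _ _ n%:R); first lra.
rewrite ler_nat -[n]cnt_II.
have hn i : (i < n)%N -> c%:~R + i%:R <= y.
  by rewrite ltnS -(ler_nat R) => ?; lra.
pose q (i : nat) : nat := absz (c + i%:Z + U%:Z).
have qE i : (q i)%:Z = c + i%:Z + U%:Z by rewrite /q gez0_abs //; lia.
have hb i : (i < n)%N -> (q i < U.*2.+1)%N.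
  move=> /hn iy; rewrite -ltz_nat qE -addnn -addn1 !PoszD.
  suff : (c + i%:Z <= U%:Z)%R by lia.
  by rewrite -(ler_int R) intrD -!pmulrn; lra.
apply: (@cnt_inj _ _ (fun i => inord (q i))) => //.
- exact: finite_finset.
- move=> i /= iy; have := hn i iy => h.
  rewrite /A /= inordK ?hb // qE addrK intrD -!pmulrn h andbT.
  by rewrite (le_trans cx) // lerDl.
- move=> i j /= iy jy /(congr1 val) /=; rewrite !inordK ?hb // => e.
  by have := qE i; have := qE j; lia.
Qed.

(** For a fixed second index the times [i] fill an interval of length [l / sigma], and the second
    indices that contribute lie in an interval of length [l + J sigma], at most [J sigma + 1]. When
    [sigma] is small against [l] and [J sigma] is large, the product is close to the expected number
    [J l]. *)
Lemma progression_visits (J U : nat) (theta sigma x0 l : R) : 0 < sigma -> 0 <= l -> l <= 1 ->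
  (cnt [set p : 'I_J * 'I_(U.*2.+1) |
     x0 <= theta - p.1%:R * sigma - (p.2%:Z - U%:Z)%:~R <= x0 + l])%:R
  <= (J%:R * sigma + 2) * (l / sigma + 1).
Proof.
move=> s0 l0 l1; set A := [set _ | _].
have fA : finite_set A by exact: finite_finset.
rewrite (cnt_fiber_fin snd fA) natr_sum.
have ls0 : 0 <= l / sigma by rewrite divr_ge0 // ltW.
have Js0 : 0 <= J%:R * sigma by rewrite mulr_ge0 // ltW.
have bound u : (cnt [set x | A x /\ x.2 = u])%:R <= (l / sigma + 1) *
    (theta - x0 - l - J%:R * sigma <= (u%:Z - U%:Z)%:~R <= theta - x0)%R%:R :> R.
  case: (boolP (_ <= _ <= _)) => h.
    rewrite mulr1.
    apply: (@int_count R _ _ (fun p : 'I_J * 'I_(U.*2.+1) => p.1%:Z)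
       ((theta - (u%:Z - U%:Z)%:~R - x0 - l) / sigma) (l / sigma) ls0 _ _).2.
    + move=> [i u'] /= [/andP[h1 h2] uu]; rewrite uu in h1 h2; rewrite -pmulrn.
      by rewrite -mulrDl ler_pdivrMr // ler_pdivlMr //; apply/andP; split; lra.
    + by move=> [i u1] [j u2] /= [_ ->] [_ ->] [/val_inj ->].
  rewrite mulr0 (_ : [set x | _] = set0) ?cnt0 //; apply/seteqP; split => // -[i u'] /=.
  move=> [/andP[h1 h2] uu]; rewrite uu in h1 h2; move/negP: h; apply.
  have : i%:R * sigma <= J%:R * sigma by rewrite ler_pM2r // ler_nat ltnW.
  have : 0 <= i%:R * sigma by rewrite mulr_ge0 // ltW.
  by move=> ? ?; apply/andP; split; lra.
apply: le_trans (ler_sum _ (fun u _ => bound u)) _.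
rewrite -mulr_sumr mulrC ler_wpM2r ?addr_ge0 // sum_fin_indic.
apply: le_trans (@int_count R _ _ (fun u : 'I_(U.*2.+1) => u%:Z - U%:Z)
       (theta - x0 - l - J%:R * sigma) (l + J%:R * sigma) _ _ _).2 _.
- lra.
- by move=> u /= /andP[? ?]; apply/andP; split; lra.
- by move=> u1 u2 _ _ /addIr [/val_inj].
- lra.
Qed.

(* Double counting of the pairs [(x, s i u x)]. *)
Lemma shift_double_count (T : choiceType) (N0 W : {fset T}) (f w0 w1 : T -> R)
    (J U : nat) (s : 'I_J -> int -> T -> T) (sigma x0 l omega : R) :
  0 < sigma -> 0 <= l -> l <= 1 ->
  (forall (i : 'I_J) u, injective (s i u)) ->
  (forall (i : 'I_J) u x, f (s i u x) = f x + u%:~R + i%:R * sigma) ->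
  {in N0, forall x, x0 <= f x <= x0 + l} ->
  {in N0, forall x, 0 <= w0 x} -> {in W, forall x, 0 <= w1 x} ->
  omega + `|x0| + l + J%:R * sigma <= U%:R ->
  (forall (i : 'I_J) (u : 'I_(U.*2.+1)) x, x \in N0 ->
     `|f x + (u%:Z - U%:Z)%:~R + i%:R * sigma| <= omega ->
     s i (u%:Z - U%:Z) x \in W /\ w0 x <= w1 (s i (u%:Z - U%:Z) x)) ->
  J%:R * (2 * omega - 1) * (\sum_(x <- N0) w0 x) <=
  (J%:R * sigma + 2) * (l / sigma + 1) * (\sum_(y <- W) w1 y).
Proof.
move=> s0 l0 l1 sI fs N0f w00 w10 hU H.
pose ok (i : 'I_J) (u : 'I_(U.*2.+1)) x := `|f x + (u%:Z - U%:Z)%:~R + i%:R * sigma| <= omega.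
pose vis (i : 'I_J) (u : 'I_(U.*2.+1)) y := x0 <= f y - i%:R * sigma - (u%:Z - U%:Z)%:~R <= x0 + l.
(* Seen from [x]: for each [i] the admissible [u] are the integers in an interval of length
   [2 omega]. *)
apply: (@le_trans _ _ (\sum_(x <- N0) \sum_(i < J) \sum_u (ok i u x)%:R * w0 x)).
  rewrite mulr_sumr big_seq [leRHS]big_seq; apply: ler_sum => x xN.
  have /andP[f1 f2] := N0f x xN.
  rewrite -mulrA mulr_natl -[in leLHS](card_ord J) -sumr_const; apply: ler_sum => i _.
  rewrite -mulr_suml ler_wpM2r ?w00 // sum_fin_indic.
  have i1 : 0 <= i%:R * sigma by rewrite mulr_ge0 // ltW.
  have i2 : i%:R * sigma <= J%:R * sigma by rewrite ler_pM2r // ler_nat ltnW.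
  have := ler_norm x0; have := ler_norm (- x0); rewrite normrN => n1 n2.
  have := @int_count_ge U (- omega - f x - i%:R * sigma) (omega - f x - i%:R * sigma).
  have -> : omega - f x - i%:R * sigma - (- omega - f x - i%:R * sigma) = 2 * omega by ring.
  move=> /(_ _ _) h; apply: le_trans (h _ _) _; [lra|lra|].
  rewrite ler_nat; apply: cnt_sub; first exact: finite_finset.
  by move=> u /= /andP[h1 h2]; rewrite /ok ler_norml; apply/andP; split; lra.
rewrite exchange_big /=.
under eq_bigr do rewrite exchange_big /=.
apply: (@le_trans _ _ (\sum_(i < J) \sum_u \sum_(y <- W) (vis i u y)%:R * w1 y)).
  apply: ler_sum => i _; apply: ler_sum => u _.
  pose F := [fset x in N0 | ok i u x]%fset.
  have -> : \sum_(x <- N0) (ok i u x)%:R * w0 x = \sum_(x <- F) w0 x.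
    rewrite big_fset /= [RHS]big_mkcond; apply: eq_bigr => x _.
    by case: (ok i u x); rewrite ?mul1r ?mul0r.
  apply: (@le_trans _ _ (\sum_(x <- F) (vis i u (s i (u%:Z - U%:Z) x))%:R *
       w1 (s i (u%:Z - U%:Z) x))).
    rewrite big_seq [leRHS]big_seq; apply: ler_sum => x.
    rewrite !inE /= => /andP[xN okx]; have [_ le] := H i u x xN okx.
    have /andP[f1 f2] := N0f x xN.
    rewrite (_ : vis i u _ = true) ?mul1r // /vis fs; apply/andP; split; lra.
  apply: (ler_sum_inj (g := fun y => (vis i u y)%:R * w1 y)).
  - by move=> x y _ _ /sI.
  - by move=> x; rewrite !inE /= => /andP[xN okx]; have [] := H i u x xN okx.
  - by move=> y yW; rewrite mulr_ge0 ?w10.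
(* Seen from [y]: the pairs [(i, u)] are visits of a progression to the interval that contains [f]
   on [N0]. *)
rewrite pair_big /= exchange_big /= mulr_sumr.
rewrite big_seq [leRHS]big_seq; apply: ler_sum => y yW.
rewrite -mulr_suml ler_wpM2r ?w10 //.
rewrite (@sum_fin_indic R ('I_J * 'I_(U.*2.+1))%type (fun p => vis p.1 p.2 y)).
exact: progression_visits.
Qed.

End ProgressionCounting.

(** * Averages over a cube *)

Section QuadraticForm.
Variables (R : realType) (k : nat).
Implicit Types (alpha : 'rV[R]_k) (m d : 'rV[int]_k).

(** This is $|m+d-\alpha|^2-|m-\alpha|^2$, written so that for fixed [d] it is visibly affine in [m]
    and in [alpha]. *)
Definition dform alpha d m : R :=
  \sum_i (d 0 i)%:~R * (2 * (m 0 i)%:~R + (d 0 i)%:~R - 2 * alpha 0 i).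

Lemma dformE alpha d m : dform alpha d m = ldist alpha (m + d) ^+ 2 - ldist alpha m ^+ 2.
Proof.
rewrite !ldist_sqr -sumrB; apply: eq_bigr => i _; rewrite mxE intrD; ring.
Qed.

Lemma dform_shift alpha d m x :
  dform alpha d (m + x) = dform alpha d m + 2 * \sum_i (d 0 i)%:~R * (x 0 i)%:~R.
Proof.
rewrite mulr_sumr -big_split; apply: eq_bigr => i _ /=; rewrite mxE intrD; ring.
Qed.

Definition move alpha i (c : R) : 'rV[R]_k := \row_j (alpha 0 j + (j == i)%:R * c).

Lemma dform_move alpha i c d m :
  dform (move alpha i c) d m = dform alpha d m - 2 * (d 0 i)%:~R * c.
Proof.
rewrite /dform [in RHS](bigD1 i) // [LHS](bigD1 i) //= !mxE eqxx mul1r.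
rewrite (eq_bigr (fun j => (d 0 j)%:~R * (2 * (m 0 j)%:~R + (d 0 j)%:~R - 2 * alpha 0 j)));
  first by ring.
by move=> j /negbTE ji; rewrite !mxE ji mul0r addr0.
Qed.

Lemma ldist_move alpha i c m : `|ldist (move alpha i c) m - ldist alpha m| <= `|c|.
Proof.
apply: le_trans (ldist_lip _ _ _ _) _; rewrite (bigD1 i) //= big1 ?addr0.
  by rewrite !mxE eqxx mul1r -normrN le_eqVlt; apply/orP/or_introl/eqP; congr `|_|; ring.
move=> j /negbTE ji; rewrite !mxE ji mul0r addr0 !subrr.
by rewrite normr0.
Qed.

Lemma ldist_shift alpha m x : `|ldist alpha (m + x) - ldist alpha m| <= \sum_i `|(x 0 i)%:~R|.
Proof.
apply: le_trans (ldist_lip _ _ _ _) _; apply: ler_sum => i _.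
by rewrite mxE intrD le_eqVlt; apply/orP/or_introl/eqP; congr `|_|; ring.
Qed.

(** Convexity of $t^{k/2}$, by induction on [k]. It replaces the condition on $k$-th powers by one
    on squares, which [dform] makes affine. *)
Lemma diff_sqr_le_pow (x y : R) : (2 <= k)%N -> 0 <= x -> x <= y ->
  k%:R * x ^+ (k - 2) * (y ^+ 2 - x ^+ 2) <= 2 * (y ^+ k - x ^+ k).
Proof.
case: k => [|[|n]] // _ x0 xy; rewrite subSS subSS subn0.
have y0 := le_trans x0 xy.
elim: n => [|n IH]; first by rewrite expr0 mulr1; lra.
have xn : 0 <= x ^+ n.+1 by rewrite exprn_ge0.
have st : x ^+ n.+1 <= y ^+ n.+1 by rewrite lerXn2r ?nnegrE.
have -> : n.+3%:R = n.+2%:R + 1 :> R by rewrite natr1.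
have h2 := ler_wpM2l x0 IH; move: h2.
have -> : x * (n.+2%:R * x ^+ n * (y ^+ 2 - x ^+ 2)) =
  n.+2%:R * x ^+ n.+1 * (y ^+ 2 - x ^+ 2) by rewrite [x ^+ n.+1]exprS; ring.
rewrite (exprS y n.+2) (exprS x n.+2) (exprS y n.+1) (exprS x n.+1).
move: xn st; set s := x ^+ n.+1; set t := y ^+ n.+1 => s0 st h2.
have h3 : 0 <= (t - s) * (y + x) * (y - x).
  by rewrite !mulr_ge0 ?subr_ge0 ?addr_ge0.
have h4 : 0 <= t * (y - x) * (y - x).
  by rewrite !mulr_ge0 ?subr_ge0 // (le_trans s0).
suff : s * (y ^+ 2 - x ^+ 2) <= 2 * (y * t * (y - x)) by lra.
by lra.
Qed.

Lemma powB_le (x y : R) : 0 <= x -> x <= y ->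
  y ^+ k - x ^+ k <= k%:R * (y - x) * y ^+ k.-1.
Proof.
move=> x0 xy; have y0 := le_trans x0 xy.
rewrite subrXX mulrC -mulrA [leRHS]mulrCA mulrC ler_wpM2l ?subr_ge0 //.
have -> : k%:R * y ^+ k.-1 = \sum_(i < k) y ^+ k.-1 by rewrite sumr_const card_ord mulr_natl.
apply: ler_sum => i _.
case: (k) i => [[] //|k' [i /= ik]]; rewrite ?subSS /= -[X in _ <= y ^+ X](subnK (_ : (i <= k')%N)) //.
by rewrite exprD ler_wpM2l ?exprn_ge0 // lerXn2r ?nnegrE.
Qed.

End QuadraticForm.

Section Box.
Variable k : nat.

Definition box (M : nat) : {fset 'rV[int]_k} :=
  [fset \row_i ((f i)%:Z - M%:Z) | f : {ffun 'I_k -> 'I_(M.*2.+1)}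
     in {: {ffun 'I_k -> 'I_(M.*2.+1)}}]%fset.

Lemma box_row_inj M :
  injective (fun f : {ffun 'I_k -> 'I_(M.*2.+1)} => \row_i ((f i)%:Z - M%:Z)).
Proof.
move=> f g /rowP fg; apply/ffunP => i; have := fg i.
by rewrite !mxE => /addIr [/val_inj].
Qed.

Lemma card_box M : #|` box M| = (M.*2.+1 ^ k)%N.
Proof.
rewrite card_imfset /=; last exact: box_row_inj.
by rewrite -cardE card_ffun !card_ord.
Qed.

Lemma mem_box M (m : 'rV[int]_k) : (m \in box M) = [forall i, `|m 0 i| <= M%:Z].
Proof.
apply/imfsetP/forallP => [[f /= _ ->] i|H].
  rewrite !mxE ler_norml; move: (ltn_ord (f i)); move: (nat_of_ord (f i)) => t tM.
  by apply/andP; split; lia.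
have q i : (absz (m 0 i + M%:Z)%R < M.*2.+1)%N by have := H i; lia.
exists [ffun i => Ordinal (q i)]; first by rewrite inE.
by apply/rowP => i; rewrite !mxE ffunE /= gez0_abs; have := H i; lia.
Qed.

Lemma boxP M (m : 'rV[int]_k) : reflect (forall i, `|m 0 i| <= M%:Z) (m \in box M).
Proof. by rewrite mem_box; exact: forallP. Qed.

End Box.

(** * Averages over a finite grid *)

Section GridAverage.
Variables (R : realType) (k P : nat).

Definition upd (t : {ffun 'I_k -> 'I_P}) i s : {ffun 'I_k -> 'I_P} :=
  [ffun j => if j == i then s else t j].

(** Resampling one coordinate does not change the mean: exchanging $t_i$ with $s$ is an involution
    that turns [F (upd t i s)] into [F t]. *)
Lemma avg_coord (F : {ffun 'I_k -> 'I_P} -> R) i :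
  P%:R * (\sum_t F t) = \sum_t \sum_s F (upd t i s).
Proof.
rewrite pair_big /=.
pose phi (p : {ffun 'I_k -> 'I_P} * 'I_P) := (upd p.1 i p.2, p.1 i).
have phiK : involutive phi.
  move=> [t s]; rewrite /phi /= ffunE eqxx; congr (_, _).
  by apply/ffunP => j; rewrite !ffunE; case: eqP => [->|].
rewrite [RHS](reindex_inj (inv_inj phiK)) /=.
rewrite (eq_bigr (fun p : {ffun 'I_k -> 'I_P} * 'I_P => F p.1)); last first.
  by move=> p _; rewrite -[in RHS](phiK p).
rewrite -(pair_big xpredT xpredT (fun t _ => F t)) /= mulr_sumr.
by apply: eq_bigr => t _; rewrite sumr_const card_ord mulr_natl.
Qed.

Definition gridpt (alpha : 'rV[R]_k) (G : R) (t : {ffun 'I_k -> 'I_P}) : 'rV[R]_k :=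
  \row_i (alpha 0 i + (t i)%:R / G).

Lemma gridpt_upd alpha G t i s (s0 : 'I_P) : s0 = 0%N :> nat ->
  gridpt alpha G (upd t i s) = move (gridpt alpha G (upd t i s0)) i (s%:R / G).
Proof.
move=> e; apply/rowP => j; rewrite !mxE !ffunE; case: eqP => _; last by rewrite mul0r addr0.
by rewrite e mul0r addr0 mul1r.
Qed.

End GridAverage.

Section CoordinateAverage.
Variables (R : realType) (k : nat).

(** With the other coordinates of [m] fixed, [dform] depends on $(s,m_i)$ only through $Gm_i-s$,
    affinely with slope $2d_i/G$. Since $s<P\le G$, this integer determines the pair, so one counts
    integers in a single interval. *)
Lemma coordinate_average (alpha : 'rV[R]_k) (d : 'rV[int]_k) i (G P M : nat) (delta : R) :
  (0 < G)%N -> (P <= G)%N -> 0 <= delta -> d 0 i != 0 ->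
  \sum_(s < P) \sum_(m <- box k M)
     (0 <= dform (move alpha i (s%:R / G%:R)) d m <= delta)%R%:R
  <= (M.*2.+1 ^ k.-1)%:R * (G%:R * delta / (2 * `|(d 0 i)%:~R|) + 1) :> R.
Proof.
case: k alpha d i => [? ? []//|n] alpha d i G0 PG dl0 di.
pose A := [set p : 'I_P * 'rV[int]_n.+1 | p.2 \in box n.+1 M /\
   0 <= dform (move alpha i (p.1%:R / G%:R)) d p.2 <= delta].
have fA : finite_set A.
  apply: (@sub_finite_set _ _ ([set: 'I_P] `*` [set` box n.+1 M])) => [p [] //|].
  by apply: finite_setX => //; exact: finite_finset.
have -> : \sum_(s < P) \sum_(m <- box n.+1 M)
     (0 <= dform (move alpha i (s%:R / G%:R)) d m <= delta)%R%:R = (cnt A)%:R :> R.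
  rewrite (cnt_fiber_fin fst fA) natr_sum; apply: eq_bigr => s _.
  rewrite sum_fset_indic; congr _%:R; apply/eqP; rewrite eqn_leq; apply/andP; split.
    apply: (@cnt_inj _ _ (fun m => (s, m))) => [|m [? ?]|? ? _ _ []] //.
    by apply: sub_finite_set fA => x [].
  apply: (@cnt_inj _ _ snd) => [|[s' m] [[/= h1 h2] <-]|[? ?] [? ?] [_ /= ->] [_ /= ->] ->] //.
  by apply: sub_finite_set (finite_fset (box n.+1 M)) => m [].
have q (m : 'rV[int]_n.+1) : m \in box n.+1 M -> forall j, (absz (m 0 j + M%:Z)%R < M.*2.+1)%N.
  by move=> /boxP H j; have := H j; lia.
pose h (p : 'I_P * 'rV[int]_n.+1) : {ffun 'I_n -> 'I_(M.*2.+1)} :=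
  [ffun j => inord (absz (p.2 0 (lift i j) + M%:Z)%R)].
have := @cnt_fiber_le R _ {ffun 'I_n -> 'I_(M.*2.+1)} A h
  (G%:R * delta / (2 * `|(d 0 i)%:~R|) + 1) fA.
rewrite card_ffun !card_ord; apply => u.
set B := [set x | _]; have [->|/set0P[[s0 m0] B0]] := eqVneq B set0.
  by rewrite cnt0 addr_ge0 // divr_ge0 // !mulr_ge0.
have dn : 0 < `|(d 0 i)%:~R| :> R by rewrite normr_gt0 intr_eq0.
have Gr : 0 < G%:R :> R by rewrite ltr0n.
pose z (p : 'I_P * 'rV[int]_n.+1) : int := (G%:Z * p.2 0 i - p.1%:Z)%R.
pose z0 : R := (z (s0, m0))%:~R.
have same p : B p -> forall j, j != i -> p.2 0 j = m0 0 j.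
  move=> [[pM _] hp] j ji; have [[m0M _] hm0] := B0.
  have := hp; rewrite -hm0 => /ffunP.
  case: (unliftP i j) ji => [j' ->|->]; last by rewrite eqxx.
  move=> _ /(_ j'); rewrite !ffunE => /(congr1 val) /=; rewrite !inordK ?q //= .
  have /boxP/(_ (lift i j')) := pM; have /boxP/(_ (lift i j')) := m0M; rewrite /=; lia.
have zE p : B p -> dform (move alpha i (p.1%:R / G%:R)) d p.2 =
    dform (move alpha i (s0%:R / G%:R)) d m0 + 2 * (d 0 i)%:~R / G%:R * ((z p)%:~R - z0).
  move=> Bp; rewrite !dform_move /dform (bigD1 i) //= [in RHS](bigD1 i) //=.
  rewrite (eq_bigr (fun j => (d 0 j)%:~R * (2 * (m0 0 j)%:~R + (d 0 j)%:~R - 2 * alpha 0 j)));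
    last by move=> j ji; rewrite (same p Bp j ji).
  by rewrite /z0 /z /= !intrB !intrM -!pmulrn; field; rewrite gt_eqF.
pose D0 : R := dform (move alpha i (s0%:R / G%:R)) d m0.
have l0 : 0 <= G%:R * delta / (2 * `|(d 0 i)%:~R|) by rewrite divr_ge0 // mulr_ge0.
have zI p p' : B p -> B p' -> z p = z p' -> p = p'.
  case: p p' => [s m] [s' m'] Bp Bp' /= zz.
  have mi : m 0 i = m' 0 i.
    move: zz (ltn_ord s) (ltn_ord s'); rewrite /z /=.
    move: (m 0 i) (m' 0 i) (nat_of_ord s) (nat_of_ord s') => x y t t' zz tP t'P.
    have [xy|xy|//] := ltrgtP x y.
      have : (G%:Z * (x + 1) <= G%:Z * y)%R by rewrite ler_wpM2l //; lia.
      by rewrite mulrDr mulr1; lia.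
    have : (G%:Z * (y + 1) <= G%:Z * x)%R by rewrite ler_wpM2l //; lia.
    by rewrite mulrDr mulr1; lia.
  have ss : s = s' by apply: val_inj => /=; move: zz; rewrite /z /= mi => /addrI /oppr_inj [].
  rewrite ss; congr (_, _); apply/rowP => j; have [->//|ji] := eqVneq j i.
  by rewrite (same _ Bp) // (same _ Bp').
have [dp|dm] := ltP 0 ((d 0 i)%:~R : R).
  apply: (@int_count R _ B z (z0 - D0 * G%:R / (2 * (d 0 i)%:~R)) _ l0 _ zI).2.
  move=> p Bp; have [[_]] := Bp; rewrite (zE p Bp) -/D0 => /andP[h1 h2] _.
  have e0 : D0 + 2 * (d 0 i)%:~R / G%:R * ((z p)%:~R - z0) =
    ((z p)%:~R - (z0 - D0 * G%:R / (2 * (d 0 i)%:~R))) * (2 * (d 0 i)%:~R / G%:R).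
    by field; rewrite !gt_eqF.
  have pc : 0 < 2 * (d 0 i)%:~R / G%:R :> R by rewrite divr_gt0 // mulr_gt0.
  rewrite e0 pmulr_lge0 // subr_ge0 in h1; rewrite h1 /=.
  rewrite e0 -ler_pdivlMr // lerBlDl in h2; apply: le_trans h2 _.
  rewrite gtr0_norm // lerD2l le_eqVlt; apply/orP/or_introl/eqP; field; rewrite !gt_eqF //.
have dneg : (d 0 i)%:~R < 0 :> R by rewrite lt_neqAle intr_eq0 di.
apply: (@int_count R _ B z (z0 + (delta - D0) * G%:R / (2 * (d 0 i)%:~R)) _ l0 _ zI).2.
move=> p Bp; have [[_]] := Bp; rewrite (zE p Bp) -/D0 => /andP[h1 h2] _.
have e0 : D0 + 2 * (d 0 i)%:~R / G%:R * ((z p)%:~R - z0) =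
  delta - ((z p)%:~R - (z0 + (delta - D0) * G%:R / (2 * (d 0 i)%:~R))) * (2 * - (d 0 i)%:~R / G%:R).
  by field; rewrite (lt_eqF dneg) (gt_eqF Gr).
have pc : 0 < 2 * - (d 0 i)%:~R / G%:R :> R by rewrite divr_gt0 // mulr_gt0 // oppr_gt0.
rewrite e0 gerBl pmulr_lge0 // subr_ge0 in h2; rewrite h2 /=.
rewrite e0 subr_ge0 -ler_pdivlMr // lerBlDl in h1; apply: le_trans h1 _.
rewrite ltr0_norm // lerD2l le_eqVlt; apply/orP/or_introl/eqP.
by field; rewrite (lt_eqF dneg) (gt_eqF Gr).
Qed.

End CoordinateAverage.

(** * Differences with an equidistributing direction *)

Section GoodDirection.
Variables (R : realType) (n : nat).
Notation k := n.+2.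
Notation i1 := (ord0 : 'I_k).
Notation i2 := (lift ord0 ord0 : 'I_k).

(** The pair condition on squared distances: with $A=2a/k$, a difference of $k$-th powers at most
    $a$ forces [dform] to be at most $A/r^{k-2}$ by [diff_sqr_le_pow]. Here [m] is the nearer point
    of the pair. *)
Definition narrow_pair (alpha : 'rV[R]_k) (A rho gam : R) (d m : 'rV[int]_k) : bool :=
  [&& rho <= ldist alpha m, ldist alpha m <= gam * rho
    & 0 <= dform alpha d m <= A / ldist alpha m ^+ n].

(** The comparison window; the margin [c] makes room for points displaced by the vectors [vec12]. *)
Definition wide_pair (alpha : 'rV[R]_k) (Delta rho gam c : R) (d m : 'rV[int]_k) : bool :=
  [&& rho - c <= ldist alpha m, ldist alpha m <= gam * rho + c
    & `|dform alpha d m| <= Delta].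

(** Adding this vector to [m] moves [dform alpha d m / (2 d_1)] by $u+i\sigma$, where
    $\sigma=v_1+v_2d_2/d_1$. *)
Definition vec12 (v1 v2 : int) (i : nat) (u : int) : 'rV[int]_k :=
  \row_j (if j == i1 then u + i%:Z * v1 else if j == i2 then i%:Z * v2 else 0).

Definition shift12 (v1 v2 : int) (i : nat) (u : int) (m : 'rV[int]_k) : 'rV[int]_k :=
  m + vec12 v1 v2 i u.

Lemma sum12 (F : 'I_k -> R) : (forall j, j != i1 -> j != i2 -> F j = 0) ->
  \sum_j F j = F i1 + F i2.
Proof.
move=> H; rewrite (bigD1 i1) //= (bigD1 i2) //= big1 ?addr0 //.
by move=> j /andP[? ?]; exact: H.
Qed.

Lemma ord_centered (U : nat) (u : 'I_(U.*2.+1)) : `|u%:Z - U%:Z| <= U%:Z.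
Proof. by move: (ltn_ord u); move: (nat_of_ord u) => t tU; lia. Qed.

Lemma vec12_size (U V J c i : nat) (v1 v2 u : int) :
  `|v1| <= V%:Z -> `|v2| <= V%:Z -> `|u| <= U%:Z -> (i <= J)%N ->
  (U + 2 * J * V + 1 <= c)%N ->
  \sum_j `|(vec12 v1 v2 i u 0 j)%:~R| <= c%:R - 1 :> R.
Proof.
move=> V1 V2 uU iJ hc.
have iv v : `|v| <= V%:Z -> `|i%:Z * v| <= J%:Z * V%:Z.
  by move=> hv; rewrite normrM ler_pM // ger0_norm.
have size1 : `|u + i%:Z * v1| <= U%:Z + J%:Z * V%:Z.
  by apply: le_trans (ler_normD _ _) _; apply: lerD => //; exact: iv.
have size2 := iv v2 V2.
rewrite sum12 ?mxE ?eqxx /=; last first.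
  by move=> j /negbTE j1 /negbTE j2; rewrite mxE j1 j2 normr0.
rewrite -!intr_norm -intrD.
have -> : c%:R - 1 = (c%:Z - 1)%:~R :> R by rewrite intrB -pmulrn.
rewrite ler_int lerBrDr; apply: le_trans (lerD (lerD size1 size2) (lexx 1)) _.
by move: hc; rewrite -lez_nat !PoszD !PoszM => hc; apply: le_trans hc; lia.
Qed.

Lemma shift12_box (M c i : nat) (v1 v2 u : int) m :
  \sum_j `|(vec12 v1 v2 i u 0 j)%:~R| <= c%:R - 1 :> R -> m \in box k M ->
  shift12 v1 v2 i u m \in box k (M + c)%N.
Proof.
move=> h /boxP mM; apply/boxP => j; rewrite mxE PoszD.
apply: le_trans (ler_normD _ _) _; apply: lerD => //.
rewrite -(ler_int R) intr_norm -pmulrn; apply: (@le_trans _ _ (c%:R - 1)); last by rewrite gerBl.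
by apply: le_trans h; rewrite (bigD1 j) //= lerDl sumr_ge0.
Qed.

Lemma dform_shift12 (alpha : 'rV[R]_k) (d : 'rV[int]_k) (v1 v2 : int) i u m :
  (d 0 i1)%:~R != 0 :> R ->
  dform alpha d (shift12 v1 v2 i u m) = 2 * (d 0 i1)%:~R *
    (dform alpha d m / (2 * (d 0 i1)%:~R) + u%:~R +
     i%:R * (v1%:~R + v2%:~R * ((d 0 i2)%:~R / (d 0 i1)%:~R))).
Proof.
move=> d10; rewrite /shift12 dform_shift sum12 ?mxE ?eqxx /=; last first.
  by move=> j /negbTE j1 /negbTE j2; rewrite mxE j1 j2 mulr0.
by rewrite !intrD !intrM -!pmulrn; field.
Qed.

(* For a fixed lattice point the admissible values of the first coordinate of
   alpha form an interval of length at most w / (2 |d1|). *)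
Lemma narrow_pair_count (alpha : 'rV[R]_k) (A rho gam kap : R) (d m : 'rV[int]_k) (G P : nat) :
  let d1 : R := (d 0 i1)%:~R in let f := dform alpha d m / (2 * d1) in
  let w := A / (ldist alpha m - 1) ^+ n in
  0 < A -> (0 < G)%N -> (P <= G)%N -> d1 != 0 -> A / (2 * `|d1|) <= kap -> 3 < rho ->
  \sum_(s < P) (narrow_pair (move alpha i1 (s%:R / G%:R)) A rho gam d m)%:R
  <= [&& rho - 1 <= ldist alpha m, ldist alpha m <= gam * rho + 1
      & - kap <= f <= - kap + (P%:R / G%:R + 2 * kap)]%:R *
     (G%:R / (2 * `|d1|) * w) + 1 :> R.
Proof.
move=> d1 f w A0 G0 PG d1n kapA rho3.
have Gr : 0 < G%:R :> R by rewrite ltr0n.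
have D0 : 0 < `|d1| by rewrite normr_gt0.
rewrite sum_fin_indic; set B := [set s | _].
have sG (s : 'I_P) : 0 <= (s%:R / G%:R : R) <= P%:R / G%:R.
  by rewrite divr_ge0 //= ler_pM2r ?invr_gt0 // ler_nat ltnW.
have PG1 : P%:R / G%:R <= 1 :> R by rewrite ler_pdivrMr // mul1r ler_nat.
have fE : dform alpha d m = 2 * d1 * f by rewrite /f; field.
have hnear (s : 'I_P) : B s -> [/\ rho - 1 <= ldist alpha m, ldist alpha m <= gam * rho + 1,
    0 <= 2 * d1 * (f - s%:R / G%:R) <= w
    & - kap <= f <= - kap + (P%:R / G%:R + 2 * kap)].
  move=> /and3P[h1 h2]; rewrite dform_move -/d1 => /andP[h3 h4].
  have := ldist_move alpha i1 (s%:R / G%:R) m.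
  have := sG s.
  move: (s%:R / G%:R) (ldist (move alpha i1 (s%:R / G%:R)) m) h1 h2 h3 h4 => q r h1 h2 h3 h4.
  move=> /andP[sg1 sg2]; rewrite (ger0_norm sg1) ler_norml => /andP[e1 e2].
  have e3 : dform alpha d m - 2 * d1 * q = 2 * d1 * (f - q) by rewrite fE; ring.
  rewrite e3 in h3 h4; rewrite /w; move: (ldist alpha m) e1 e2 => x e1 e2.
  clear e3 fE sG B; move: f h3 h4 => f h3 h4.
  have h5 : rho - 1 <= x by clear -e1 e2 sg1 sg2 h1 PG1; lra.
  have x1 : 0 < x - 1 by clear -h5 rho3; lra.
  have r1 : 1 <= r by clear -h1 rho3; lra.
  have r0 : 0 < r by clear -r1; lra.
  have xr : x - 1 <= r by clear -e1 e2 sg1 sg2 PG1; lra.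
  have h6 : A / r ^+ n <= A / (x - 1) ^+ n.
    rewrite ler_pM2l // lef_pV2 ?posrE ?exprn_gt0 //.
    by rewrite lerXn2r ?nnegrE // ltW.
  have h7 : A / r ^+ n <= A.
    by rewrite ler_pdivrMr ?exprn_gt0 // ler_peMr ?exprn_ege1 // ltW.
  have h8 : `|f - q| <= kap.
    apply: le_trans kapA; rewrite ler_pdivlMr ?mulr_gt0 //.
    rewrite mulrC -(@ger0_norm _ 2) // -!normrM ger0_norm //; exact: le_trans h4 h7.
  split => //.
  - by clear -h2 e1 e2 sg1 sg2 PG1; lra.
  - by rewrite h3 (le_trans h4).
  - by move: h8; rewrite ler_norml => /andP[? ?]; apply/andP; split; lra.
have [->|/set0P[s0 Bs0]] := eqVneq B set0.
  rewrite cnt0; case: (boolP [&& _, _ & _]) => [/and3P[r1 _ _]|_]; last by rewrite mul0r add0r.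
  by rewrite mul1r addr_ge0 // mulr_ge0 ?divr_ge0 ?mulr_ge0 ?exprn_ge0 // ?(ltW A0) //; lra.
have [h1 h2 _ h3] := hnear s0 Bs0.
rewrite h1 h2 h3 mul1r; clear s0 Bs0 h3.
have L0 : 0 <= G%:R / (2 * `|d1|) * w.
  by rewrite mulr_ge0 ?divr_ge0 ?mulr_ge0 ?exprn_ge0 // ?(ltW A0) //; lra.
have sI (s t : 'I_P) : B s -> B t -> s%:Z = t%:Z -> s = t by move=> _ _ [/val_inj].
have [dp|dm] := ltP 0 d1.
  apply: (@int_count R _ B (fun s => s%:Z) (G%:R * f - G%:R / (2 * `|d1|) * w) _ L0 _ sI).2.
  move=> s /hnear[_ _ /andP[e1 e2] _]; rewrite -pmulrn subrK (gtr0_norm dp).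
  rewrite -ler_pdivlMl ?mulr_gt0 // in e2.
  rewrite pmulr_rge0 ?mulr_gt0 // in e1.
  have -> : s%:R = G%:R * (s%:R / G%:R) :> R by rewrite mulrC divfK // gt_eqF.
  rewrite -[G%:R / _ * _]mulrA; move: e1 e2.
  move: (s%:R / G%:R) ((2 * d1)^-1 * w) => q x e1 e2.
  by rewrite -mulrBr !ler_pM2l //; clear -e1 e2; apply/andP; split; lra.
have dneg : d1 < 0 by rewrite lt_neqAle d1n.
apply: (@int_count R _ B (fun s => s%:Z) (G%:R * f) _ L0 _ sI).2.
move=> s /hnear[_ _ /andP[e1 e2] _]; rewrite -pmulrn (ltr0_norm dneg).
have e5 : 2 * d1 * (f - s%:R / G%:R) = 2 * - d1 * (s%:R / G%:R - f) by ring.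
have dn2 : 0 < 2 * - d1 by rewrite mulr_gt0 // oppr_gt0.
rewrite e5 in e1 e2; rewrite -ler_pdivlMl // in e2; rewrite pmulr_rge0 // in e1.
have -> : s%:R = G%:R * (s%:R / G%:R) :> R by rewrite mulrC divfK // gt_eqF.
rewrite -[G%:R / _ * _]mulrA; move: e1 e2 {e5}.
move: (s%:R / G%:R) ((2 * - d1)^-1 * w) => q x e1 e2.
by rewrite -mulrDr !ler_pM2l //; clear -e1 e2; apply/andP; split; lra.
Qed.

(** By [narrow_pair_count] the points to bound have [f = dform / (2 d_1)] in an interval of length
    [l]. The vectors [vec12] carry each of them in at least [J (2 om - 1)] ways into the wide
    window, and each wide point is hit at most [(J sig + 2) (l / sig + 1)] times. The weight [w1] at
    the new point dominates [w0] at the old one, because a shift changes distances by at most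
    [c - 1]. The first term on the right collects the rounding error 1 per lattice point. *)
Lemma good_direction (alpha : 'rV[R]_k) (A rho gam Delta kap : R) (d : 'rV[int]_k)
    (G P M J U V c : nat) (v1 v2 : int) :
  let d1 : R := (d 0 i1)%:~R in let d2 : R := (d 0 i2)%:~R in
  let sig := v1%:~R + v2%:~R * (d2 / d1) in
  let l := P%:R / G%:R + 2 * kap in
  let om := Delta / (2 * `|d1|) in
  0 < A -> 0 <= gam -> (0 < G)%N -> (P <= G)%N -> d 0 i1 != 0 -> 0 < sig ->
  `|v1| <= V%:Z -> `|v2| <= V%:Z -> (1 <= c)%N ->
  A / (2 * `|d1|) <= kap -> l <= 1 -> om + kap + l + J%:R * sig <= U%:R ->
  (U + 2 * J * V + 1 <= c)%N -> 2 * c%:R + 1 < rho -> 0 <= 2 * om - 1 ->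
  J%:R * (2 * om - 1) *
    (\sum_(s < P) \sum_(m <- box k M) (narrow_pair (move alpha i1 (s%:R / G%:R)) A rho gam d m)%:R)
  <= J%:R * (2 * om - 1) * #|` box k M|%:R +
     G%:R / (2 * `|d1|) * ((J%:R * sig + 2) * (l / sig + 1)) *
     \sum_(y <- box k (M + c)%N)
       (wide_pair alpha Delta rho gam c%:R d y)%:R * (A / (ldist alpha y - c%:R) ^+ n).
Proof.
move=> d1 d2 sig l om A0 gam0 G0 PG d10 sig0 V1 V2 c1 kapA l1 hU hc hrho om1.
have Gr : 0 < G%:R :> R by rewrite ltr0n.
have c1r : 1 <= c%:R :> R by rewrite ler1n.
have PG1 : P%:R / G%:R <= 1 :> R by rewrite ler_pdivrMr // mul1r ler_nat.
have tau0 : 0 <= P%:R / G%:R :> R by rewrite divr_ge0.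
have d1n : d1 != 0 by rewrite intr_eq0.
have D0 : 0 < `|d1| by rewrite normr_gt0.
have kap0 : 0 <= kap by apply: le_trans kapA; rewrite divr_ge0 ?mulr_ge0 // ltW.
have l0 : 0 <= l by rewrite /l addr_ge0 // mulr_ge0.
pose f m := dform alpha d m / (2 * d1).
have fE m : dform alpha d m = 2 * d1 * f m by rewrite /f; field.
pose w0 m := A / (ldist alpha m - 1) ^+ n.
pose w1 m := A / (ldist alpha m - c%:R) ^+ n.
pose N0 := [fset m in box k M | [&& rho - 1 <= ldist alpha m, ldist alpha m <= gam * rho + 1
   & - kap <= f m <= - kap + l]%R]%fset.
pose W := [fset y in box k (M + c)%N | wide_pair alpha Delta rho gam c%:R d y]%fset.
have N0P m : m \in N0 -> [/\ m \in box k M, rho - 1 <= ldist alpha m, ldist alpha m <= gam * rho + 1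
   & - kap <= f m <= - kap + l].
  by rewrite !inE /= => /andP[-> /and3P[]].
have WP y : y \in W -> rho - c%:R <= ldist alpha y.
  by rewrite !inE /= => /andP[_ /and3P[]].
have w00 : {in N0, forall x, 0 <= w0 x}.
  by move=> m /N0P[_ h _ _]; rewrite divr_ge0 ?exprn_ge0 ?(ltW A0) //; clear -h hrho c1r; lra.
have w10 : {in W, forall x, 0 <= w1 x}.
  by by move=> m /WP h; rewrite divr_ge0 ?exprn_ge0 ?(ltW A0) //; clear -h hrho c1r; lra.
have N0E m : m \in box k M -> (m \in N0) = [&& rho - 1 <= ldist alpha m,
    ldist alpha m <= gam * rho + 1 & - kap <= f m <= - kap + l].
  by move=> mM; rewrite !inE /= mM.
have rho3 : 3 < rho by clear -c1r hrho; lra.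
have step1 m : m \in box k M ->
    \sum_(s < P) (narrow_pair (move alpha i1 (s%:R / G%:R)) A rho gam d m)%:R
    <= (m \in N0)%:R * (G%:R / (2 * `|d1|) * w0 m) + 1 :> R.
  by move=> mM; rewrite N0E //; exact: narrow_pair_count.
have step2 : \sum_(s < P) \sum_(m <- box k M)
     (narrow_pair (move alpha i1 (s%:R / G%:R)) A rho gam d m)%:R <=
     G%:R / (2 * `|d1|) * (\sum_(m <- N0) w0 m) + #|` box k M|%:R.
  rewrite exchange_big /=.
  apply: (@le_trans _ _ (\sum_(m <- box k M) ((m \in N0)%:R * (G%:R / (2 * `|d1|) * w0 m) + 1))).
    by rewrite big_seq [leRHS]big_seq; apply: ler_sum => m; exact: step1.
  rewrite big_split /= lerD //; last by rewrite big_const_seq count_predT iter_addr_0.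
  have -> : \sum_(m <- N0) w0 m = \sum_(m <- box k M) (m \in N0)%:R * w0 m.
    rewrite [LHS]big_fset /= big_mkcond /= big_seq [RHS]big_seq; apply: eq_bigr => m mM.
    by rewrite !inE /= mM /=; case: ifP => _; rewrite ?mul1r ?mul0r.
  by rewrite mulr_sumr; apply: ler_sum => m _; rewrite mulrCA.
have step3 := @shift_double_count R _ N0 W f w0 w1 J U (fun i u m => shift12 v1 v2 i u m)
  sig (- kap) l om sig0 l0 l1.
have key : J%:R * (2 * om - 1) * (\sum_(x <- N0) w0 x) <=
  (J%:R * sig + 2) * (l / sig + 1) * (\sum_(y <- W) w1 y).
  apply: step3 => //.
  - by move=> i u x y /addIr.
  - by move=> i u m; rewrite /f dform_shift12 // mulrC mulKf // mulf_neq0.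
  - by move=> m /N0P[].
  - by rewrite normrN ger0_norm.
  move=> i u m mN hom; have [mM h1 h2 _] := N0P m mN.
  set y := shift12 _ _ _ _ _.
  have sz := vec12_size V1 V2 (ord_centered u) (ltnW (ltn_ord i)) hc.
  have r12 := le_trans (ldist_shift alpha m _) sz.
  rewrite -/(shift12 v1 v2 i (u%:Z - U%:Z) m) -/y ler_norml in r12.
  have /andP[r1 r2] := r12.
  have fy : f y = f m + (u%:Z - U%:Z)%:~R + i%:R * sig.
    by rewrite /f dform_shift12 // mulrC mulKf // mulf_neq0.
  split.
    rewrite !inE /=; apply/andP; split; first exact: shift12_box.
    apply/and3P; split; [clear -r1 h1; lra|clear -r2 h2; lra|].
    rewrite fE normrM fy; apply: le_trans (ler_wpM2l _ hom) _ => //.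
    by rewrite /om normrM ger0_norm // mulrC divfK // gt_eqF // mulr_gt0.
  have y1 : 0 < ldist alpha y - c%:R by clear -r1 h1 hrho; lra.
  have y2 : ldist alpha y - c%:R <= ldist alpha m - 1 by clear -r2; lra.
  have y3 : 0 < ldist alpha m - 1 by clear -y1 y2; lra.
  rewrite /w0 /w1 ler_pM2l // lef_pV2 ?posrE ?exprn_gt0 //.
  by rewrite lerXn2r ?nnegrE // ltW.
have Jom : 0 <= J%:R * (2 * om - 1) by rewrite mulr_ge0.
apply: le_trans (ler_wpM2l Jom step2) _.
rewrite mulrDr addrC lerD2l mulrCA -[leRHS]mulrA ler_wpM2l ?divr_ge0 ?mulr_ge0 //.
apply: le_trans key _; rewrite ler_wpM2l //.
  have sig0' := ltW sig0.
  by apply: mulr_ge0; apply: addr_ge0 => //; [exact: mulr_ge0|exact: divr_ge0].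
rewrite le_eqVlt; apply/orP/or_introl/eqP.
rewrite [LHS]big_fset /= big_mkcond /=; apply: eq_bigr => y _.
by case: ifP; rewrite ?mul1r ?mul0r.
Qed.

End GoodDirection.

(** * Points in shells *)

Section Asymptotics.
Variable R : realType.

Lemma ratio_near1 (c eps : R) n : 0 <= c -> 0 < eps -> exists2 r0 : R, 0 < r0 &
  forall r, r0 <= r -> 0 < r - c /\ (r + c) ^+ n <= (1 + eps) * (r - c) ^+ n.
Proof.
move=> c0; elim: n eps => [|n IH] eps e0.
  by exists (c + 1) => [|r h]; [lra|rewrite !expr0; split; lra].
pose e1 := Num.min 1 (eps / 3).
have e10 : 0 < e1 by rewrite lt_min ltr01 divr_gt0.
have e1l : e1 <= 1 by rewrite ge_min lexx.
have e1e : e1 <= eps / 3 by rewrite ge_min lexx orbT.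
have [r0 r00 H] := IH e1 e10.
exists (r0 + c * (2 + e1) / e1) => [|r h].
  by rewrite ltr_wpDr // divr_ge0 ?mulr_ge0 //; clear -e10; lra.
have h1 : r0 <= r.
  by apply: le_trans h; rewrite lerDl divr_ge0 ?mulr_ge0 //; clear -e10; lra.
have [rc hn] := H r h1; split=> //.
have h2 : r + c <= (1 + e1) * (r - c).
  have : c * (2 + e1) / e1 <= r by apply: le_trans h; rewrite lerDr ltW.
  by rewrite ler_pdivrMr // => ?; clear H IH; lra.
have rc0 : 0 <= r + c by clear -rc c0; lra.
have rcn : 0 <= (r - c) ^+ n by rewrite exprn_ge0 // ltW.
rewrite !exprSr; apply: (@le_trans _ _ ((1 + e1) * (r - c) ^+ n * ((1 + e1) * (r - c)))).
  by apply: ler_pM => //; rewrite exprn_ge0.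
have -> : (1 + e1) * (r - c) ^+ n * ((1 + e1) * (r - c)) =
  (1 + e1) ^+ 2 * ((r - c) ^+ n * (r - c)) by ring.
rewrite ler_wpM2r ?mulr_ge0 ?(ltW rc) //.
have : e1 * e1 <= e1 by rewrite ger_pMl.
by rewrite expr2; clear -e1e; lra.
Qed.

Lemma small_power (C c g theta : R) k : 0 <= C -> 0 <= c -> 0 <= g -> 0 < theta -> (0 < k)%N ->
  exists2 r0 : R, 1 <= r0 & forall rho, r0 <= rho -> C * (c + g * rho) ^+ k.-1 <= theta * rho ^+ k.
Proof.
move=> C0 c0 g0 t0; case: k => // k _ /=.
have h0 : 0 <= C * (c + g) ^+ k by rewrite mulr_ge0 // exprn_ge0 // addr_ge0.
exists (1 + C * (c + g) ^+ k / theta) => [|rho h]; first by rewrite lerDl divr_ge0 // ltW.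
have r1 : 1 <= rho by apply: le_trans h; rewrite lerDl divr_ge0 // ltW.
have r2 : C * (c + g) ^+ k <= rho * theta.
  rewrite -ler_pdivrMr //; apply: le_trans h; rewrite lerDr //.
have r0 : 0 <= rho by clear -r1; lra.
apply: (@le_trans _ _ (C * ((c + g) * rho) ^+ k)).
  rewrite ler_wpM2l // lerXn2r ?nnegrE ?mulr_ge0 ?addr_ge0 ?mulr_ge0 //.
  by rewrite mulrDl lerD2r ler_peMr.
rewrite exprMn mulrA [rho ^+ k.+1]exprS mulrA ler_wpM2r ?exprn_ge0 //.
by rewrite mulrC [theta * _]mulrC mulrC.
Qed.

End Asymptotics.

Section ShellCounts.
Variables (R : realType) (k : nat) (C : R).
Notation B := (unit_ball_volume R k).
Hypothesis C0 : 0 < C.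
Hypothesis HC : forall (alpha : 'rV[R]_k) rho, 0 <= rho ->
    `|(cnt (nball alpha rho))%:R - B * rho ^+ k| <= C * (1 + rho) ^+ k.-1.

Lemma cnt_disj (T : choiceType) (A A' E : set T) : finite_set E -> A `<=` E -> A' `<=` E ->
  A `&` A' = set0 -> (cnt A + cnt A' <= cnt E)%N.
Proof.
move=> fE AE A'E AA'.
have fA := sub_finite_set AE fE; have fA' := sub_finite_set A'E fE.
have <- : cnt (A `|` A') = (cnt A + cnt A')%N.
  by rewrite /cnt fset_setU // cardfsU -fset_setI // AA' fset_set0 cardfs0 subn0.
by apply: cnt_sub => // x [/AE|/A'E].
Qed.

Definition annulus (alpha : 'rV[R]_k) (x y : R) : set 'rV[int]_k :=
  [set m | x < ldist alpha m <= y].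

Lemma annulus_sub (alpha : 'rV[R]_k) x y : annulus alpha x y `<=` nball alpha y.
Proof. by move=> m /andP[]. Qed.

Lemma finite_annulus (alpha : 'rV[R]_k) x y : finite_set (annulus alpha x y).
Proof. exact: sub_finite_set (@annulus_sub alpha x y) (finite_nball _ _). Qed.

Lemma annulus_count (alpha : 'rV[R]_k) (x y : R) : 0 <= x -> x <= y ->
  `|(cnt (annulus alpha x y))%:R - B * (y ^+ k - x ^+ k)| <= 2 * C * (1 + y) ^+ k.-1.
Proof.
move=> x0 xy; have y0 := le_trans x0 xy.
have e : cnt (nball alpha y) = (cnt (annulus alpha x y) + cnt (nball alpha x))%N.
  apply/eqP; rewrite eqn_leq; apply/andP; split.
    apply: leq_trans (cntU (finite_annulus alpha x y) (finite_nball alpha x)).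
    apply: cnt_sub => [|m my]; first by rewrite finite_setU; split;
      [exact: finite_annulus|exact: finite_nball].
    by have [h|h] := leP (ldist alpha m) x; [right|left; rewrite /annulus /= h].
  apply: cnt_disj; [exact: finite_nball|exact: annulus_sub| |].
    by move=> m h; exact: le_trans h xy.
  by apply/seteqP; split => m //= [/andP[h _]]; rewrite /nball /= leNgt h.
have := HC alpha y0; have := HC alpha x0; rewrite e natrD.
have : (1 + x) ^+ k.-1 <= (1 + y) ^+ k.-1.
  by rewrite lerXn2r ?nnegrE ?addr_ge0 // lerD2l.
rewrite -(ler_pM2l C0) !ler_norml => h1 /andP[h2 h3] /andP[h4 h5].
by clear -h1 h2 h3 h4 h5; apply/andP; split; lra.
Qed.

Lemma annulus_count_le (alpha : 'rV[R]_k) (x y : R) : 0 <= x -> x <= y ->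
  (cnt (annulus alpha x y))%:R <= B * (y ^+ k - x ^+ k) + 2 * C * (1 + y) ^+ k.-1.
Proof. by move=> x0 xy; have := annulus_count alpha x0 xy; rewrite ler_norml => /andP[_]; lra. Qed.

(** For bounded [kap] the error [2 C] is of the order of the main term [2 B k kap]; this is what
    forces the wide window to have a large factor [K]. *)
Lemma shell_count_le (alpha : 'rV[R]_k) (r kap : R) : 0 < B -> 0 <= kap -> kap <= r ->
  (cnt [set m | `|ldist alpha m - r| < kap])%:R <=
  (2 * B * k%:R * kap + 2 * C) * (1 + r + kap) ^+ k.-1.
Proof.
move=> B0 k0 kr; apply: (@le_trans _ _ (cnt (annulus alpha (r - kap) (r + kap)))%:R).
  rewrite ler_nat; apply: cnt_sub; first exact: finite_annulus.
  by move=> m /=; rewrite /annulus /= ltr_norml => /andP[? ?]; apply/andP; split; lra.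
apply: le_trans (annulus_count_le alpha _ _) _; [lra|lra|].
have r0 : 0 <= r - kap by lra.
have := powB_le k r0 (_ : r - kap <= r + kap); rewrite (_ : r + kap - (r - kap) = 2 * kap); last ring.
move=> /(_ ltac:(lra)) h.
have h2 : (r + kap) ^+ k.-1 <= (1 + r + kap) ^+ k.-1.
  by rewrite lerXn2r ?nnegrE; lra.
have h3 : k%:R * (2 * kap) * (r + kap) ^+ k.-1 <= k%:R * (2 * kap) * (1 + r + kap) ^+ k.-1.
  by rewrite ler_wpM2l // !mulr_ge0.
have := ler_wpM2l (ltW B0) (le_trans h h3).
by rewrite addrA; clear; lra.
Qed.

End ShellCounts.

(** * The wide window, summed over all differences *)

Section WideTotal.
Variables (R : realType) (n : nat).
Notation k := n.+2.
Notation B := (unit_ball_volume R k).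
(** For fixed [y] the differences [d] correspond to the points [y + d] of one shell around [alpha],
    whatever [F] is. This is where summing over all differences at once pays. *)
Lemma wide_exchange (alpha : 'rV[R]_k) (A Delta rho gam c : R) (F : {fset 'rV[int]_k}) M b :
  0 < A -> 0 < rho - 2 * c ->
  (forall y, rho - c <= ldist alpha y <= gam * rho + c ->
    A / (ldist alpha y - c) ^+ n *
    (cnt [set m | `|ldist alpha m ^+ 2 - ldist alpha y ^+ 2| <= Delta])%:R <= b) ->
  0 <= b ->
  \sum_(d <- F) \sum_(y <- box k M)
    (wide_pair alpha Delta rho gam c d y)%:R * (A / (ldist alpha y - c) ^+ n)
  <= (cnt [set y | rho - c <= ldist alpha y <= gam * rho + c])%:R * b.
Proof.
move=> A0 rc H b0; rewrite exchange_big /=.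
apply: (@le_trans _ _ (\sum_(y <- box k M) (rho - c <= ldist alpha y <= gam * rho + c)%R%:R * b)).
  apply: ler_sum => y _; rewrite -mulr_suml.
  case: (boolP (rho - c <= ldist alpha y <= gam * rho + c)) => hy; last first.
    rewrite big1 ?mul0r // => d _; rewrite /wide_pair andbA.
    by move/negbTE: hy => ->.
  rewrite mul1r; apply: le_trans (H y hy); rewrite mulrC; have /andP[hy1 hy2] := hy.
  rewrite ler_wpM2l ?divr_ge0 ?exprn_ge0 ?(ltW A0) //; first by lra.
  rewrite sum_fset_indic ler_nat.
  apply: (@cnt_inj _ _ (fun d => y + d)).
  - apply: sub_finite_set (finite_sqdist_le alpha (ldist alpha y ^+ 2 + Delta)) => m /=.
    by rewrite ler_norml => /andP[_ h]; rewrite /sqdist -/(ldist alpha m); lra.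
  - by move=> d [_ /and3P[_ _]]; rewrite dformE.
  - by move=> ? ? _ _ /addrI.
rewrite -mulr_suml ler_wpM2r // sum_fset_indic ler_nat; apply: cnt_sub.
  by apply: sub_finite_set (finite_nball alpha (gam * rho + c)) => m /andP[].
by move=> m [].
Qed.

(** For [y] at distance $r$ the shell holds about $BkK\rho\,r^{k-2}$ points, and the weight
    $A/r^{k-2}$ removes the dependence on $r$; so the bound per [y] is uniform. The number of [y] is
    about $B\rho^k$ because $\gamma^k=2$. *)
Lemma wide_total (C A K gam c eps : R) : 0 < B -> 0 < C ->
  (forall (alpha : 'rV[R]_k) rho, 0 <= rho ->
    `|(cnt (nball alpha rho))%:R - B * rho ^+ k| <= C * (1 + rho) ^+ k.-1) ->
  0 < A -> 0 < K -> 1 <= gam -> gam ^+ k = 2 -> 0 <= c ->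
  0 < eps -> eps <= 1 ->
  exists2 rho0 : R, 0 < rho0 & forall rho (alpha : 'rV[R]_k) (F : {fset 'rV[int]_k}) M,
  rho0 <= rho ->
  \sum_(d <- F) \sum_(y <- box k M)
    (wide_pair alpha (K * rho) rho gam c d y)%:R * (A / (ldist alpha y - c) ^+ n)
  <= ((1 + eps) * (B * rho ^+ k)) *
     ((1 + eps) ^+ 2 * (A * rho * (B * k%:R * K + 2 * C * (gam + 1)))).
Proof.
move=> B0 C0 HC A0 K0 g1 gk c0 e0 e1.
have g0 : 0 <= gam by lra.
pose c3 := 1 + c + 2 * K.
have c30 : 0 <= c3 by rewrite /c3; clear -c0 K0; lra.
have [r1 r10 H1] := ratio_near1 k.-1 c30 e0.
(* Sized so that the errors at the two radii and the boundary error of the count of [y], all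
   measured by [th], add up to at most [eps B]. *)
pose th := eps * B / (3 * B + 1).
have B31 : 0 < 3 * B + 1 by rewrite addr_gt0 // mulr_gt0.
have th0 : 0 < th by rewrite divr_gt0 // mulr_gt0.
have thE : th * (3 * B + 1) = eps * B by rewrite /th divfK // gt_eqF.
have th2 : 0 < th / 2 by rewrite divr_gt0.
have c40 : 0 <= c + 1 by clear -c0; lra.
have [r2 r20 H2] := ratio_near1 k c40 th2.
have c2C : 0 <= 2 * C by rewrite mulr_ge0 // ltW.
have c50 : 0 <= 2 + c by clear -c0; lra.
have [r3 r31 H3] := @small_power R (2 * C) (2 + c) gam th k c2C c50 g0 th0 isT.
(* From [r4] on, replacing [q + r] by [2 r] in the denominator costs at most the factor [1 + eps]
   built into [kap]. *)
pose r4 := (1 + eps) * 2 * K / eps.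
have r40 : 0 < r4.
  by apply: divr_gt0 => //; apply: mulr_gt0 => //; apply: mulr_gt0 => //; clear -e0; lra.
have e01 : 0 < 1 + eps by clear -e0; lra.
exists (2 * (r1 + r2 + r3 + c3 + r4)); first by clear -r10 r20 r31 c30 r40; lra.
move=> rho alpha F M hr.
have rr1 : 2 * r1 <= rho by clear -hr r10 r20 r31 c30 r40; lra.
have rr2 : r2 <= rho by clear -hr r10 r20 r31 c30 r40; lra.
have rr3 : r3 <= rho by clear -hr r10 r20 r31 c30 r40; lra.
have rr4 : 2 * r4 <= rho by clear -hr r10 r20 r31 c30 r40; lra.
have rr5 : 2 * r1 + 2 * c3 <= rho by clear -hr r10 r20 r31 c30 r40; lra.
have rc3 : 2 * (1 + c + 2 * K) <= rho by rewrite -/c3; clear -rr5 r10; lra.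
have rho0 : 0 < rho by clear -rr1 r10; lra.
have rc : 0 < rho - 2 * c by clear -rc3 K0; lra.
have E0 : 0 <= B * k%:R * K + 2 * C * (gam + 1).
  by apply: addr_ge0; rewrite !mulr_ge0 ?addr_ge0 // ltW.
have b0 : 0 <= (1 + eps) ^+ 2 * (A * rho * (B * k%:R * K + 2 * C * (gam + 1))).
  by apply: mulr_ge0; rewrite ?sqr_ge0 // mulr_ge0 // mulr_ge0 // ltW.
apply: le_trans (@wide_exchange alpha A (K * rho) rho gam c F M _ A0 rc _ b0) _.
  move=> y; set r := ldist alpha y => /andP[y1 y2].
  pose kap := (1 + eps) * K * rho / (2 * r).
  have rh : rho <= 2 * r by clear -y1 rc; lra.
  have r0 : 0 < r by clear -rh rho0; lra.
  have rr : r1 <= r by clear -rr1 rh; lra.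
  have kap0 : 0 <= kap by apply/ltW/divr_gt0; rewrite !mulr_gt0.
  have kapK : kap <= 2 * K.
    rewrite /kap ler_pdivrMr ?mulr_gt0 //; apply: (@le_trans _ _ (2 * K * rho)).
      by rewrite ler_wpM2r ?(ltW rho0) // ler_wpM2r ?(ltW K0) //; clear -e1; lra.
    by rewrite ler_wpM2l // mulr_ge0 // ltW.
  have kapr : kap * (2 * r) = (1 + eps) * K * rho by rewrite /kap divfK // gt_eqF ?mulr_gt0.
  have [rc3' hratio] := H1 r rr.
  have rcc : r - c3 <= r - c by rewrite /c3; clear -K0; lra.
  have rcp : 0 < r - c by clear -rc3' rcc; lra.
  have p1 : (1 + r + kap) ^+ n.+1 <= (1 + eps) * (r - c) ^+ n.+1.
    apply: (@le_trans _ _ ((r + c3) ^+ n.+1)).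
      have s1 : 0 <= 1 + r + kap by clear -r0 kap0; lra.
      have s2 : 1 + r + kap <= r + c3 by rewrite /c3; clear -kapK c0; lra.
      by rewrite lerXn2r ?nnegrE // (le_trans s1).
    apply: le_trans hratio _; rewrite ler_wpM2l ?(ltW e01) //.
    by rewrite lerXn2r ?nnegrE ?(ltW rc3') ?(ltW rcp).
  have sub : (cnt [set m | (`|ldist alpha m ^+ 2 - r ^+ 2| <= K * rho)%R] <=
      cnt [set m | (`|ldist alpha m - r| < kap)%R])%N.
    apply: cnt_sub.
      apply: sub_finite_set (finite_nball alpha (r + kap)) => m /=; rewrite ltr_norml => /andP[_ h].
      by rewrite /nball /=; clear -h; lra.
    move=> m /=; have : 0 <= ldist alpha m := ldist_ge0 _ _.
    move: (ldist alpha m) => q q0 hq.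
    rewrite subr_sqr normrM (@ger0_norm _ (q + r)) ?addr_ge0 ?(ltW r0) // in hq.
    have qr : 0 < q + r by clear -q0 r0; lra.
    have K2 : 0 < K * rho by rewrite mulr_gt0.
    rewrite -ler_pdivlMr // in hq; apply: le_lt_trans (hq) _.
    have u0 : K * rho / (q + r) <= 2 * K.
      rewrite ler_pdivrMr // (_ : 2 * K * (q + r) = K * (2 * r) + 2 * K * q); last by ring.
      by rewrite ler_wpDr ?mulr_ge0 ?(ltW K0) // ler_wpM2l ?(ltW K0).
    have u1 : 2 * r - 2 * K <= q + r.
      have /andP[u3 _] : - (2 * K) <= q - r <= 2 * K by rewrite -ler_norml (le_trans hq).
      by clear -u3; lra.
    have u2 : 2 * r < (1 + eps) * (q + r).
      have u4 : r4 <= r by clear -rr4 rh; lra.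
      rewrite /r4 ler_pdivrMr // in u4.
      have := ler_wpM2l (ltW e01) u1.
      have : 0 < (1 + eps) * K by rewrite mulr_gt0.
      by clear -u4; lra.
    rewrite ltr_pdivrMr // -(@ltr_pM2r _ (2 * r)) ?mulr_gt0 //.
    rewrite (_ : kap * (q + r) * (2 * r) = K * rho * ((1 + eps) * (q + r))); last first.
      by rewrite mulrAC kapr; ring.
    by rewrite ltr_pM2l.
  apply: (@le_trans _ _ (A / (r - c) ^+ n * ((2 * B * k%:R * kap + 2 * C) * (1 + r + kap) ^+ k.-1))).
    rewrite ler_wpM2l ?divr_ge0 ?exprn_ge0 ?(ltW A0) ?(ltW rcp) //.
    apply: le_trans (shell_count_le C0 HC alpha B0 kap0 _); first by rewrite ler_nat.
    by apply: le_trans kapK _; clear -rr rc3' c0 K0; rewrite /c3 in rc3'; lra.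
  have q0 : 0 <= 2 * B * k%:R * kap + 2 * C.
    by rewrite addr_ge0 // mulr_ge0 // mulr_ge0 // mulr_ge0 // ltW.
  apply: (@le_trans _ _ (A / (r - c) ^+ n * ((2 * B * k%:R * kap + 2 * C) *
      ((1 + eps) * (r - c) ^+ n.+1)))).
    by rewrite ler_wpM2l ?divr_ge0 ?exprn_ge0 ?(ltW A0) ?(ltW rcp) // ler_wpM2l.
  have -> : A / (r - c) ^+ n * ((2 * B * k%:R * kap + 2 * C) * ((1 + eps) * (r - c) ^+ n.+1)) =
     (1 + eps) * A * ((2 * B * k%:R * kap + 2 * C) * (r - c)).
    by rewrite exprS; field; rewrite expf_neq0 // gt_eqF.
  have -> : (1 + eps) ^+ 2 * (A * rho * (B * k%:R * K + 2 * C * (gam + 1))) =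
    (1 + eps) * A * ((1 + eps) * (rho * (B * k%:R * K + 2 * C * (gam + 1)))) by ring.
  rewrite ler_wpM2l ?mulr_ge0 ?(ltW e01) ?(ltW A0) //.
  apply: (@le_trans _ _ ((2 * B * k%:R * kap + 2 * C) * r)).
    by rewrite ler_wpM2l // gerBl.
  have -> : (2 * B * k%:R * kap + 2 * C) * r = B * k%:R * (kap * (2 * r)) + 2 * C * r by ring.
  rewrite kapr.
  have -> : (1 + eps) * (rho * (B * k%:R * K + 2 * C * (gam + 1))) =
    B * k%:R * ((1 + eps) * K * rho) + 2 * C * ((1 + eps) * (rho * (gam + 1))) by ring.
  rewrite lerD2l ler_wpM2l //; apply: (@le_trans _ _ (rho * (gam + 1))).
    by clear -y2 rc c0; lra.
  by rewrite ler_peMl ?mulr_ge0 ?addr_ge0 ?(ltW rho0) //; clear -e0; lra.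
rewrite ler_wpM2r //.
have [q1 q2] := H2 rho rr2.
have gr : rho <= gam * rho by rewrite ler_peMl // ltW.
have [q3 q4] := H2 (gam * rho) (le_trans rr2 gr).
apply: (@le_trans _ _ (cnt (annulus alpha (rho - (c + 1)) (gam * rho + (c + 1))))%:R).
  rewrite ler_nat; apply: cnt_sub; first exact: finite_annulus.
  by move=> y /= /andP[h1 h2]; rewrite /annulus /=; clear -h1 h2; apply/andP; split; lra.
apply: le_trans (annulus_count_le C0 HC alpha (ltW q1) _) _; first by clear -gr c0; lra.
have p3 := H3 rho rr3.
rewrite (_ : 1 + (gam * rho + (c + 1)) = 2 + c + gam * rho); last by ring.
have p4 : (gam * rho + (c + 1)) ^+ k <= (2 + th) * rho ^+ k.
  apply: le_trans q4 _; have -> : 2 + th = (1 + th / 2) * gam ^+ k by rewrite gk; field.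
  rewrite -mulrA -exprMn ler_wpM2l //; first by clear -th0; lra.
  by rewrite lerXn2r ?nnegrE ?(ltW q3) ?mulr_ge0 ?(ltW rho0) // gerBl.
have p5 : (1 - th / 2) * rho ^+ k <= (rho - (c + 1)) ^+ k.
  have rk : rho ^+ k <= (1 + th / 2) * (rho - (c + 1)) ^+ k.
    by apply: le_trans q2; rewrite lerXn2r ?nnegrE ?addr_ge0 ?(ltW rho0) // lerDl.
  have t0 : 0 <= rho ^+ k by rewrite exprn_ge0 // ltW.
  have s0 : 0 <= (rho - (c + 1)) ^+ k by rewrite exprn_ge0 // ltW.
  move: rk t0 s0; move: (rho ^+ k) ((rho - (c + 1)) ^+ k) => t s rk t0 s0.
  have [th1|th1] := leP (1 - th / 2) 0.
    by apply: le_trans s0; rewrite mulr_le0_ge0.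
  apply: le_trans (ler_wpM2l (ltW th1) rk) _.
  rewrite mulrA (_ : (1 - th / 2) * (1 + th / 2) = 1 - (th / 2) ^+ 2); last by ring.
  by rewrite mulrBl mul1r gerBl mulr_ge0 // sqr_ge0.
have p6 := ler_wpM2l (ltW B0) (lerB p4 p5).
apply: le_trans (lerD p6 p3) _.
have t0 : 0 <= rho ^+ k by rewrite exprn_ge0 // ltW.
move: (rho ^+ k) t0 => t t0.
have -> : B * ((2 + th) * t - (1 - th / 2) * t) + th * t = (B + (3 / 2 * B * th + th)) * t by field.
have -> : (1 + eps) * (B * t) = (B + eps * B) * t by ring.
rewrite ler_wpM2r // lerD2l -thE.
have : 0 <= B * th by rewrite mulr_ge0 // ltW.
by clear; lra.
Qed.

End WideTotal.

(** * Exceptional differences *)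

Section Directions.
Variable R : realType.

Lemma dirichlet_approx (x : R) (Q : nat) : (0 < Q)%N ->
  exists q p : int, [/\ 1 <= q, q <= Q%:Z & `|q%:~R * x - p%:~R| <= Q%:R^-1].
Proof.
case: Q => // Q _; pose fr (j : nat) := j%:R * x - (Num.floor (j%:R * x))%:~R.
have fr01 j : 0 <= fr j < 1.
  have /andP[h1 h2] := floor_itv (j%:R * x); rewrite intrD in h2.
  by rewrite /fr; apply/andP; split; [rewrite subr_ge0|rewrite ltrBlDl].
have Qp : 0 < Q.+1%:R :> R by rewrite ltr0n.
have bin j : (Num.truncn (Q.+1%:R * fr j) < Q.+1)%N.
  have /andP[h1 h2] := fr01 j; rewrite -(ltr_nat R); apply: (@le_lt_trans _ _ (Q.+1%:R * fr j)).
    by rewrite truncn_le mulr_ge0.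
  by rewrite gtr_pMr.
(* Pigeonhole: [Q.+2] fractional parts in [Q.+1] bins, [Q.+1] being the original bound. *)
pose g (j : 'I_Q.+2) := Ordinal (bin j).
have /injectivePn[i [j ij gij]] : ~~ injectiveb g.
  by apply/negP => /injectiveP /leq_card; rewrite !card_ord ltnn.
wlog ltij : i j ij gij / (i < j)%N.
  move=> H; case: (ltngtP i j) => [|ji|/val_inj e]; first exact: H.
  - by apply: (H j i) => //; rewrite eq_sym.
  - by rewrite e eqxx in ij.
have close : `|fr j - fr i| <= Q.+1%:R^-1.
  have e : Num.truncn (Q.+1%:R * fr i) = Num.truncn (Q.+1%:R * fr j) by have [] := gij.
  have q0 l : 0 <= Q.+1%:R * fr l by have /andP[h _] := fr01 l; rewrite mulr_ge0.
  have /andP[a1 a2] := truncn_itv (q0 i); have /andP[b1 b2] := truncn_itv (q0 j).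
  rewrite -e in b1 b2; rewrite -(ler_pM2l Qp) -[X in X * `|_|]ger0_norm // -normrM mulfV ?gt_eqF //.
  rewrite -[(Num.truncn (Q.+1%:R * fr i)).+1%:R]natr1 in a2 b2.
  by rewrite mulrBr ler_norml; clear -a1 a2 b1 b2; apply/andP; split; lra.
exists (j%:Z - i%:Z), (Num.floor (j%:R * x) - Num.floor (i%:R * x)); split.
- lia.
- by move: (ltn_ord j); move: (nat_of_ord j) (nat_of_ord i) => j' i'; lia.
apply: le_trans close; rewrite !intrB -!pmulrn le_eqVlt; apply/orP/or_introl/eqP.
by congr `|_|; rewrite /fr; ring.
Qed.

(** With [x = d_2 / d_1] the value $v_1+v_2x$ is the step $\sigma$ of [vec12]: at most [s0] so that
    the steps are fine, at least [s1] so that a bounded number of steps goes round the circle many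
    times. *)
Definition steep (x s1 s0 : R) (V : nat) : Prop := exists v1 v2 : int,
  [/\ `|v1| <= V%:Z, `|v2| <= V%:Z, s1 <= v1%:~R + v2%:~R * x & v1%:~R + v2%:~R * x <= s0].

Lemma steep_or_rational (x b s1 : R) (Q V : nat) : (0 < Q)%N -> `|x| <= b ->
  Q%:R * (b + 1) + 1 <= V%:R ->
  steep x s1 Q%:R^-1 V \/
  exists q p : int, [/\ 1 <= q, q <= Q%:Z, `|p| <= V%:Z & `|q%:~R * x - p%:~R| < s1].
Proof.
move=> Q0 xb QV; have [q [p [q1 qQ h]]] := dirichlet_approx x Q0.
have Qr : 1 <= Q%:R :> R by rewrite ler1n.
have b0 : 0 <= b by exact: le_trans xb.
have qr : 1 <= (q%:~R : R) by rewrite (ler_int R 1).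
have qrQ : (q%:~R : R) <= Q%:R by rewrite pmulrn ler_int.
have Qi : Q%:R^-1 <= 1 :> R by rewrite invf_le1 // (lt_le_trans ltr01).
have qV : `|q| <= V%:Z.
  rewrite -(ler_int R) intr_norm -pmulrn ger0_norm; last by clear -qr; lra.
  apply: le_trans qrQ _; apply: le_trans QV; rewrite mulrDr mulr1.
  have : 0 <= Q%:R * b by rewrite mulr_ge0.
  by clear; lra.
have pV : `|p| <= V%:Z.
  rewrite -(ler_int R) intr_norm -pmulrn.
  have -> : p%:~R = q%:~R * x - (q%:~R * x - p%:~R) :> R by ring.
  apply: le_trans (ler_normB _ _) _; apply: le_trans (lerD (lexx _) h) _; rewrite normrM.
  have : `|q%:~R| * `|x| <= Q%:R * b by rewrite ler_pM // ger0_norm //; clear -qr; lra.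
  by clear -Qi QV Qr; lra.
have [hs|hs] := ltP `|q%:~R * x - p%:~R| s1; first by right; exists q, p.
left; have [s0|s0] := leP 0 (q%:~R * x - p%:~R).
  exists (- p), q; rewrite normrN mulrNz addrC; rewrite ger0_norm // in h hs.
exists p, (- q); rewrite normrN mulrNz mulNr; rewrite ltr0_norm // opprB in h hs.
by split.
Qed.

Lemma coordinate_fiber k (A : set 'rV[int]_k) (i : 'I_k) (D : nat) (l : R) : 0 <= l ->
  (forall m, A m -> m \in box k D) ->
  (forall m0, A m0 -> exists x : R, forall m, A m -> (forall j, j != i -> m 0 j = m0 0 j) ->
     x <= (m 0 i)%:~R <= x + l) ->
  (cnt A)%:R <= (D.*2.+1 ^ k.-1)%:R * (l + 1).
Proof.
case: k A i => [? []//|k] A i l0 AD H.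
have fA : finite_set A by apply: sub_finite_set (finite_fset (box k.+1 D)).
have q (m : 'rV[int]_k.+1) : m \in box k.+1 D -> forall j, (absz (m 0 j + D%:Z)%R < D.*2.+1)%N.
  by move=> /boxP B j; have := B j; lia.
pose h (m : 'rV[int]_k.+1) : {ffun 'I_k -> 'I_(D.*2.+1)} :=
  [ffun j => inord (absz (m 0 (lift i j) + D%:Z)%R)].
have := @cnt_fiber_le R _ {ffun 'I_k -> 'I_(D.*2.+1)} A h (l + 1) fA.
rewrite card_ffun !card_ord; apply => u.
set B := [set x | _]; have [->|/set0P[m0 B0]] := eqVneq B set0; first by rewrite cnt0 addr_ge0.
have same m : B m -> forall j, j != i -> m 0 j = m0 0 j.
  move=> [Am hm] j ji; have [Am0 hm0] := B0.
  have := hm; rewrite -hm0 => /ffunP.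
  case: (unliftP i j) ji => [j' ->|->]; last by rewrite eqxx.
  move=> _ /(_ j'); rewrite !ffunE => /(congr1 val) /=; rewrite !inordK ?q ?AD //.
  have /boxP/(_ (lift i j')) := AD m Am; have /boxP/(_ (lift i j')) := AD m0 Am0; lia.
have [x Hx] := H m0 B0.1.
apply: (@int_count R _ B (fun m => m 0 i) x l l0 _ _).2.
  by move=> m Bm; apply: Hx; [exact: Bm.1|exact: same].
move=> m m' Bm Bm' e; apply/rowP => j; have [->//|ji] := eqVneq j i.
by rewrite (same _ Bm) // (same _ Bm').
Qed.

Definition supn k (d : 'rV[int]_k) : nat := \max_i absz (d 0 i)%R.

Lemma supn_box k (d : 'rV[int]_k) D : (d \in box k D) = (supn d <= D)%N.
Proof.
apply/boxP/bigmax_leqP => H i; first by move=> _; have := H i; lia.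
by have := H i isT; lia.
Qed.

Lemma supn_attained k (d : 'rV[int]_k) : d != 0 -> exists i, d 0 i != 0 /\ absz (d 0 i) = supn d.
Proof.
move=> d0; have [i di] : exists i, d 0 i != 0.
  apply/existsP; apply: contraNT d0; rewrite negb_exists => /forallP H.
  by apply/eqP/rowP => i; rewrite mxE; apply/eqP; have := H i; rewrite negbK.
have c : (0 < #|'I_k|)%N by apply/card_gt0P; exists i.
have [j e] := @bigop.eq_bigmax _ (fun i => absz (d 0 i)) c.
exists j; split; last by rewrite /supn e.
have : (absz (d 0 i)%R <= absz (d 0 j)%R)%N by rewrite -e leq_bigmax.
by move: di; lia.
Qed.

(** The boundary of the box of size $D$ has $O(D^{k-1})$ points of weight $1/D$; summing the
    resulting $O(D^{k-2})$ over successive boxes gives the exponent. *)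
Lemma sum_inv_supn n D :
  \sum_(d <- box n.+2 D) (supn d)%:R^-1 <= 2 * n.+2%:R * 3 ^+ n.+1 * D%:R ^+ n.+1 :> R.
Proof.
have c0 : 0 <= 2 * n.+2%:R * 3 ^+ n.+1 :> R by rewrite !mulr_ge0 ?exprn_ge0.
elim: D => [|D IH].
  (* The origin contributes nothing, because the inverse of 0 is 0. *)
  rewrite expr0n mulr0 big_seq big1 // => d; rewrite supn_box leqn0 => /eqP ->.
  by rewrite invr0.
have sub : (box n.+2 D `<=` box n.+2 D.+1)%fset.
  by apply/fsubsetP => d; rewrite !supn_box => /leq_trans; apply.
rewrite (big_fsetID _ (mem (box n.+2 D))) /=.
have -> : [fset x in box n.+2 D.+1 | x \in box n.+2 D]%fset = box n.+2 D.
  apply/fsetP => d; rewrite !inE /=; apply/andP/idP => [[]//|h]; split => //.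
  exact: (fsubsetP sub).
set E := [fset x in _ | _]%fset.
have EE : E = (box n.+2 D.+1 `\` box n.+2 D)%fset.
  by apply/fsetP => d; rewrite !inE /= andbC.
have cE : (#|` E|)%:R <= 2 * n.+2%:R * (2 * D.+1%:R + 1) ^+ n.+1 :> R.
  rewrite EE cardfsD (fsetIidPr sub) !card_box natrB; last first.
    by rewrite leq_exp2r // ltnS leq_double.
  have e1 : (D.+1.*2.+1)%:R = 2 * D.+1%:R + 1 :> R by rewrite -muln2 -addn1 natrD natrM mulrC.
  have e2 : (D.*2.+1)%:R = 2 * D.+1%:R - 1 :> R.
    by rewrite -muln2 -addn1 natrD natrM -[D.+1%:R]natr1; ring.
  rewrite !natrX e1 e2.
  have D1 : 1 <= D.+1%:R :> R by rewrite ler1n.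
  apply: le_trans (powB_le n.+2 _ _) _; [lra|lra|].
  rewrite (_ : 2 * D.+1%:R + 1 - (2 * D.+1%:R - 1) = 2); last by ring.
  by rewrite mulrC [n.+2%:R * 2]mulrC mulrC.
apply: (@le_trans _ _ (2 * n.+2%:R * 3 ^+ n.+1 * D%:R ^+ n.+1 + 2 * n.+2%:R * 3 ^+ n.+1 * D.+1%:R ^+ n)).
  apply: lerD; first exact: IH.
  have Dp : 0 < D.+1%:R :> R by rewrite ltr0n.
  apply: (@le_trans _ _ (\sum_(d <- E) D.+1%:R^-1)).
    rewrite big_seq [leRHS]big_seq; apply: ler_sum => d.
    rewrite EE !inE !supn_box -ltnNge => /andP[h1 h2].
    by have -> : supn d = D.+1 by apply/eqP; rewrite eqn_leq h1 h2.
  rewrite big_const_seq count_predT iter_addr_0 -[_ *+ _]mulr_natl ler_pdivrMr //.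
  apply: le_trans cE _.
  have -> : 2 * n.+2%:R * 3 ^+ n.+1 * D.+1%:R ^+ n * D.+1%:R =
      2 * n.+2%:R * (3 * D.+1%:R) ^+ n.+1 :> R by rewrite exprMn [D.+1%:R ^+ n.+1]exprSr; ring.
  rewrite ler_wpM2l ?mulr_ge0 //.
  rewrite lerXn2r ?nnegrE ?addr_ge0 ?mulr_ge0 //.
  have : 1 <= D.+1%:R :> R by rewrite ler1n.
  by clear; lra.
rewrite -mulrDr ler_wpM2l // exprS [leRHS]exprS -[in leRHS]natr1 mulrDl mul1r natr1 lerD2r.
by rewrite ler_wpM2l // lerXn2r ?nnegrE // ler_nat.
Qed.

End Directions.

(** * Low pair correlation *)

Section Averages.
Variables (R : realType) (n : nat).
Notation k := n.+2.
Notation i1 := (ord0 : 'I_k).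
Notation i2 := (lift ord0 ord0 : 'I_k).
Notation B := (unit_ball_volume R k).

(** For an arbitrary difference only the averaging over one coordinate of [alpha] is used. This has
    the right order in [rho] and [d], with a constant depending on the side $1/q$ of the cube; that
    is enough because the bad differences are few. *)
Lemma bad_average (alpha : 'rV[R]_k) (A rho gam : R) (d : 'rV[int]_k) i (q P M : nat) :
  (0 < q)%N -> 0 < A -> 0 < rho -> d 0 i != 0 ->
  P.+1%:R * (\sum_(t : {ffun 'I_k -> 'I_P.+1}) \sum_(m <- box k M)
     (narrow_pair (gridpt alpha (q * P.+1)%:R t) A rho gam d m)%:R) <=
  (P.+1 ^ k)%:R * ((M.*2.+1 ^ k.-1)%:R *
     ((q * P.+1)%:R * (A / rho ^+ n) / (2 * `|(d 0 i)%:~R|) + 1)) :> R.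
Proof.
move=> q0 A0 rho0 di; rewrite (avg_coord _ i).
have -> : (P.+1 ^ k)%:R = \sum_(t : {ffun 'I_k -> 'I_P.+1}) 1 :> R.
  by rewrite sumr_const card_ffun !card_ord.
rewrite mulr_suml; apply: ler_sum => t _; rewrite mul1r.
have G0 : (0 < q * P.+1)%N by rewrite muln_gt0 q0.
have PG : (P.+1 <= q * P.+1)%N by rewrite leq_pmull.
have d0 : 0 <= A / rho ^+ n by rewrite divr_ge0 ?exprn_ge0 ?ltW.
apply: le_trans (coordinate_average (gridpt alpha (q * P.+1)%:R (upd t i ord0)) M G0 PG d0 di).
apply: ler_sum => s _; apply: ler_sum => m _.
rewrite (@gridpt_upd R k P.+1 alpha (q * P.+1)%:R t i s ord0) //.
set beta := move _ _ _.
case: (boolP (narrow_pair _ _ _ _ _ _)) => [/and3P[r1 _ /andP[h1 h2]]|_]; last by rewrite ler0n.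
have -> : 0 <= dform beta d m <= A / rho ^+ n; last by [].
rewrite h1 (le_trans h2) // ler_pM2l // lef_pV2 ?posrE ?exprn_gt0 ?(lt_le_trans rho0) //.
by rewrite lerXn2r ?nnegrE ?(ltW rho0) ?ldist_ge0.
Qed.

(** [good_direction] with [Delta = K rho], summed over [d]. The five factors [1 + eps] come from the
    visits (one), the number of [y] (one), the shells (two) and [Kbound] (one). *)
Lemma good_total (C A eps eta s1 gam : R) (q V Q : nat) : 0 < B -> 0 < C ->
  (forall (alpha : 'rV[R]_k) rho, 0 <= rho ->
    `|(cnt (nball alpha rho))%:R - B * rho ^+ k| <= C * (1 + rho) ^+ k.-1) ->
  0 < A -> 0 < eps -> eps <= 1 -> 0 < eta -> 0 < s1 -> 1 <= gam -> gam ^+ k = 2 ->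
  (2 <= q)%N -> (0 < Q)%N -> 3 * q%:R / eps <= Q%:R ->
  exists2 rho0 : R, 0 < rho0 & forall rho (alpha : 'rV[R]_k) (F : {fset 'rV[int]_k}) M P,
  rho0 <= rho ->
  (forall d, d \in F -> [/\ eta * rho <= `|(d 0 i1)%:~R|, `|(d 0 i1)%:~R| <= 4 * rho &
    steep ((d 0 i2)%:~R / (d 0 i1)%:~R) s1 Q%:R^-1 V]) ->
  \sum_(d <- F) \sum_(s < P.+1) \sum_(m <- box k M)
     (narrow_pair (move alpha i1 (s%:R / (q * P.+1)%:R)) A rho gam d m)%:R
  <= P.+1%:R * ((1 + eps) ^+ 5 * (A * k%:R / 2 * B ^+ 2 * rho ^+ k)) +
     #|` F|%:R * #|` box k M|%:R :> R.
Proof.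
move=> B0 C0 HC A0 e0 e1 eta0 s10 g1 gk q2 Q0 Qe.
have q0 : (0 < q)%N by exact: ltnW.
have qr : 0 < q%:R :> R by rewrite ltr0n.
have qr2 : 2 <= q%:R :> R by rewrite (ler_nat R 2).
have k1 : 1 <= k%:R :> R by rewrite ler1n.
have g2 : gam <= 2 by rewrite -gk ler_eXnr.
have Qr : 0 < Q%:R :> R by rewrite ltr0n.
have Qi : Q%:R^-1 <= eps / (3 * q%:R).
  by rewrite -[leRHS]invf_div lef_pV2 ?posrE // divr_gt0 // mulr_gt0.
have q1 : eps / (3 * q%:R) <= 6^-1.
  rewrite ler_pdivrMr ?mulr_gt0 //; clear -e1 qr2; lra.
have epsq : 0 < eps / (3 * q%:R) by rewrite divr_gt0 ?mulr_gt0.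
(* The loss from [2 om] to [2 om - 1] replaces [K] by [K - 4], as $|d_1|\le4\rho$; [K] is so large
   that this and the error of the shell count fit into one factor [1 + eps]. *)
pose K := 6 * C / (eps * B) + 8 / eps + 8.
have K1 : 0 < 6 * C / (eps * B) by rewrite divr_gt0 ?mulr_gt0.
have K2 : 8 <= 8 / eps by rewrite ler_pdivlMr // ger_pMr.
have K8 : 8 <= K by rewrite /K; clear -K1 K2; lra.
have K0 : 0 < K by clear -K8; lra.
have K4 : 0 < K - 4 by clear -K8; lra.
have Kbound : B * k%:R * K + 2 * C * (gam + 1) <= (1 + eps) * (B * k%:R * (K - 4)).
  have e2 : eps * B * K = 6 * C + 8 * B + 8 * eps * B by rewrite /K; field; rewrite !gt_eqF.
  have : 2 * C * (gam + 1) <= 6 * C * k%:R.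
    apply: (@le_trans _ _ (6 * C)); last by rewrite ler_peMr // mulr_ge0 // ltW.
    have : C * gam <= C * 2 by rewrite ler_pM2l.
    by clear; lra.
  have -> : (1 + eps) * (B * k%:R * (K - 4)) =
      B * k%:R * K + (eps * B * K) * k%:R - 4 * (1 + eps) * B * k%:R by ring.
  rewrite e2; have : 0 <= (1 - eps) * (B * k%:R) by rewrite mulr_ge0 ?subr_ge0 // mulr_ge0 // ltW.
  have : 0 <= eps * (B * k%:R) by rewrite mulr_ge0 ?(ltW e0) // mulr_ge0 // ltW.
  have : 0 <= B * k%:R by rewrite mulr_ge0 // ltW.
  by clear; lra.
(* The number of visits is [J l + J sig + 2 l / sig + 2]. This [J] makes the last two terms at most
   [J eps / (3 q)]; [sig <= 1 / Q] does the same for the second, and the excess of [l] over [1 / q]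
   is the third such error. *)
pose J := Num.bound ((2 / s1 + 2) * (3 * q%:R / eps)).
have J1 : (2 / s1 + 2) * (3 * q%:R / eps) < J%:R.
  by apply: archi_boundP; rewrite mulr_ge0 ?addr_ge0 ?divr_ge0 ?mulr_ge0 // ltW.
have J0 : 0 < J%:R :> R.
  by apply: le_lt_trans J1; rewrite mulr_ge0 ?addr_ge0 ?divr_ge0 ?mulr_ge0 // ltW.
have J2 : 2 / s1 + 2 <= J%:R * (eps / (3 * q%:R)).
  rewrite -ler_pdivrMr // invf_div; exact: ltW.
pose U := Num.bound (K / (2 * eta) + 2 + J%:R).
have U1 : K / (2 * eta) + 2 + J%:R < U%:R.
  by apply: archi_boundP; rewrite addr_ge0 // addr_ge0 // divr_ge0 ?mulr_ge0 // ltW.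
(* Displacements have length at most [c - 1], with [c] independent of [rho], [d] and [alpha]. *)
pose c := (U + 2 * J * V + 1)%N.
have c0 : 0 <= c%:R :> R by [].
have [r1 r10 H1] := wide_total B0 C0 HC A0 K0 g1 gk c0 e0 e1.
have AE : 0 < A / (2 * eta) / (eps / (6 * q%:R)) by rewrite !divr_gt0 ?mulr_gt0.
exists (r1 + (2 * c%:R + 2) + A / (2 * eta) / (eps / (6 * q%:R)) + 1).
  by clear -r10 c0 AE; lra.
move=> rho alpha F M P hr HF.
have rr1 : r1 <= rho by clear -r10 c0 AE hr; lra.
have rr2 : 2 * c%:R + 1 < rho by clear -r10 c0 AE hr; lra.
have rr3 : A / (2 * eta) / (eps / (6 * q%:R)) <= rho by clear -r10 c0 AE hr; lra.
have rho0 : 0 < rho by clear -rr1 r10; lra.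
pose kap := A / (2 * (eta * rho)).
have kap0 : 0 < kap by rewrite divr_gt0 ?mulr_gt0.
have kap1 : 2 * kap <= eps / (3 * q%:R).
  have rr4 : A / (2 * eta) / rho <= eps / (6 * q%:R).
    by rewrite ler_pdivrMr // [_ * rho]mulrC -ler_pdivrMr ?divr_gt0 ?mulr_gt0.
  have e2 : A / (2 * eta) / rho = kap by rewrite /kap; field; rewrite !gt_eqF.
  rewrite e2 in rr4; apply: (@le_trans _ _ (2 * (eps / (6 * q%:R)))); first by rewrite ler_pM2l.
  by rewrite le_eqVlt; apply/orP/or_introl/eqP; field; rewrite gt_eqF.
set G := (q * P.+1)%N.
have G0 : (0 < G)%N by rewrite muln_gt0 q0.
have PG : (P.+1 <= G)%N by rewrite leq_pmull.
have tauE : P.+1%:R / G%:R = q%:R^-1 :> R.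
  by rewrite /G natrM invfM mulrCA mulfV ?mulr1 // pnatr_eq0.
have qi : q%:R^-1 <= 2^-1 :> R by rewrite lef_pV2 ?posrE.
have qi0 : 0 < q%:R^-1 :> R by rewrite invr_gt0.
have epsqE : eps / (3 * q%:R) = eps / 3 * q%:R^-1 by field; rewrite gt_eqF.
pose Wd d := \sum_(y <- box k (M + c)%N)
   (wide_pair alpha (K * rho) rho gam c%:R d y)%:R * (A / (ldist alpha y - c%:R) ^+ n).
(* Up to the losses this is [P.+1] divided by the full width [2 K rho] of the wide window; it no
   longer depends on [d]. *)
pose coef : R := P.+1%:R * (1 + eps) / (2 * ((K - 4) * rho)).
have e01 : 0 < 1 + eps by clear -e0; lra.
have Wd0 d : 0 <= Wd d.
  apply: sumr_ge0 => y _; case: (boolP (wide_pair _ _ _ _ _ _ _)) => [/and3P[h _ _]|_]; last by rewrite mul0r.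
  rewrite mul1r divr_ge0 ?exprn_ge0 ?(ltW A0) //; clear -h rr2 c0; lra.
have perd d : d \in F -> \sum_(s < P.+1) \sum_(m <- box k M)
     (narrow_pair (move alpha i1 (s%:R / G%:R)) A rho gam d m)%:R <= #|` box k M|%:R + coef * Wd d.
  move=> dF; have [d1a d1b [v1 [v2 [V1 V2 sg1 sg2]]]] := HF d dF.
  have D0 : 0 < `|(d 0 i1)%:~R| :> R by apply: lt_le_trans d1a; rewrite mulr_gt0.
  have d10 : d 0 i1 != 0 by rewrite -(intr_eq0 R) -normr_gt0.
  have sg0 := lt_le_trans s10 sg1.
  have c1 : (1 <= c)%N by rewrite /c addn1.
  have kapA : A / (2 * `|(d 0 i1)%:~R|) <= kap.
    by rewrite /kap ler_pM2l // lef_pV2 ?posrE ?mulr_gt0 // ler_pM2l.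
  have l1 : P.+1%:R / G%:R + 2 * kap <= 1 by rewrite tauE; clear -kap1 qi q1; lra.
  have om0 : K * rho / (2 * `|(d 0 i1)%:~R|) <= K / (2 * eta).
    rewrite ler_pdivrMr ?mulr_gt0 // mulrAC ler_pdivlMr ?mulr_gt0 //.
    by rewrite -!mulrA ler_pM2l // mulrCA ler_pM2l // mulrC.
  have om1 : K / 8 <= K * rho / (2 * `|(d 0 i1)%:~R|).
    rewrite ler_pdivlMr ?mulr_gt0 //.
    have := ler_wpM2l (ltW K0) d1b; clear; lra.
  have om2 : 0 < 2 * (K * rho / (2 * `|(d 0 i1)%:~R|)) - 1 by clear -om1 K8; lra.
  have sgJ : J%:R * (v1%:~R + v2%:~R * ((d 0 i2)%:~R / (d 0 i1)%:~R)) <= J%:R :> R.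
    rewrite -[leRHS]mulr1 ler_pM2l //; apply: le_trans sg2 _; clear -Qi q1; lra.
  have hU : K * rho / (2 * `|(d 0 i1)%:~R|) + kap + (P.+1%:R / G%:R + 2 * kap) +
      J%:R * (v1%:~R + v2%:~R * ((d 0 i2)%:~R / (d 0 i1)%:~R)) <= U%:R.
    by clear -om0 kap1 q1 l1 sgJ U1; lra.
  have := @good_direction R n alpha A rho gam (K * rho) kap d G P.+1 M J U V c v1 v2 A0 (le_trans ler01 g1) G0 PG d10 sg0 V1 V2 c1 kapA l1 hU (leqnn c)
    rr2 (ltW om2).
  rewrite -/(Wd d).
  move: sg0 sg1 sg2 sgJ hU; move: (v1%:~R + _) => sg sg0 sg1 sg2 sgJ hU.
  set l := P.+1%:R / G%:R + 2 * kap.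
  have l0 : 0 <= l by rewrite /l tauE; clear -qi0 kap0; lra.
  have vis : (J%:R * sg + 2) * (l / sg + 1) <= J%:R * ((1 + eps) / q%:R).
    have -> : (J%:R * sg + 2) * (l / sg + 1) = J%:R * l + J%:R * sg + 2 * (l / sg) + 2.
      by field; rewrite gt_eqF.
    have u1 : l / sg <= s1^-1.
      apply: (@le_trans _ _ sg^-1); first by rewrite ler_piMl // invr_ge0 ltW.
      by rewrite lef_pV2 ?posrE.
    have u2 : J%:R * l <= J%:R * (q%:R^-1 + eps / (3 * q%:R)).
      by rewrite ler_pM2l // /l tauE lerD2l.
    have u3 : J%:R * sg <= J%:R * (eps / (3 * q%:R)) by rewrite ler_pM2l // (le_trans sg2).
    have -> : J%:R * ((1 + eps) / q%:R) = J%:R * (q%:R^-1 + eps / (3 * q%:R)) +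
       J%:R * (eps / (3 * q%:R)) + J%:R * (eps / (3 * q%:R)) by field; rewrite gt_eqF.
    by clear -u1 u2 u3 J2; lra.
  set om := K * rho / (2 * `|(d 0 i1)%:~R|).
  set L := \sum_(s < _) _ => hL.
  have c0' : 0 <= G%:R / (2 * `|(d 0 i1)%:~R|) :> R by rewrite divr_ge0 ?mulr_ge0.
  have X := ler_wpM2r (Wd0 d) (ler_wpM2l c0' vis).
  rewrite -(lerD2l (J%:R * (2 * om - 1) * #|` box k M|%:R)) in X.
  have hL2 := le_trans hL X.
  have Jo : 0 < J%:R * (2 * om - 1) by rewrite mulr_gt0.
  rewrite -(ler_pM2l Jo); apply: le_trans hL2 _; rewrite [leRHS]mulrDr lerD2l [leRHS]mulrA.
  rewrite ler_wpM2r // -[leRHS]mulrA.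
  have -> : G%:R / (2 * `|(d 0 i1)%:~R|) * (J%:R * ((1 + eps) / q%:R)) =
     J%:R * (P.+1%:R * (1 + eps) / (2 * `|(d 0 i1)%:~R|)).
    rewrite /G natrM; move: (P.+1%:R : R) `|_| D0 => p D D0; field.
    by rewrite !gt_eqF.
  rewrite ler_pM2l // /coef; clear hL X L.
  rewrite /om; clear om Jo; move: (`|(d 0 i1)%:~R|) D0 d1b => D D0 d1b.
  move: (P.+1%:R : R) (ler0n R P.+1) => p p0.
  have -> : (2 * (K * rho / (2 * D)) - 1) * (p * (1 + eps) / (2 * ((K - 4) * rho))) =
     p * (1 + eps) / (2 * D) * ((K * rho - D) / ((K - 4) * rho)).
    by field; rewrite !gt_eqF.
  rewrite ler_peMr ?divr_ge0 ?mulr_ge0 ?(ltW D0) ?(ltW e01) //.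
  by rewrite ler_pdivlMr ?mulr_gt0 // mul1r; clear -d1b; lra.
rewrite big_seq; apply: le_trans (ler_sum _ perd) _; rewrite -big_seq big_split /=.
rewrite addrC; apply: lerD; last first.
  by rewrite big_const_seq count_predT iter_addr_0 -[_ *+ _]mulr_natl.
rewrite -mulr_sumr.
have coef0 : 0 <= coef by rewrite /coef divr_ge0 ?mulr_ge0 // ltW.
apply: le_trans (ler_wpM2l coef0 (H1 rho alpha F (M + c)%N rr1)) _.
have t0 : 0 <= rho ^+ k by rewrite exprn_ge0 // ltW.
have cc0 : 0 <= P.+1%:R * (1 + eps) ^+ 4 / (2 * (K - 4)) * (B * rho ^+ k) * A.
  apply: mulr_ge0 (ltW A0); apply: mulr_ge0 (mulr_ge0 (ltW B0) t0); apply: divr_ge0.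
    by rewrite mulr_ge0 // exprn_ge0 // ltW.
  by rewrite mulr_ge0 // ltW.
have := ler_wpM2l cc0 Kbound.
rewrite (_ : coef * _ = P.+1%:R * (1 + eps) ^+ 4 / (2 * (K - 4)) * (B * rho ^+ k) * A *
   (B * k%:R * K + 2 * C * (gam + 1))); last first.
  rewrite /coef; move: (rho ^+ k) => t; field; rewrite !gt_eqF //.
move/le_trans; apply; rewrite le_eqVlt; apply/orP/or_introl/eqP.
by move: (rho ^+ k) => t; field; rewrite gt_eqF.
Qed.

End Averages.

(** * Scarcity of bad differences *)

Section LowAverage.
Variables (R : realType) (n : nat).
Notation k := n.+2.
Notation i1 := (ord0 : 'I_k).
Notation i2 := (lift ord0 ord0 : 'I_k).
Notation B := (unit_ball_volume R k).

Definition good_dir (eta s1 : R) (Q V N : nat) (d : 'rV[int]_k) : Prop :=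
  eta * N%:R <= `|(d 0 i1)%:~R| /\ steep ((d 0 i2)%:~R / (d 0 i1)%:~R) s1 Q%:R^-1 V.

Lemma cnt_cover (T : choiceType) (U : finType) (F : {fset T}) (E : set T) (A : U -> set T) (b : R) :
  (forall x, E x -> x \in F) -> (forall x, E x -> exists u, A u x) ->
  (forall u, (cnt [set x | x \in F /\ A u x])%:R <= b) -> (cnt E)%:R <= #|U|%:R * b.
Proof.
move=> EF EA H; have -> : E = [set x | x \in F /\ `[< E x >]].
  by apply/seteqP; split => x /= => [Ex|[_ /asboolP]//]; split; [exact: EF|exact/asboolP].
rewrite -sum_fset_indic; apply: (@le_trans _ _ (\sum_(x <- F) \sum_u (`[< A u x >])%:R)).
  apply: ler_sum => x _; case: asboolP => [/EA[u Au]|_]; last by rewrite sumr_ge0.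
  by rewrite (bigD1 u) //= asboolT // lerDl sumr_ge0.
rewrite exchange_big /= mulr_natl -sumr_const; apply: ler_sum => u _.
rewrite sum_fset_indic; apply: le_trans (H u); rewrite ler_nat; apply: cnt_sub.
  by apply: sub_finite_set (finite_fset F) => x [].
by move=> x [xF /asboolP].
Qed.

Lemma box_side (N c : nat) : (0 < N)%N -> ((c * N).*2.+1)%:R <= (2 * c + 1)%:R * N%:R :> R.
Proof. by move=> N0; rewrite -natrM ler_nat -muln2; nia. Qed.

(** A bad difference lies in the slab $|d_1|\le\eta N$ or, by [steep_or_rational], in one of the
    slabs $|qd_2-pd_1|\le4s_1N$. The number of these is fixed by [Q] and [eta] before [s1] is
    chosen, so that together they are thin. *)
Lemma bad_count (eta2 : R) (Q : nat) : 0 < eta2 -> (0 < Q)%N ->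
  exists eta s1 : R, exists V N0 : nat, [/\ 0 < eta, 0 < s1 & forall N, (N0 <= N)%N ->
    (cnt [set d | d \in box k (4 * N)%N /\ ~ good_dir eta s1 Q V N d])%:R <=
      eta2 * N%:R ^+ k].
Proof.
move=> e20 Q0; have Qr : 0 < Q%:R :> R by rewrite ltr0n.
(* The side [8 N + 1] of the box is at most [9 N]. The factors 3 and 9 below absorb the [+ 1] of an
   integer count once [eta N] and [s1 N] are at least 1. *)
pose c9 : R := (2 * 4 + 1)%:R ^+ n.+1.
have c90 : 0 < c9 by rewrite exprn_gt0 // ltr0n.
pose eta : R := eta2 / (2 * c9 * 3).
have eta0 : 0 < eta by rewrite divr_gt0 ?mulr_gt0.
pose V := Num.bound (Q%:R * (4 / eta + 1) + 1 : R).
have V1 : Q%:R * (4 / eta + 1) + 1 < V%:R.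
  by apply: archi_boundP; rewrite addr_ge0 // mulr_ge0 // addr_ge0 // divr_ge0 // ltW.
pose c2 : R := (Q * V.*2.+1)%:R.
have c20 : 0 < c2 by rewrite ltr0n muln_gt0 Q0.
pose s1 : R := eta2 / (2 * c9 * c2 * 9).
have s10 : 0 < s1 by rewrite divr_gt0 ?mulr_gt0.
exists eta, s1, V, (Num.bound (1 / eta + 1 / s1)).+1; split => // N hN.
have N0 : (0 < N)%N by apply: leq_trans hN.
have Nr : 0 < N%:R :> R by rewrite ltr0n.
have hN2 : 1 / eta + 1 / s1 <= N%:R :> R.
  apply: (@le_trans _ _ (Num.bound (1 / eta + 1 / s1))%:R); last by rewrite ler_nat ltnW.
  by apply/ltW/archi_boundP; rewrite addr_ge0 // divr_ge0 // ltW.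
have i_eta : 0 < 1 / eta by rewrite divr_gt0.
have i_s1 : 0 < 1 / s1 by rewrite divr_gt0.
have N1 : 1 <= eta * N%:R by rewrite -ler_pdivrMl // -[_^-1]mul1r; clear -hN2 i_s1; lra.
have N2 : 1 <= s1 * N%:R by rewrite -ler_pdivrMl // -[_^-1]mul1r; clear -hN2 i_eta; lra.
pose A0 : set 'rV[int]_k := [set d | d \in box k (4 * N)%N /\ `|(d 0 i1)%:~R| <= eta * N%:R].
pose A1 (u : 'I_Q * 'I_(V.*2.+1)) : set 'rV[int]_k :=
  [set d | `|(u.1.+1)%:R * (d 0 i2)%:~R - (u.2%:Z - V%:Z)%:~R * (d 0 i1)%:~R| <= 4 * s1 * N%:R].
pose E1 : set 'rV[int]_k := [set d | d \in box k (4 * N)%N /\ exists u, A1 u d].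
have fb : finite_set [set` box k (4 * N)%N] by exact: finite_fset.
have side : ((4 * N).*2.+1 ^ k.-1)%:R <= c9 * N%:R ^+ n.+1 :> R.
  by rewrite natrX /c9 -exprMn lerXn2r ?nnegrE ?mulr_ge0 // box_side.
have b0 : (cnt A0)%:R <= (c9 * N%:R ^+ n.+1) * (3 * (eta * N%:R)).
  have l0 : 0 <= 2 * (eta * N%:R) by clear -N1; lra.
  apply: le_trans (@coordinate_fiber R k A0 i1 (4 * N)%N (2 * (eta * N%:R)) l0 _ _) _.
  - by move=> m [].
  - move=> m0 _; exists (- (eta * N%:R)) => m [_ h] _; move: h; rewrite ler_norml => /andP[h1 h2].
    by apply/andP; split => //; clear -h2; lra.
  apply: ler_pM => //; first by rewrite addr_ge0.
  by clear -N1; lra.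
have b1 : (cnt E1)%:R <= c2 * ((c9 * N%:R ^+ n.+1) * (9 * (s1 * N%:R))).
  have cU : #|{: 'I_Q * 'I_(V.*2.+1)}| = (Q * V.*2.+1)%N by rewrite card_prod !card_ord.
  rewrite /c2 -cU; apply: (@cnt_cover _ _ (box k (4 * N)%N) E1 A1) => [x []//|x []//|u].
  have l0 : 0 <= 8 * s1 * N%:R by clear -N2; lra.
  apply: le_trans (@coordinate_fiber R k _ i2 (4 * N)%N (8 * s1 * N%:R) l0 _ _) _.
  - by move=> m [].
  - move=> m0 _; pose z : R := (u.2%:Z - V%:Z)%:~R * (m0 0 i1)%:~R / (u.1.+1)%:R.
    exists (z - 4 * s1 * N%:R) => m [_ h] /(_ i1 isT) e; move: h; rewrite /A1 /= e.
    have u0 : 1 <= (u.1.+1)%:R :> R by rewrite ler1n.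
    have u0' : 0 < (u.1.+1)%:R :> R by rewrite ltr0n.
    rewrite (_ : _ - _ = (u.1.+1)%:R * ((m 0 i2)%:~R - z)); last first.
      by rewrite /z mulrBr [X in _ = _ - X]mulrC divfK // gt_eqF.
    rewrite normrM gtr0_norm // => h.
    have : `|(m 0 i2)%:~R - z| <= 4 * s1 * N%:R by apply: le_trans h; rewrite ler_peMl.
    by rewrite ler_norml => /andP[h1 h2]; clear -h1 h2; apply/andP; split; lra.
  apply: ler_pM => //; first by rewrite addr_ge0.
  by clear -N2; lra.
apply: (@le_trans _ _ (cnt (A0 `|` E1))%:R).
  rewrite ler_nat; apply: cnt_sub.
    by rewrite finite_setU; split; apply: sub_finite_set fb => d [].
  move=> d [dB ngood]; have [d1|d1] := leP `|(d 0 i1)%:~R| (eta * N%:R); first by left.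
  right; split => //.
  have d1p : 0 < `|(d 0 i1)%:~R| :> R by apply: lt_trans d1; rewrite mulr_gt0.
  have dn : (d 0 i1)%:~R != 0 :> R by rewrite -normr_gt0.
  have size j : `|(d 0 j)%:~R| <= 4 * N%:R :> R.
    by have /boxP/(_ j) := dB; rewrite -(ler_int R) intr_norm -pmulrn natrM.
  have xb : `|(d 0 i2)%:~R / (d 0 i1)%:~R| <= 4 / eta :> R.
    rewrite normrM normfV ler_pdivrMr // mulrAC ler_pdivlMr //.
    apply: le_trans (ler_wpM2r (ltW eta0) (size i2)) _; rewrite -mulrA ler_wpM2l //.
    by rewrite mulrC ltW.
  have [st|[q [p [q1 qQ pV h]]]] := steep_or_rational s1 Q0 xb (ltW V1).
    by case: ngood; split; first exact: ltW.
  have qb : (absz (q - 1)%R < Q)%N by clear -q1 qQ; lia.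
  have pb : (absz (p + V%:Z)%R < V.*2.+1)%N by clear -pV; lia.
  exists (Ordinal qb, Ordinal pb); rewrite /A1 /=.
  have -> : (absz (q - 1)).+1%:R = q%:~R :> R by rewrite pmulrn; congr _%:~R; clear -q1; lia.
  have -> : (absz (p + V%:Z)%R)%:Z - V%:Z = p by clear -pV; lia.
  rewrite (_ : _ - _ = (q%:~R * ((d 0 i2)%:~R / (d 0 i1)%:~R) - p%:~R) * (d 0 i1)%:~R);
    last by rewrite mulrBl -mulrA divfK.
  rewrite normrM (_ : 4 * s1 * N%:R = s1 * (4 * N%:R)); last by ring.
  by apply: ler_pM => //; exact: ltW.
apply: (@le_trans _ _ ((cnt A0)%:R + (cnt E1)%:R)).
  by rewrite -natrD ler_nat; apply: cntU; apply: sub_finite_set fb => d [].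
apply: le_trans (lerD b0 b1) _.
rewrite [N%:R ^+ k]exprSr; move: (N%:R : R) (N%:R ^+ n.+1 : R) => Y X.
rewrite le_eqVlt; apply/orP/or_introl/eqP.
have e1 : c9 * X * (3 * (eta * Y)) = eta2 / 2 * (X * Y).
  by rewrite /eta; field; rewrite gt_eqF.
have e2 : c2 * (c9 * X * (9 * (s1 * Y))) = eta2 / 2 * (X * Y).
  by rewrite /s1; field; rewrite !gt_eqF.
by rewrite e1 e2; field.
Qed.

End LowAverage.

(** * A grid point with few pairs *)

Section LowExists.
Variables (R : realType) (n : nat).
Notation k := n.+2.
Notation i1 := (ord0 : 'I_k).
Notation i2 := (lift ord0 ord0 : 'I_k).
Notation B := (unit_ball_volume R k).

(** Small differences are the dangerous ones for [bad_average], but those of norm at most [T]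
    contribute little even if all are bad; for the rest each weight is at most [1 / y] and the size
    of [F] decides. *)
Lemma sum_inv_split (F : {fset 'rV[int]_k}) (D T : nat) (y : R) : (T <= D)%N -> 0 < y ->
  y <= T.+1%:R -> {subset F <= box k D} ->
  \sum_(d <- F) (supn d)%:R^-1 <= 2 * k%:R * 3 ^+ n.+1 * T%:R ^+ n.+1 + y^-1 * (#|` F|)%:R :> R.
Proof.
move=> TD y0 yT FD.
apply: (@le_trans _ _ (\sum_(d <- F) ((supn d <= T)%N%:R * (supn d)%:R^-1 + y^-1))).
  apply: ler_sum => d _; case: (leqP (supn d) T) => h.
    by rewrite mul1r lerDl invr_ge0 ltW.
  rewrite mul0r add0r lef_pV2 ?posrE // ?ltr0n ?(leq_ltn_trans _ h) //.
  by apply: le_trans yT _; rewrite ler_nat.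
rewrite big_split /=; apply: lerD; last first.
  by rewrite big_const_seq count_predT iter_addr_0 mulr_natr.
apply: le_trans (sum_inv_supn R n T).
have sub : (box k T `<=` box k D)%fset.
  by apply/fsubsetP => d; rewrite !supn_box => /leq_trans; apply.
apply: (@le_trans _ _ (\sum_(d <- box k D) (supn d <= T)%N%:R * (supn d)%:R^-1)).
  apply: (ler_sum_inj (h := id) (g := fun d => (supn d <= T)%N%:R * (supn d)%:R^-1)) => //.
rewrite (big_fsetID _ (mem (box k T))) /=.
rewrite [X in _ + X]big_seq [X in _ + X]big1 ?addr0; last first.
  by move=> d; rewrite !inE /= !supn_box => /andP[_ /negbTE ->]; rewrite mul0r.
have -> : [fset x in box k D | x \in box k T]%fset = box k T.
  apply/fsetP => d; rewrite !inE /=; apply/andP/idP => [[]//|h]; split => //.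
  exact: (fsubsetP sub).
rewrite big_seq [leRHS]big_seq; apply: ler_sum => d; rewrite supn_box => ->.
by rewrite mul1r.
Qed.

Lemma exists_le_average (T : finType) (f : T -> R) (x : R) : (0 < #|T|)%N ->
  \sum_t f t <= #|T|%:R * x -> exists t, f t <= x.
Proof.
move=> T0 H; apply/existsP; apply: contraT; rewrite negb_exists => /forallP h.
have h' t : x < f t by rewrite ltNge.
have : #|T|%:R * x < \sum_t f t.
  have /card_gt0P[t0 _] := T0.
  rewrite mulr_natl -sumr_const (bigD1 t0) //= [ltRHS](bigD1 t0) //=.
  by apply: ltr_leD => //; apply: ler_sum => t _; exact: ltW.
by rewrite ltNge H.
Qed.

(** Some point of the grid is at most the mean over a cube of side below $1/q$. The four errors of
    size [eps / 4] are the loss in [good_total], the bad differences of norm up to [h N], the other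
    bad differences, and the rounding terms. *)
Lemma low_exists (C a eps gam : R) (q : nat) : 0 < B -> 0 < C ->
  (forall (alpha : 'rV[R]_k) rho, 0 <= rho ->
    `|(cnt (nball alpha rho))%:R - B * rho ^+ k| <= C * (1 + rho) ^+ k.-1) ->
  0 < a -> 0 < eps -> 1 <= gam -> gam ^+ k = 2 -> (2 <= q)%N ->
  exists N0 : nat, forall N (alpha : 'rV[R]_k), (N0 <= N)%N ->
  exists P : nat, exists t : {ffun 'I_k -> 'I_P.+1},
    \sum_(d <- box k (4 * N)%N | d != 0) \sum_(m <- box k (3 * N)%N)
      (narrow_pair (gridpt alpha (q * P.+1)%:R t) (2 * a / k%:R) N%:R gam d m)%:R
    <= (a * B ^+ 2 + eps) * N%:R ^+ k.
Proof.
move=> B0 C0 HC a0 e0 g1 gk q2; have q0 : (0 < q)%N by exact: ltnW.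
have kr : 0 < k%:R :> R by rewrite ltr0n.
have qr : 0 < q%:R :> R by rewrite ltr0n.
pose A := 2 * a / k%:R; have A0 : 0 < A by rewrite divr_gt0 ?mulr_gt0.
have AE : A * k%:R / 2 = a by rewrite /A; field; rewrite ?gt_eqF.
(* On $[0,1]$ one has $(1+x)^5\le1+31x$, as $31=2^5-1$. *)
pose ep : R := Num.min 1 (eps / (4 * 31 * (a * B ^+ 2))).
have aB0 : 0 < a * B ^+ 2 by rewrite mulr_gt0 // exprn_gt0.
have ep0 : 0 < ep by rewrite lt_min ltr01 divr_gt0 ?mulr_gt0.
have ep1 : ep <= 1 by rewrite ge_min lexx.
have epe : 31 * ep * (a * B ^+ 2) <= eps / 4.
  have : ep <= eps / (4 * 31 * (a * B ^+ 2)) by rewrite ge_min lexx orbT.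
  rewrite ler_pdivlMr ?mulr_gt0 //; clear; lra.
have ep5 : (1 + ep) ^+ 5 * (a * B ^+ 2) <= a * B ^+ 2 + eps / 4.
  apply: (@le_trans _ _ ((1 + 31 * ep) * (a * B ^+ 2))); last by rewrite mulrDl mul1r lerD2l.
  rewrite ler_wpM2r ?(ltW aB0) //.
  have u j : ep ^+ j.+1 <= ep by rewrite exprS ler_piMr ?(ltW ep0) // exprn_ile1 ?(ltW ep0).
  have -> : (1 + ep) ^+ 5 = 1 + 5 * ep ^+ 1 + 10 * ep ^+ 2 + 10 * ep ^+ 3 + 5 * ep ^+ 4 + ep ^+ 5.
    by ring.
  by have := u 0%N; have := u 1%N; have := u 2%N; have := u 3%N; have := u 4%N; clear; lra.
pose c7 : R := (2 * 3 + 1)%:R ^+ n.+1 * (q%:R * A / 2).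
have c70 : 0 < c7 by rewrite mulr_gt0 ?exprn_gt0 ?ltr0n // divr_gt0 ?mulr_gt0.
pose c3 : R := 2 * k%:R * 3 ^+ n.+1.
have c30 : 0 < c3 by rewrite mulr_gt0 ?mulr_gt0 ?exprn_gt0.
pose h : R := Num.min 1 (eps / (4 * c7 * c3)).
have h0 : 0 < h by rewrite lt_min ltr01 divr_gt0 ?mulr_gt0.
have h1 : h <= 1 by rewrite ge_min lexx.
have he : c7 * (c3 * h) <= eps / 4.
  have : h <= eps / (4 * c7 * c3) by rewrite ge_min lexx orbT.
  rewrite ler_pdivlMr ?mulr_gt0 //; clear; lra.
(* Proportional to [h], to pay for the factor [1 / (h N)] in [sum_inv_split]. *)
pose e2 : R := eps / (4 * c7) * h.
have e20 : 0 < e2 by rewrite mulr_gt0 // divr_gt0 ?mulr_gt0.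
pose Q := (Num.bound (3 * q%:R / ep)).+1.
have Q0 : (0 < Q)%N by [].
have Q1 : 3 * q%:R / ep <= Q%:R.
  apply: (@le_trans _ _ (Num.bound (3 * q%:R / ep))%:R); last by rewrite ler_nat.
  by apply/ltW/archi_boundP; rewrite divr_ge0 ?mulr_ge0 ?(ltW ep0).
have [eta [s1 [V [Nb [eta0 s10 Hbad]]]]] := @bad_count R n e2 Q e20 Q0.
have [r0 r00 Hgood] := @good_total R n C A ep eta s1 gam q V Q B0 C0 HC A0 ep0 ep1 eta0 s10 g1 gk q2 Q0 Q1.
exists (Nb + (Num.bound r0).+1)%N => N alpha hN.
have N0 : (0 < N)%N by apply: leq_trans hN; rewrite addnS.
have Nr : 0 < N%:R :> R by rewrite ltr0n.
have Nr0 : r0 <= N%:R.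
  apply: (@le_trans _ _ (Num.bound r0)%:R); first exact/ltW/archi_boundP/ltW.
  by rewrite ler_nat (leq_trans _ hN) // -addSnnS leq_addl.
have NNb : (Nb <= N)%N by apply: leq_trans hN; rewrite leq_addr.
set D := box k (4 * N)%N; set M := box k (3 * N)%N.
(* The mesh is chosen after [N]: the two rounding terms are bounded only in terms of [N], and are
   divided by [P.+1]. *)
pose P := Num.bound (((3 * N).*2.+1 ^ k.-1)%:R * (#|` D|)%:R * 4 / eps +
   (#|` D|)%:R * (#|` M|)%:R * 4 / eps : R).
have P1 : ((3 * N).*2.+1 ^ k.-1)%:R * (#|` D|)%:R + (#|` D|)%:R * (#|` M|)%:R <= P.+1%:R * (eps / 4).
  rewrite -ler_pdivrMr ?divr_gt0 // mulrDl invf_div.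
  apply: (@le_trans _ _ P%:R); last by rewrite ler_nat.
  rewrite !mulrA; apply/ltW/archi_boundP.
  by rewrite addr_ge0 // divr_ge0 ?mulr_ge0 ?(ltW e0).
exists P.
apply: exists_le_average; first by rewrite card_ffun !card_ord expn_gt0.
rewrite card_ffun !card_ord.
set G := (q * P.+1)%:R.
pose f d (t : {ffun 'I_k -> 'I_P.+1}) : R :=
  \sum_(m <- M) (narrow_pair (gridpt alpha G t) A N%:R gam d m)%:R.
have f0 d t : 0 <= f d t by rewrite sumr_ge0.
pose F := [fset d in D | `[< good_dir eta s1 Q V N d >]]%fset.
pose E := [fset d in D | (d != 0) && ~~ `[< good_dir eta s1 Q V N d >]]%fset.
rewrite exchange_big /= -/A.
have good : P.+1%:R * (\sum_(d <- F) \sum_t f d t) <= (P.+1 ^ k)%:R *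
   (P.+1%:R * ((1 + ep) ^+ 5 * (a * B ^+ 2 * N%:R ^+ k)) + (#|` D|)%:R * (#|` M|)%:R).
  rewrite exchange_big /= (avg_coord _ i1).
  have -> : (P.+1 ^ k)%:R = \sum_(t : {ffun 'I_k -> 'I_P.+1}) 1 :> R.
    by rewrite sumr_const card_ffun !card_ord.
  rewrite mulr_suml; apply: ler_sum => t _; rewrite mul1r exchange_big /=.
  apply: (@le_trans _ _ (P.+1%:R * ((1 + ep) ^+ 5 * (a * B ^+ 2 * N%:R ^+ k)) +
     (#|` F|)%:R * (#|` M|)%:R)); last first.
    rewrite lerD2l ler_wpM2r // ler_nat; apply: fsubset_leq_card.
    by apply/fsubsetP => d; rewrite !inE => /andP[].
  have HF d : d \in F -> [/\ eta * N%:R <= `|(d 0 i1)%:~R|, `|(d 0 i1)%:~R| <= 4 * N%:R :> R &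
      steep ((d 0 i2)%:~R / (d 0 i1)%:~R) s1 Q%:R^-1 V].
    rewrite !inE /= => /andP[/boxP/(_ i1) dB /asboolP[g2 g3]]; split; [exact: g2| |exact: g3].
    move: dB; rewrite -(ler_int R) intr_norm => dB; apply: le_trans dB _.
    by rewrite -pmulrn natrM.
  have step := Hgood N%:R (gridpt alpha G (upd t i1 ord0)) F (3 * N)%N P Nr0 HF.
  rewrite AE in step; apply: le_trans step.
  apply: ler_sum => d _; apply: ler_sum => s _; rewrite /f.
  by rewrite (@gridpt_upd R k P.+1 alpha G t i1 s ord0).
set X : R := ((3 * N).*2.+1 ^ k.-1)%:R in P1 *.
have X0 : 0 <= X by [].
have XN : X * (q%:R * A / 2) / N%:R ^+ n <= c7 * N%:R.
  have Nn : 0 < N%:R ^+ n :> R by rewrite exprn_gt0.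
  rewrite ler_pdivrMr // -[leRHS]mulrA -exprS /c7 [leRHS]mulrAC ler_wpM2r //.
    by rewrite divr_ge0 // mulr_ge0 // ltW.
  by rewrite /X natrX -exprMn lerXn2r ?nnegrE ?mulr_ge0 // box_side.
have ED : {subset E <= D} by move=> d; rewrite !inE => /andP[].
have cE : (#|` E|)%:R <= e2 * N%:R ^+ k.
  apply: le_trans (Hbad N NNb); rewrite ler_nat -[X in #|` X|]set_fsetK -/(cnt _).
  apply: cnt_sub => [|d /=]; first by apply: sub_finite_set (finite_fset D) => d [].
  by rewrite !inE /= => /and3P[dD _ /asboolP].
have hN0 : 0 < h * N%:R by rewrite mulr_gt0.
have /andP[T1 T2] := truncn_itv (ltW hN0); set T := Num.truncn (h * N%:R) in T1 T2.
have TD : (T <= 4 * N)%N.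
  rewrite -(ler_nat R) (le_trans T1) // natrM ler_wpM2r // (le_trans h1) //.
  by rewrite (ler_nat R 1 4).
have sumE : \sum_(d <- E) (supn d)%:R^-1 <= (c3 * h + eps / (4 * c7)) * N%:R ^+ n.+1.
  apply: le_trans (sum_inv_split TD hN0 (ltW T2) ED) _; rewrite [leRHS]mulrDl; apply: lerD.
    rewrite -/c3 -mulrA ler_wpM2l ?(ltW c30) //.
    apply: (@le_trans _ _ ((h * N%:R) ^+ n.+1)).
      by rewrite lerXn2r ?nnegrE ?(ltW hN0).
    rewrite exprMn ler_wpM2r ?exprn_ge0 //.
    by rewrite exprS ler_piMr ?(ltW h0) // exprn_ile1 ?(ltW h0).
  apply: (@le_trans _ _ ((h * N%:R)^-1 * (e2 * N%:R ^+ k))).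
    by rewrite ler_wpM2l // invr_ge0 ltW.
  rewrite [N%:R ^+ k]exprS /e2 le_eqVlt; apply/orP/or_introl/eqP.
  by move: (N%:R ^+ n.+1 : R) => Y; field; rewrite !gt_eqF.
have perd d : d \in E -> P.+1%:R * (\sum_t f d t) <= (P.+1 ^ k)%:R *
    (P.+1%:R * (X * (q%:R * A / 2) / N%:R ^+ n) * (supn d)%:R^-1 + X).
  rewrite !inE => /and3P[dD dn _]; have [i [di ie]] := supn_attained dn.
  have := @bad_average R n alpha A N%:R gam d i q P (3 * N)%N q0 A0 Nr di.
  rewrite -/X -/G -/M; move/le_trans; apply; rewrite ler_wpM2l // le_eqVlt; apply/orP/or_introl/eqP.
  have -> : `|(d 0 i)%:~R| = (supn d)%:R :> R by rewrite -ie -intr_norm -[RHS]pmulrn.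
  have s0 : (supn d)%:R != 0 :> R by rewrite -ie pnatr_eq0 absz_eq0.
  rewrite /G natrM; move: (P.+1%:R : R) ((supn d)%:R : R) s0 => p sd s0.
  have Nn : N%:R ^+ n != 0 :> R by rewrite expf_neq0 // gt_eqF.
  by move: (N%:R ^+ n : R) Nn => Y Y0; field; rewrite s0 Y0.
have bad : P.+1%:R * (\sum_(d <- E) \sum_t f d t) <= (P.+1 ^ k)%:R *
   (P.+1%:R * ((eps / 4 + eps / 4) * N%:R ^+ k) + X * (#|` D|)%:R).
  rewrite mulr_sumr; apply: (@le_trans _ _ (\sum_(d <- E) (P.+1 ^ k)%:R *
    (P.+1%:R * (X * (q%:R * A / 2) / N%:R ^+ n) * (supn d)%:R^-1 + X))).
    by rewrite big_seq [leRHS]big_seq; apply: ler_sum.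
  rewrite -mulr_sumr ler_wpM2l // big_split /=; apply: lerD; last first.
    rewrite big_const_seq count_predT iter_addr_0 -[leLHS]mulr_natr ler_wpM2l // ler_nat.
    by apply: fsubset_leq_card; apply/fsubsetP.
  rewrite -mulr_sumr -mulrA ler_wpM2l //.
  apply: (@le_trans _ _ (c7 * N%:R * ((c3 * h + eps / (4 * c7)) * N%:R ^+ n.+1))).
    apply: ler_pM => //; last by apply: sumr_ge0 => d _; rewrite invr_ge0.
    by rewrite divr_ge0 ?exprn_ge0 // mulr_ge0 // divr_ge0 // mulr_ge0 // ltW.
  rewrite [N%:R ^+ k]exprS; move: (N%:R ^+ n.+1 : R) (exprn_ge0 n.+1 (ltW Nr)) => Y Y0.
  have -> : c7 * N%:R * ((c3 * h + eps / (4 * c7)) * Y) = (c7 * (c3 * h) + eps / 4) * (N%:R * Y).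
    by field; rewrite gt_eqF.
  by rewrite ler_wpM2r ?mulr_ge0 // lerD2r.
have split_le : \sum_(d <- D | d != 0) \sum_t f d t <=
    \sum_(d <- F) (\sum_t f d t) + \sum_(d <- E) (\sum_t f d t).
  have t0 d : 0 <= \sum_t f d t by rewrite sumr_ge0.
  have -> : \sum_(d <- F) (\sum_t f d t) = \sum_(d <- D)
      (if `[< good_dir eta s1 Q V N d >] then \sum_t f d t else 0).
    by rewrite [LHS]big_fset /= [LHS]big_mkcond.
  have -> : \sum_(d <- E) (\sum_t f d t) = \sum_(d <- D)
      (if (d != 0) && ~~ `[< good_dir eta s1 Q V N d >] then \sum_t f d t else 0).
    by rewrite [LHS]big_fset /= [LHS]big_mkcond.
  rewrite [leLHS]big_mkcond -big_split /=.
  apply: ler_sum => d _; case: ifP => dn /=; last by rewrite addr0; case: ifP.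
  by case: ifP => _ /=; rewrite ?addr0 ?add0r.
have Pp : 0 < P.+1%:R :> R by rewrite ltr0n.
rewrite -(ler_pM2l Pp); apply: le_trans (ler_wpM2l (ltW Pp) split_le) _.
rewrite [leLHS]mulrDr; apply: le_trans (lerD good bad) _.
rewrite -[leLHS]mulrDr [leRHS]mulrCA ler_wpM2l //.
have Nk : 1 <= N%:R ^+ k :> R by rewrite exprn_ege1 // ler1n.
have Nk0 : 0 <= N%:R ^+ k :> R by rewrite exprn_ge0.
have last1 : P.+1%:R * (eps / 4) <= P.+1%:R * (eps / 4 * N%:R ^+ k).
  by rewrite ler_wpM2l // ler_peMr // divr_ge0 // ltW.
have last2 : P.+1%:R * ((1 + ep) ^+ 5 * (a * B ^+ 2 * N%:R ^+ k)) <=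
   P.+1%:R * ((a * B ^+ 2 + eps / 4) * N%:R ^+ k).
  by rewrite ler_wpM2l // mulrA ler_wpM2r.
apply: (@le_trans _ _ (P.+1%:R * ((a * B ^+ 2 + eps / 4) * N%:R ^+ k) +
   P.+1%:R * ((eps / 4 + eps / 4) * N%:R ^+ k) + P.+1%:R * (eps / 4 * N%:R ^+ k))).
  by clear -last1 last2 P1; lra.
rewrite le_eqVlt; apply/orP/or_introl/eqP.
by move: (N%:R ^+ k : R) (P.+1%:R : R) => Y p; field.
Qed.

End LowExists.

Section LowR2.
Variables (R : realType) (n : nat).
Notation k := n.+2.
Notation B := (unit_ball_volume R k).

Lemma cnt_pairs (T U : choiceType) (D : {fset T}) (S : set (T * U)) : finite_set S ->
  (forall p, S p -> p.1 \in D) -> cnt S = (\sum_(d <- D) cnt [set m | S (d, m)])%N.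
Proof.
move=> fS SD; have [->|/set0P[[x0 y0] S0]] := eqVneq S set0.
  by rewrite cnt0 big1 // => d _; rewrite cnt0.
rewrite (@cnt_fiber _ S (fun p => index p.1 D) (size D) fS); last first.
  by move=> p /SD; rewrite index_mem.
rewrite (big_nth x0) big_mkord; apply: eq_bigr => j _.
have jD : nth x0 D j \in D by rewrite mem_nth.
apply/eqP; rewrite eqn_leq; apply/andP; split.
  have fA : finite_set [set m | S (nth x0 D j, m)].
    apply: (@finite_inj _ _ (fun m => (nth x0 D j, m)) _ S) => // x y _ _ [].
  by [].
  apply: (@cnt_inj _ _ snd) => // [[d m] [/= Sdm ij]|[d m] [d' m'] /= [S1 i1] [S2 i2] ->].
    by rewrite -ij nth_index // (SD _ Sdm).
  congr (_, _); have := nth_index x0 (SD _ S1); have := nth_index x0 (SD _ S2).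
  by rewrite /= i1 i2 => <- ->.
apply: (@cnt_inj _ _ (fun m => (nth x0 D j, m))) => [|m /= Sm|x y _ _ [] //].
  by apply: sub_finite_set fS => p [].
by split => //=; rewrite index_uniq ?fset_uniq.
Qed.

Lemma root2_exists : exists2 gam : R, 1 <= gam & gam ^+ k = 2.
Proof.
exists (2 `^ (k%:R^-1)).
  by rewrite -[leLHS](powRr0 2) ler_powR // ?ler1n // invr_ge0.
rewrite -powR_mulrn ?powR_ge0 // -powRrM mulVf ?pnatr_eq0 //.
by rewrite powRr1.
Qed.

(** The factor 2 comes from orienting each pair by its nearer point [m]. Distances are at most [2 N]
    since $\gamma\le2$, so differences have coordinates up to [4 N], and [m] has coordinates up to
    [3 N] because those of [alpha] are at most [N]. *)
Lemma lpairs_bound (alpha : 'rV[R]_k) (a gam : R) (N : nat) : 0 < a -> 1 <= gam ->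
  gam ^+ k = 2 -> (forall i, `|alpha 0 i| <= N%:R) -> (0 < N)%N ->
  (cnt (lpairs alpha (- a) a (N%:R ^+ k)))%:R <=
  2 * \sum_(d <- box k (4 * N)%N | d != 0) \sum_(m <- box k (3 * N)%N)
      (narrow_pair alpha (2 * a / k%:R) N%:R gam d m)%:R :> R.
Proof.
move=> a0 g1 gk aN N0; have Nr : 0 < N%:R :> R by rewrite ltr0n.
have g0 : 0 <= gam := le_trans ler01 g1.
have g2 : gam <= 2 by rewrite -gk ler_eXnr.
have kr : 0 < k%:R :> R by rewrite ltr0n.
pose S : set ('rV[int]_k * 'rV[int]_k) := [set p | [/\ p.1 \in box k (4 * N)%N, p.1 != 0,
  p.2 \in box k (3 * N)%N & narrow_pair alpha (2 * a / k%:R) N%:R gam p.1 p.2]].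
have fS : finite_set S.
  apply: (@sub_finite_set _ _ ([set` box k (4 * N)%N] `*` [set` box k (3 * N)%N])).
    by move=> p [].
  exact: finite_setX.
have -> : \sum_(d <- box k (4 * N)%N | d != 0) \sum_(m <- box k (3 * N)%N)
      (narrow_pair alpha (2 * a / k%:R) N%:R gam d m)%:R = (cnt S)%:R :> R.
  rewrite (@cnt_pairs _ _ (box k (4 * N)%N) S fS) => [|p []//].
  rewrite natr_sum big_mkcond big_seq [RHS]big_seq; apply: eq_bigr => d dD.
  case: ifP => d0.
    rewrite sum_fset_indic; congr (cnt _)%:R; apply/seteqP; split => m /=.
      by move=> [mM nm]; split.
    by move=> [].
  by rewrite (_ : [set m | _] = set0) ?cnt0 //; apply/seteqP; split => m //= []; rewrite d0.
have core m p : m <> p -> N%:R ^+ k <= ldist alpha m ^+ k -> ldist alpha m ^+ k <= 2 * N%:R ^+ k ->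
    ldist alpha p ^+ k <= 2 * N%:R ^+ k -> ldist alpha m ^+ k <= ldist alpha p ^+ k ->
    ldist alpha p ^+ k - ldist alpha m ^+ k <= a -> S (p - m, m).
  move=> mp h1 h2 h3 h4 h5.
  have upper q : ldist alpha q ^+ k <= 2 * N%:R ^+ k -> ldist alpha q <= gam * N%:R.
    by rewrite -gk -exprMn ler_pXn2r // ?nnegrE ?mulr_ge0 ?ldist_ge0.
  have m1 : N%:R <= ldist alpha m by rewrite -(@ler_pXn2r _ k) // nnegrE ?ldist_ge0.
  have mn : ldist alpha m <= ldist alpha p by rewrite -(@ler_pXn2r _ k) // nnegrE ldist_ge0.
  have m2 := upper m h2; have p2 := upper p h3.
  have gN : gam * N%:R <= 2 * N%:R by rewrite ler_wpM2r.
  split => /=.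
  - apply/boxP => i; rewrite -(ler_int R) intr_norm -pmulrn natrM !mxE intrB.
    have -> : (p 0 i)%:~R - (m 0 i)%:~R =
       ((p 0 i)%:~R - alpha 0 i) - ((m 0 i)%:~R - alpha 0 i) :> R by ring.
    apply: le_trans (ler_normB _ _) _; have := ldist_coord alpha p i; have := ldist_coord alpha m i.
    by clear -m2 p2 gN; lra.
  - by rewrite subr_eq0; apply/eqP => pm; apply: mp.
  - apply/boxP => i; rewrite -(ler_int R) intr_norm -pmulrn natrM.
    have -> : (m 0 i)%:~R = ((m 0 i)%:~R - alpha 0 i) + alpha 0 i :> R by ring.
    apply: le_trans (ler_normD _ _) _; have := aN i; have := ldist_coord alpha m i.
    by clear -m2 gN; lra.
  - apply/and3P; split => //; rewrite dformE (_ : m + (p - m) = p); last by rewrite addrC subrK.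
    have m0 := ldist_ge0 alpha m.
    rewrite subr_ge0 lerXn2r ?nnegrE ?ldist_ge0 //=.
    rewrite ler_pdivlMr ?exprn_gt0 ?(lt_le_trans Nr) //.
    rewrite ler_pdivlMr // mulrC mulrA.
    have := diff_sqr_le_pow (isT : (2 <= k)%N) m0 mn; rewrite subSS subSS subn0 => h.
    by rewrite [leLHS]mulrAC; apply: le_trans h _; rewrite ler_pM2l.
have fl := (cnt_close_pairs (isT : (0 < k)%N) alpha (- a) a (N%:R ^+ k)).1.
rewrite mulr_natl mulr2n -natrD ler_nat.
pose A1 := lpairs alpha (- a) a (N%:R ^+ k) `&` [set p | ldist alpha p.1 ^+ k <= ldist alpha p.2 ^+ k].
pose A2 := lpairs alpha (- a) a (N%:R ^+ k) `&` [set p | ldist alpha p.2 ^+ k <= ldist alpha p.1 ^+ k].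
have f1 : finite_set A1 by apply: sub_finite_set fl => p [].
have f2 : finite_set A2 by apply: sub_finite_set fl => p [].
apply: (@leq_trans (cnt (A1 `|` A2))).
  apply: cnt_sub; first by rewrite finite_setU; split; [exact: f1|exact: f2].
  by move=> p lp; case: (leP (ldist alpha p.1 ^+ k) (ldist alpha p.2 ^+ k)) => h; [left|right];
    split => //; exact: ltW.
apply: leq_trans (cntU f1 f2) _; apply: leq_add.
  apply: (@cnt_inj _ _ (fun p => (p.2 - p.1, p.1)) A1 S fS).
    move=> [m p] [[/= mp]]; rewrite !in_itv /= => /andP[h1 h2] /andP[h3 h4] /andP[h5 h6] h7.
    by apply: core => //; clear -h5; lra.
  by move=> [m p] [m' p'] /= _ _ [/[swap] ->] /addIr ->.
apply: (@cnt_inj _ _ (fun p => (p.1 - p.2, p.2)) A2 S fS).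
  move=> [p m] [[/= mp]]; rewrite !in_itv /= => /andP[h1 h2] /andP[h3 h4] /andP[h5 h6] h7.
  by apply: core => // e; apply: mp.
by move=> [m p] [m' p'] /= _ _ [/[swap] ->] /addIr ->.
Qed.

Lemma low_R2 (a eps delta : R) (alpha0 : 'rV[R]_k) (Mb : R) : 0 < a -> 0 < eps -> 0 < delta ->
  exists alpha : 'rV[R]_k, (forall i, `|alpha0 0 i - alpha 0 i| < delta) /\
    exists2 L : R, Mb <= L & R2 alpha (- a) a L < 2 * a * B + eps.
Proof.
move=> a0 e0 d0; have [B0 [C C0 HC]] := lattice_count_ball R k.
have [gam g1 gk] := root2_exists.
pose q := (Num.bound delta^-1).+2.
have qd : delta^-1 < q%:R.
  apply: (@lt_trans _ _ (Num.bound delta^-1)%:R); last by rewrite ltr_nat ltnW.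
  by apply: archi_boundP; rewrite invr_ge0 ltW.
have q2 : (2 <= q)%N by [].
have qr : 0 < q%:R :> R by rewrite ltr0n.
have e1 : 0 < eps * B / 3 by rewrite divr_gt0 ?mulr_gt0.
have [N0 H] := low_exists B0 C0 HC a0 e1 g1 gk q2.
pose s := \sum_i (`|alpha0 0 i| + delta).
have s0 : 0 <= s by apply: sumr_ge0 => i _; rewrite addr_ge0 // ltW.
pose N := (N0 + (Num.bound (s + `|Mb|)).+1)%N.
have NN0 : (N0 <= N)%N by rewrite leq_addr.
have Npos : (0 < N)%N by rewrite /N addnS.
have Nr : 0 < N%:R :> R by rewrite ltr0n.
have sN : s + `|Mb| <= N%:R.
  apply: (@le_trans _ _ (Num.bound (s + `|Mb|))%:R); first by apply/ltW/archi_boundP; rewrite addr_ge0.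
  by rewrite ler_nat /N addnS ltnW // ltnS leq_addl.
have [P [t Ht]] := H N alpha0 NN0.
exists (gridpt alpha0 (q * P.+1)%:R t).
have near i : `|alpha0 0 i - gridpt alpha0 (q * P.+1)%:R t 0 i| < delta.
  rewrite mxE opprD addrA subrr sub0r normrN ger0_norm ?divr_ge0 //.
  apply: (@le_lt_trans _ _ (q%:R^-1)); last by rewrite invf_plt ?posrE.
  have Pp : 0 < P.+1%:R :> R by rewrite ltr0n.
  rewrite natrM ler_pdivrMr ?mulr_gt0 // mulKf ?gt_eqF // ler_nat ltnW //.
split => //; exists (N%:R ^+ k).
  have N1 : 1 <= N%:R :> R by rewrite ler1n.
  apply: le_trans (ler_norm Mb) _; apply: (@le_trans _ _ N%:R).
    by apply: le_trans sN; rewrite lerDr.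
  by rewrite ler_eXnr.
have aN i : `|gridpt alpha0 (q * P.+1)%:R t 0 i| <= N%:R.
  have -> : gridpt alpha0 (q * P.+1)%:R t 0 i =
    alpha0 0 i - (alpha0 0 i - gridpt alpha0 (q * P.+1)%:R t 0 i) by ring.
  apply: le_trans (ler_normB _ _) _; apply: (@le_trans _ _ s).
    apply: le_trans (lerD (lexx _) (ltW (near i))) _.
    by rewrite /s (bigD1 i) //= lerDl sumr_ge0 // => j _; rewrite addr_ge0 // ltW.
  by apply: le_trans sN; rewrite lerDl.
have := lpairs_bound a0 g1 gk aN Npos.
set c := cnt _ => hc.
rewrite R2E // -/c ltr_pdivrMr; last by rewrite mulr_gt0 ?exprn_gt0.
apply: le_lt_trans hc _; apply: (@le_lt_trans _ _ (2 * ((a * B ^+ 2 + eps * B / 3) * N%:R ^+ k))).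
  by rewrite ler_pM2l.
have Y0 : 0 < N%:R ^+ k :> R by rewrite exprn_gt0.
move: (N%:R ^+ k : R) Y0 => Y Y0.
have -> : (2 * a * B + eps) * (B * Y) = 2 * ((a * B ^+ 2 + eps * B / 3) * Y) + eps * B / 3 * Y by field.
by rewrite ltrDl mulr_gt0.
Qed.

End LowR2.

(** * Baire category on the torus *)

Section Semicontinuity.
Variables (R : realType) (k : nat).
Hypothesis k0 : (0 < k)%N.
Implicit Types alpha beta : 'rV[R]_k.

Lemma near_coord alpha (e : R) : 0 < e ->
  \forall beta \near alpha, forall i, `|alpha 0 i - (beta : 'rV[R]_k) 0 i| < e.
Proof.
move=> e0; apply/nbhs_ballP; exists e => //= beta ab i.
exact: (ab.2 0 i).
Qed.

Lemma nbhs_coord alpha (U : set 'rV[R]_k) : nbhs alpha U ->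
  exists2 e : R, 0 < e & forall beta, (forall i, `|alpha 0 i - beta 0 i| < e) -> U beta.
Proof.
move=> /nbhs_ballP[e /= e0 H]; exists e => // beta h; apply: H; split => // i j.
by rewrite ord1; exact: h.
Qed.

Lemma ldist_continuous (m : 'rV[int]_k) : continuous (fun alpha : 'rV[R]_k => ldist alpha m).
Proof.
move=> alpha; apply/cvgrPdist_lt => [|e e0]; first exact: (nbhs_filter alpha).
have d0 : 0 < e / k%:R by rewrite divr_gt0 // ltr0n.
have := near_coord alpha d0; apply: (@filterS _ _ (nbhs_filter alpha)) => beta H.
apply: le_lt_trans (ldist_lip alpha beta m m) _.
apply: (@lt_le_trans _ _ (\sum_(i < k) e / k%:R)); last first.
  by rewrite sumr_const card_ord -[_ *+ _]mulr_natr divfK // pnatr_eq0 -lt0n.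
have H' i : `|(m 0 i)%:~R - (m 0 i)%:~R - (alpha 0 i - beta 0 i)| < e / k%:R.
  by rewrite subrr sub0r normrN.
rewrite (bigD1 (Ordinal k0)) //= [ltRHS](bigD1 (Ordinal k0)) //=.
by apply: ltr_leD => //; apply: ler_sum => i _; exact: ltW.
Qed.

Lemma ldistX_continuous (m : 'rV[int]_k) : continuous (fun alpha : 'rV[R]_k => ldist alpha m ^+ k).
Proof.
move=> alpha; apply: (@continuous_comp _ _ _ (fun a => ldist a m) (fun x => x ^+ k)).
  exact: ldist_continuous.
exact: exprn_continuous.
Qed.

Lemma cont_near_gt (f : 'rV[R]_k -> R) alpha (c : R) : continuous f -> c < f alpha ->
  \forall beta \near alpha, c < f beta.
Proof. by move=> fc h; have /cvgr_gt := fc alpha; apply. Qed.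

Lemma cont_near_lt (f : 'rV[R]_k -> R) alpha (c : R) : continuous f -> f alpha < c ->
  \forall beta \near alpha, f beta < c.
Proof. by move=> fc h; have /cvgr_lt := fc alpha; apply. Qed.

Lemma near_fset (T : choiceType) alpha (F : {fset T}) (P : T -> 'rV[R]_k -> Prop) :
  (forall x, x \in F -> \forall beta \near alpha, P x beta) ->
  \forall beta \near alpha, forall x, x \in F -> P x beta.
Proof.
move=> H.
have := @filter_bigI _ _ F (fun x => [set b | P x b]) _ (nbhs_filter alpha) H.
apply: (@filterS _ _ (nbhs_filter alpha)) => b h x xF; exact: (h x xF).
Qed.

(** All conditions are closed, so a pair that fails at [alpha] fails nearby, and the bounded window
    leaves only finitely many candidate pairs to exclude. *)
Lemma lpairs_usc alpha (a X : R) :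
  \forall beta \near alpha, (cnt (lpairs beta (- a) a X) <= cnt (lpairs alpha (- a) a X))%N.
Proof.
have fin b := (cnt_close_pairs k0 b (- a) a X).1.
have X0 : 0 <= `|2 * X| + 1 by rewrite addr_ge0.
pose rho := Num.max 1 (`|2 * X|).
have fb : finite_set (nball alpha (rho + k%:R)) by exact: finite_nball.
pose F := fset_set (nball alpha (rho + k%:R) `*` nball alpha (rho + k%:R)).
have fF : finite_set (nball alpha (rho + k%:R) `*` nball alpha (rho + k%:R)) by exact: finite_setX.
have sub : \forall beta \near alpha, lpairs beta (- a) a X `<=` [set` F].
  near=> beta.
  have H : forall i, `|alpha 0 i - beta 0 i| < 1 by near: beta; exact: near_coord.
  have bnd m : ldist beta m ^+ k <= 2 * X -> nball alpha (rho + k%:R) m.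
    move=> h; have h1 : ldist beta m <= rho.
      rewrite leNgt; apply/negP => h2; have := le_trans h (ler_norm _).
      apply/negP; rewrite -ltNge; apply: (@lt_le_trans _ _ (ldist beta m)).
        by apply: le_lt_trans h2; rewrite le_max lexx orbT.
      rewrite ler_eXnr // (le_trans _ (ltW h2)) // le_max lexx //.
    have := ldist_lip alpha beta m m.
    have : \sum_i `|(m 0 i)%:~R - (m 0 i)%:~R - (alpha 0 i - beta 0 i)| <= k%:R.
      rewrite -[leRHS](_ : \sum_(i < k) 1 = _); last by rewrite sumr_const card_ord.
      by apply: ler_sum => i _; rewrite subrr sub0r normrN ltW.
    rewrite /nball /= => h3 /le_trans /(_ h3); rewrite ler_norml => /andP[_]; clear -h1; lra.
  move=> [m p] [/= _]; rewrite !in_itv /= => /andP[_ h1] /andP[_ h2] _.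
  by rewrite in_fset_set //; apply: mem_set; split; apply: bnd.
have out : \forall beta \near alpha, forall p, p \in F -> ~ lpairs alpha (- a) a X p ->
    ~ lpairs beta (- a) a X p.
  apply: near_fset => -[m p] _.
  have cm := @ldistX_continuous m; have cp := @ldistX_continuous p.
  have cd : continuous (fun b : 'rV[R]_k => ldist b m ^+ k - ldist b p ^+ k).
    by move=> b; exact: (@cvgB R R^o _ _ (nbhs_filter b) _ _ _ _ (cm b) (cp b)).
  case: (pselect (lpairs alpha (- a) a X (m, p))) => [lp|nlp].
    by near=> beta => /(_ lp).
  have [mp|/eqP mp] := eqVneq m p; first by near=> beta => _ [].
  have [h1|h1] := ltP (ldist alpha m ^+ k) X.
    have := cont_near_lt cm h1; apply: (@filterS _ _ (nbhs_filter alpha)) => b h _ [_]; rewrite in_itv /= => /andP[h' _].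
    by rewrite ltNge h' in h.
  have [h2|h2] := ltP (2 * X) (ldist alpha m ^+ k).
    have := cont_near_gt cm h2; apply: (@filterS _ _ (nbhs_filter alpha)) => b h _ [_]; rewrite in_itv /= => /andP[_ h'].
    by rewrite ltNge h' in h.
  have [h3|h3] := ltP (ldist alpha p ^+ k) X.
    have := cont_near_lt cp h3; apply: (@filterS _ _ (nbhs_filter alpha)) => b h _ [_ _]; rewrite in_itv /= => /andP[h' _].
    by rewrite ltNge h' in h.
  have [h4|h4] := ltP (2 * X) (ldist alpha p ^+ k).
    have := cont_near_gt cp h4; apply: (@filterS _ _ (nbhs_filter alpha)) => b h _ [_ _]; rewrite in_itv /= => /andP[_ h'].
    by rewrite ltNge h' in h.
  have [h5|h5] := ltP (ldist alpha m ^+ k - ldist alpha p ^+ k) (- a).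
    have := cont_near_lt cd h5; apply: (@filterS _ _ (nbhs_filter alpha)) => b h _ [_ _ _]; rewrite in_itv /= => /andP[h' _].
    by rewrite ltNge h' in h.
  have [h6|h6] := ltP a (ldist alpha m ^+ k - ldist alpha p ^+ k).
    have := cont_near_gt cd h6; apply: (@filterS _ _ (nbhs_filter alpha)) => b h _ [_ _ _]; rewrite in_itv /= => /andP[_ h'].
    by rewrite ltNge h' in h.
  by case: nlp; split => //=; rewrite in_itv /=; apply/andP.
near=> beta; apply: cnt_sub => // p lp; apply: contrapT => nlp.
have sF : lpairs beta (- a) a X `<=` [set` F] by near: beta; exact: sub.
have pF : p \in F by exact: sF.
have o : forall p, p \in F -> ~ lpairs alpha (- a) a X p -> ~ lpairs beta (- a) a X p.
  by near: beta; exact: out.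
exact: o pF nlp lp.
Unshelve. all: by end_near. Qed.

(* Exact coincidences strictly inside the window persist for nearby alpha. *)
Definition strict_pairs alpha (X : R) : set ('rV[int]_k * 'rV[int]_k) :=
  [set p | [/\ p.1 <> p.2, X < ldist alpha p.1 ^+ k < 2 * X &
     ldist alpha p.1 = ldist alpha p.2]].

Lemma strict_pairs_sub alpha (a X : R) : 0 < a -> strict_pairs alpha X `<=` lpairs alpha (- a) a X.
Proof.
move=> a0 [m p] [/= mp /andP[h1 h2] e]; split => //=; rewrite -?e in_itv /= ?(ltW h1) ?(ltW h2) //.
by rewrite subrr oppr_le0 (ltW a0).
Qed.

Lemma finite_strict_pairs alpha (X : R) : finite_set (strict_pairs alpha X).
Proof.
exact: sub_finite_set (@strict_pairs_sub alpha 1 X ltr01) (cnt_close_pairs k0 alpha (- 1) 1 X).1.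
Qed.

Lemma strict_pairs_lsc alpha (a X : R) : 0 < a ->
  \forall beta \near alpha, (cnt (strict_pairs alpha X) <= cnt (lpairs beta (- a) a X))%N.
Proof.
move=> a0; have fS := finite_strict_pairs alpha X.
have H : \forall beta \near alpha, forall p, p \in fset_set (strict_pairs alpha X) ->
    lpairs beta (- a) a X p.
  apply: near_fset => -[m p]; rewrite in_fset_set // => /set_mem[/= mp /andP[h1 h2] e].
  have cm := @ldistX_continuous m; have cp := @ldistX_continuous p.
  have cd : continuous (fun b : 'rV[R]_k => ldist b m ^+ k - ldist b p ^+ k).
    by move=> b; exact: (@cvgB R R^o _ _ (nbhs_filter b) _ _ _ _ (cm b) (cp b)).
  near=> b; split => //=; rewrite in_itv /=; apply/andP; split; apply: ltW; near: b.
  - exact: cont_near_gt cm _.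
  - exact: cont_near_lt cm _.
  - by apply: cont_near_gt cp _; rewrite -e.
  - by apply: cont_near_lt cp _; rewrite -e.
  - by apply: cont_near_gt cd _; rewrite e subrr oppr_lt0.
  - by apply: cont_near_lt cd _; rewrite e subrr.
near=> beta; apply: cnt_sub; first exact: (cnt_close_pairs k0 beta (- a) a X).1.
have h : forall p, p \in fset_set (strict_pairs alpha X) -> lpairs beta (- a) a X p.
  by near: beta; exact: H.
by move=> p sp; apply: h; rewrite in_fset_set //; exact: mem_set.
Unshelve. all: by end_near. Qed.

End Semicontinuity.

Local Open Scope quotient_scope.

HB.instance Definition _ (R : realType) (k : nat) :=
  Uniform_isComplete.Build 'rV[R]_k (@cauchy_cvg _).

(** * Open dense sets and the quotient map *)

Section TorusBaire.
Variables (R : realType) (k : nat).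
Implicit Types alpha beta : 'rV[R]_k.

Lemma pi_torusE alpha beta :
  \pi_(torus R k) alpha = \pi_(torus R k) beta <-> eqmodZ alpha beta.
Proof. by split => [/eqmodP|h]; [|apply/eqmodP]. Qed.

Lemma eqmodZ_shift alpha beta : eqmodZ alpha beta ->
  exists z : 'rV[int]_k, alpha = beta + map_mx intr z.
Proof.
move=> /forallP H; exists (\row_i Num.floor (alpha 0 i - beta 0 i)).
apply/rowP => i; rewrite !mxE; have /intrP[z e] := H i.
by rewrite e intrKfloor -e addrC subrK.
Qed.

Lemma shift_eqmodZ alpha (z : 'rV[int]_k) : eqmodZ (alpha + map_mx intr z) alpha.
Proof. by apply/forallP => i; rewrite !mxE addrC addrK intr_int. Qed.

Lemma shift_continuous beta : continuous (fun alpha : 'rV[R]_k => alpha + beta).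
Proof.
move=> alpha; apply: (@cvgD R _ _ _ (nbhs_filter alpha)); first exact: cvg_id.
exact: (@cvg_cst _ _ _ _ (nbhs_filter alpha)).
Qed.

Lemma pi_torus_open (U : set 'rV[R]_k) : open U -> open (\pi_(torus R k) @` U).
Proof.
move=> oU; rewrite /open /= /quotient_open.
have -> : \pi_(torus R k) @^-1` (\pi_(torus R k) @` U) =
    \bigcup_(z : 'rV[int]_k) ((fun alpha : 'rV[R]_k => alpha + map_mx intr z) @^-1` U).
  apply/seteqP; split => alpha /=.
    move=> [beta Ub /pi_torusE/eqmodZ_shift[z e]]; exists z => //=.
    by rewrite -e.
  move=> [z _ /= h]; exists (alpha + map_mx intr z) => //.
  by apply/pi_torusE; exact: shift_eqmodZ.
apply: bigcup_open => z _; move: oU; apply: (continuousP _).1; exact: shift_continuous.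
Qed.

Lemma dense_interior_near (W : set 'rV[R]_k) :
  (forall alpha (e : R), 0 < e -> exists2 beta, W° beta & forall i, `|alpha 0 i - beta 0 i| < e) ->
  dense W°.
Proof.
move=> H O [alpha Oa] oO; have [e e0 He] := nbhs_coord (open_nbhs_nbhs (conj oO Oa)).
by have [beta Wb hb] := H alpha e e0; exists beta; split => //; exact: He.
Qed.

(** Asking every representative to lie in [G i] means asking [alpha] to lie in all translates of
    [G i] by the countable group $\mathbb{Z}^k$. If the set were a union of nowhere dense [F i], the
    complements of the preimages of their closures would be open, and dense because the projection
    is open. Baire then gives a point of all these sets, whose class is in the set but in no
    [F i]. *)
Lemma torus_second_category (G : nat -> set 'rV[R]_k) :
  (forall i, open (G i) /\ dense (G i)) ->
  second_category [set x : torus R k | forall alpha, \pi_(torus R k) alpha = x ->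
    forall i, G i alpha].
Proof.
move=> HG [F Fnd CE].
pose H i := ~` (\pi_(torus R k) @^-1` closure (F i)).
pose S (i : nat) (z : 'rV[int]_k) := (fun alpha : 'rV[R]_k => alpha + map_mx intr z) @^-1` G i.
have oH i : open (H i).
  have : open (~` closure (F i)).
    by rewrite openC; exact: closed_closure.
  exact.
have dH i : dense (H i).
  move=> O [alpha Oa] oO; apply: contrapT => nO.
  have sub : \pi_(torus R k) @` O `<=` closure (F i).
    by move=> _ [beta Ob <-]; apply: contrapT => nc; apply: nO; exists beta.
  move: sub; rewrite (open_subsetE _ (pi_torus_open oO)) (Fnd i).
  by move=> /(_ (\pi_(torus R k) alpha)); apply; exists alpha.
have oS i z : open (S i z).
  by move: (HG i).1; apply: (continuousP _).1; exact: shift_continuous.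
have dS i z : dense (S i z).
  move=> O [alpha Oa] oO.
  have [||beta [/= Ob Gb]] := (HG i).2 ((fun a : 'rV[R]_k => a - map_mx intr z) @^-1` O).
  - by exists (alpha + map_mx intr z); rewrite /= addrK.
  - by move: oO; apply: (continuousP _).1; exact: shift_continuous.
  by exists (beta - map_mx intr z); split => //; rewrite /S /= subrK.
pose T : countType := (nat + nat * 'rV[int]_k)%type.
pose K (j : nat) : set 'rV[R]_k := match choice.unpickle j : option T with
  | Some (inl i) => H i | Some (inr (i, z)) => S i z | None => setT end.
have Kod j : open (K j) /\ dense (K j).
  rewrite /K; case: (choice.unpickle j) => [[i|[i z]]|].
  - by split; [exact: oH|exact: dH].
  - by split; [exact: oS|exact: dS].
  - by split; [exact: openT|move=> O [a Oa] _; exists a].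
have [|alpha [_ Ka]] := @Baire R 'rV[R]_k K Kod setT _ openT; first by exists 0.
have KE (t : T) : K (choice.pickle t) alpha by exact: Ka.
have : [set x : torus R k | forall alpha, \pi_(torus R k) alpha = x ->
   forall i, G i alpha] (\pi_(torus R k) alpha).
  move=> beta /pi_torusE/eqmodZ_shift[z ->] i.
  by have := KE (inr (i, z)); rewrite /K choice.pickleK.
rewrite CE => -[i _ Fi]; have := KE (inl i); rewrite /K choice.pickleK; apply.
exact: subset_closure.
Qed.

End TorusBaire.

(** * Linear independence *)

Section RationalHyperplanes.
Variables (R : realType) (k : nat).
Hypothesis k0 : (0 < k)%N.

Lemma linear_form_continuous (c : 'I_k -> R) :
  continuous (fun alpha : 'rV[R]_k => \sum_i c i * alpha 0 i).
Proof.
move=> alpha; apply/cvgrPdist_lt => [|e e0]; first exact: (nbhs_filter alpha).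
have s0 : 0 < 1 + \sum_i `|c i| by rewrite ltr_pwDl // sumr_ge0.
have d0 : 0 < e / (1 + \sum_i `|c i|) by rewrite divr_gt0.
have := near_coord alpha d0; apply: (@filterS _ _ (nbhs_filter alpha)) => beta H.
rewrite -sumrB; apply: le_lt_trans (ler_norm_sum _ _ _) _.
apply: (@le_lt_trans _ _ (\sum_i `|c i| * (e / (1 + \sum_i `|c i|)))).
  by apply: ler_sum => i _; rewrite -mulrBr normrM ler_wpM2l // ltW.
by rewrite -mulr_suml mulrCA gtr_pMr // ltr_pdivrMr // mul1r ltrDr.
Qed.

Lemma off_hyperplane_dense (q : 'rV[rat]_(k + 1)) : q != 0 ->
  dense [set alpha : 'rV[R]_k |
    \sum_i ratr (q 0 i) * (row_mx alpha (1%:M : 'rV[R]_1)) 0 i <> 0]°.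
Proof.
move=> q0; pose c i : R := ratr (q 0 (lshift 1 i)); pose d : R := ratr (q 0 (rshift k 0)).
pose f (alpha : 'rV[R]_k) := \sum_i c i * alpha 0 i.
have E (alpha : 'rV[R]_k) :
    \sum_i ratr (q 0 i) * (row_mx alpha (1%:M : 'rV[R]_1)) 0 i = f alpha + d.
  rewrite big_split_ord /= big_ord1 row_mxEr mxE mulr1; congr (_ + _).
  by apply: eq_bigr => i _; rewrite row_mxEl.
have fc : continuous f by exact: linear_form_continuous.
have int alpha : f alpha + d <> 0 -> [set alpha : 'rV[R]_k |
    \sum_i ratr (q 0 i) * (row_mx alpha (1%:M : 'rV[R]_1)) 0 i <> 0]° alpha.
  move=> /eqP; rewrite neq_lt => /orP[h|h].
    have := @cont_near_lt _ _ _ alpha (- d) fc.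
    rewrite -subr_lt0 opprK => /(_ h); apply: (@filterS _ _ (nbhs_filter alpha)) => b.
    by rewrite /= E -subr_lt0 opprK => h' /eqP; rewrite lt_eqF.
  have := @cont_near_gt _ _ _ alpha (- d) fc.
  rewrite -subr_gt0 opprK => /(_ h); apply: (@filterS _ _ (nbhs_filter alpha)) => b.
  by rewrite /= E -subr_gt0 opprK => h' /eqP; rewrite gt_eqF.
apply: dense_interior_near => alpha e e0.
have [h|h] := eqVneq (f alpha + d) 0; last first.
  by exists alpha => [|i]; [exact/int/eqP|rewrite subrr normr0].
(* If all [c i] vanished, so would [d], because [f alpha + d = 0], and then [q] would be 0. *)
have [i ci] : exists i, c i != 0.
  apply: contrapT => nc; have c0 i : c i = 0.
    by apply/eqP/negPn/negP => ci; apply: nc; exists i.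
  move/eqP: q0; apply; apply/rowP => j; rewrite mxE.
  apply: (fmorph_inj (ratr : {rmorphism rat -> R})); rewrite rmorph0.
  case: (splitP j) => [i ij|i ij].
    have -> : j = lshift 1 i by exact: val_inj.
    exact: c0.
  have -> : j = rshift k 0 by apply: val_inj => /=; rewrite ij ord1.
  by move: h; rewrite /f big1 ?add0r // => l _; rewrite c0 mul0r.
exists (alpha + (e / 2) *: delta_mx 0 i); last first.
  move=> j; rewrite !mxE opprD addNKr normrN normrM ger0_norm ?divr_ge0 // 1?ltW //.
  by case: (_ && _); rewrite ?normr1 ?normr0 ?mulr1 ?mulr0 //; lra.
apply: int; rewrite /f (eq_bigr (fun j => c j * alpha 0 j + (j == i)%:R * (c i * (e / 2)))); last first.
  move=> j _; rewrite !mxE eqxx /= mulrDr; congr (_ + _).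
  by case: eqVneq => [->|_]; rewrite ?mul1r ?mulr1 // mul0r !mulr0.
rewrite big_split /= -mulr_suml -/(f alpha) addrAC h add0r (bigD1 i) //= eqxx big1.
  by rewrite addr0 mul1r; apply/eqP; rewrite mulf_neq0 // gt_eqF // divr_gt0.
by move=> j /negbTE ->.
Qed.

(** The difference $|m-\alpha|^2-|n-\alpha|^2$ is an affine form in $\alpha$ with integral
    coefficients, the linear ones being $2(n_i-m_i)$. *)
Lemma ldist_inj (alpha : 'rV[R]_k) :
  lin_indep_over_rat (row_mx alpha (1%:M : 'rV[R]_1)) -> injective (ldist alpha).
Proof.
move=> li m n mn; apply/rowP => i.
pose d (j : 'I_k) : rat := (n 0 j - m 0 j)%:~R.
pose S : int := \sum_j (m 0 j ^+ 2 - n 0 j ^+ 2).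
pose e : rat := S%:~R.
have /rowP/(_ (lshift 1 i)) : row_mx (\row_j (2 * d j)) (e%:M : 'rV_1) = 0.
  apply: li; rewrite big_split_ord /= big_ord1 !row_mxEr !mxE mulr1 eqxx mulr1n.
  under eq_bigr do rewrite !row_mxEl mxE; rewrite /e ratr_int /S rmorph_sum /= -big_split /=.
  have : ldist alpha m ^+ 2 = ldist alpha n ^+ 2 by rewrite mn.
  rewrite !ldist_sqr => /eqP; rewrite -subr_eq0 -sumrB => /eqP h.
  apply: etrans h.
  apply: eq_bigr => j _; rewrite rmorphM /= ratr_nat /d ratr_int.
  by rewrite !rmorphB /= !rmorphXn /=; ring.
rewrite row_mxEl !mxE => /eqP; rewrite mulf_eq0 /= /d intr_eq0 subr_eq0 => /eqP ->//.
Qed.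

End RationalHyperplanes.

(** * Intermediate values of the pair correlation *)

Section LevelCrossing.
Variables (R : realType) (k : nat).
Hypothesis k0 : (0 < k)%N.
Notation B := (unit_ball_volume R k).
Implicit Types alpha : 'rV[R]_k.

Lemma root_exists (t : R) : 0 <= t -> exists2 r : R, 0 <= r & r ^+ k = t.
Proof.
move=> t0; exists (t `^ k%:R^-1); first exact: powR_ge0.
by rewrite -powR_mulrn ?powR_ge0 // -powRrM mulVf ?pnatr_eq0 -?lt0n // powRr1.
Qed.

Lemma ge_of_exp_ge (x y : R) : 0 <= x -> 0 <= y -> x ^+ k <= y ^+ k -> x <= y.
Proof. by move=> x0 y0; rewrite ler_pXn2r. Qed.

(** The $k$-th powers fill an interval of bounded length, so the volume term is bounded and the
    boundary error $O(s^{1-1/k})$ is small against $s$. The inner radius uses [s - 2 a] because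
    annuli are open at the inner end. *)
Lemma crowd_bound alpha (a eps : R) : 0 < a -> 0 < eps -> exists s0 : R, forall s, s0 <= s ->
  finite_set [set n | `|ldist alpha n ^+ k - s| <= a] /\
  (cnt [set n | `|ldist alpha n ^+ k - s| <= a])%:R <= eps * s.
Proof.
move=> a0 e0; have [B0 [C C0 HC]] := lattice_count_ball R k.
have C2 : 0 <= 2 * C by rewrite mulr_ge0 // ltW.
have e4 : 0 < eps / 4 by rewrite divr_gt0.
have [r0 r01 Hr] := small_power C2 (@ler01 R) (@ler01 R) e4 k0.
exists (Num.max (2 * a) (Num.max (r0 ^+ k) (6 * a * B / eps))) => s.
rewrite !ge_max => /and3P[sa sr]; rewrite ler_pdivrMr // => sB.
have [y y0 yk] := @root_exists (s + a) ltac:(lra).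
have [x x0 xk] := @root_exists (s - 2 * a) ltac:(lra).
have xy : x <= y by apply: ge_of_exp_ge => //; rewrite xk yk; lra.
have sub : [set n | `|ldist alpha n ^+ k - s| <= a] `<=` annulus alpha x y.
  move=> n /=; rewrite ler_norml => /andP[h1 h2]; apply/andP; split.
    rewrite ltNge; apply/negP => h; have : ldist alpha n ^+ k <= x ^+ k.
      by rewrite lerXn2r ?nnegrE ?ldist_ge0.
    rewrite xk; lra.
  by apply: ge_of_exp_ge; rewrite ?ldist_ge0 // yk; lra.
have fin := @finite_annulus _ _ alpha x y.
split; first exact: sub_finite_set sub fin.
apply: (@le_trans _ _ (cnt (annulus alpha x y))%:R); first by rewrite ler_nat; exact: cnt_sub.
apply: le_trans (annulus_count_le C0 HC alpha x0 xy) _.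
have r0y : r0 <= y by apply: ge_of_exp_ge => //; rewrite ?yk; lra.
have := Hr y r0y; rewrite mul1r yk xk => h.
have : eps / 4 * (s + a) <= eps * s / 2.
  rewrite -mulrA mulrAC -mulrA ler_pM2l //; lra.
move: h sB; clear; set P := 2 * C * _; lra.
Qed.

Lemma seq_gap (T : eqType) (f : T -> R) (s : seq T) : exists2 eta : R, 0 < eta &
  forall x, x \in s -> f x != 0 -> eta <= `|f x|.
Proof.
elim: s => [|x s [eta e0 H]]; first by exists 1.
have [fx|fx] := eqVneq (f x) 0.
  by exists eta => // y; rewrite inE => /orP[/eqP ->|/H //]; rewrite fx eqxx.
exists (Num.min eta `|f x|) => [|y]; first by rewrite lt_min e0 normr_gt0.
by rewrite inE ge_min => /orP[/eqP -> _|/H h /h ->//]; rewrite lexx orbT.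
Qed.

Lemma isolated_value alpha (s : R) : exists2 eta : R, 0 < eta &
  forall m, `|ldist alpha m ^+ k - s| < eta -> ldist alpha m ^+ k = s.
Proof.
have [eta e0 H] := seq_gap (fun m => ldist alpha m ^+ k - s)
  (fset_set (nball alpha (1 + `|s + 1|))).
exists (Num.min 1 eta) => [|m]; first by rewrite lt_min ltr01.
rewrite lt_min => /andP[h1 h2]; apply/eqP; rewrite -subr_eq0; apply/negPn/negP => h.
have : eta <= `|ldist alpha m ^+ k - s|; last by rewrite leNgt h2.
apply: H => //; rewrite in_fset_set; last exact: finite_nball.
apply/mem_set; rewrite /nball /=.
have [l1|l1] := leP (ldist alpha m) 1; first by rewrite (le_trans l1) // lerDl.
apply: (@le_trans _ _ (ldist alpha m ^+ k)).
  by rewrite -[leLHS]expr1; apply: ler_weXn2l => //; exact: ltW.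
by have := ler_norm (s + 1); move: h1; rewrite ltr_norml => /andP[_]; lra.
Qed.

(* As the window moves up, a pair can only be lost together with a point of [L', L''[. *)
Lemma count_drop alpha (a s L' L'' : R) : 0 < a -> injective (ldist alpha) ->
  0 <= L' -> L' <= s -> s <= L'' -> finite_set [set n | `|ldist alpha n ^+ k - s| <= a] ->
  (forall m, L' <= ldist alpha m ^+ k < L'' -> ldist alpha m ^+ k = s) ->
  (cnt (lpairs alpha (- a) a L') <=
   cnt (lpairs alpha (- a) a L'') + 2 * cnt [set n | (`|ldist alpha n ^+ k - s| <= a)%R])%N.
Proof.
move=> a0 inj L0 Ls sL finJ H; set J := [set n | _].
have injk m n : ldist alpha m ^+ k = s -> ldist alpha n ^+ k = s -> m = n.
  move=> hm hn; apply: inj; apply/eqP.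
  by rewrite -(@eqrXn2 _ k) ?ldist_ge0 // hm hn.
pose P1 := [set p : 'rV[int]_k * 'rV[int]_k | ldist alpha p.1 ^+ k = s /\ J p.2].
pose P2 := [set p : 'rV[int]_k * 'rV[int]_k | ldist alpha p.2 ^+ k = s /\ J p.1].
have i1 p q : P1 p -> P1 q -> p.2 = q.2 -> p = q.
  case: p q => [m n] [m' n'] [/= hm _] [/= hm' _] ->; congr (_, _); exact: injk.
have i2 p q : P2 p -> P2 q -> p.1 = q.1 -> p = q.
  case: p q => [m n] [m' n'] [/= hm _] [/= hm' _] ->; congr (_, _); exact: injk.
have f1 : finite_set P1 by apply: (finite_inj finJ _ i1) => p [].
have f2 : finite_set P2 by apply: (finite_inj finJ _ i2) => p [].
have c1 : (cnt P1 <= cnt J)%N by apply: (cnt_inj finJ _ i1) => p [].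
have c2 : (cnt P2 <= cnt J)%N by apply: (cnt_inj finJ _ i2) => p [].
have f3 := (cnt_close_pairs k0 alpha (- a) a L'').1.
have fU : finite_set (P1 `|` P2) by rewrite finite_setU.
have fV : finite_set (lpairs alpha (- a) a L'' `|` (P1 `|` P2)) by rewrite finite_setU.
apply: (@leq_trans (cnt (lpairs alpha (- a) a L'' `|` (P1 `|` P2)))).
  apply: cnt_sub => // -[m n] [/= mn]; rewrite !in_itv /= => /andP[m1 m2] /andP[n1 n2] /andP[d1 d2].
  have [mL|mL] := ltP (ldist alpha m ^+ k) L''.
    have e : ldist alpha m ^+ k = s by apply: H; rewrite m1.
    right; left; split => //; rewrite /J /= ler_norml -e; apply/andP; split; lra.
  have [nL|nL] := ltP (ldist alpha n ^+ k) L''.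
    have e : ldist alpha n ^+ k = s by apply: H; rewrite n1.
    right; right; split => //; rewrite /J /= ler_norml -e; apply/andP; split; lra.
  left; split => //=; rewrite in_itv /=; apply/andP; split => //; lra.
apply: leq_trans (cntU f3 fU) _; rewrite leq_add2l mul2n -addnn.
by apply: leq_trans (cntU f1 f2) _; exact: leq_add.
Qed.

(** The point [s] is the supremum of the places in $[L_1,L_2]$ where [g] is at least [c]. Since [g]
    jumps, nothing is known at [s] itself, and one point is taken on each side. *)
Lemma last_crossing (g : R -> R) (c L1 L2 : R) : L1 <= L2 -> c <= g L1 -> g L2 < c ->
  exists2 s, L1 <= s & forall et, 0 < et -> exists L' L'',
    [/\ s - et < L' <= s, s <= L'' <= s + et, L1 <= L', c <= g L' & g L'' < c].
Proof.
move=> L12 gL1 gL2; pose S := [set L : R | L1 <= L <= L2 /\ c <= g L].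
have SL1 : S L1 by split; rewrite ?lexx.
have hS : has_sup S by split; [exists L1|exists L2 => L [/andP[]]].
have L1s : L1 <= sup S by exact: (ub_le_sup hS.2 SL1).
have sL2 : sup S <= L2 by apply: ge_sup; [exists L1|move=> L [/andP[]]].
exists (sup S) => // et et0; have [L' SL' L's] := sup_adherent et0 hS.
have L's' : L' <= sup S by exact: (ub_le_sup hS.2 SL').
have [[/andP[L1L' _] cg] e2] := (SL', divr_gt0 et0 (ltr0n R 2)).
(* The cap keeps the point in the interval; when it is attained, [g L2 < c] applies directly. *)
pose L'' := Num.min L2 (sup S + et / 2).
have sL'' : sup S <= L'' by rewrite le_min sL2 lerDl ltW.
exists L', L''; split => //; first by rewrite L's.
  by rewrite sL'' ge_min lerD2l; apply/orP; right; lra.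
rewrite ltNge; apply/negP => h; have SL'' : S L''.
  by split => //; rewrite (le_trans L1s sL'') ge_min lexx.
have := ub_le_sup hS.2 SL''; rewrite ge_min => /orP[L2s|]; last by lra.
by move: h; rewrite /L'' min_l ?leNgt ?gL2 // -leNgt; lra.
Qed.

(** Half of the error pays for lost pairs, [2 j <= eps b s / 2], and half for the change of
    normalisation, [c b (L'' - L') <= eps b / 2]. *)
Lemma crossing_arith (b c eps et s L' L'' n1 n2 j : R) : 0 < b -> 0 < c -> 0 < eps -> 0 < et ->
  1 <= s -> s - et < L' -> s <= L'' -> L'' <= s + et -> c * et <= eps / 4 ->
  n1 <= n2 + 2 * j -> j <= eps * b / 4 * s -> c * (b * L') <= n1 -> n2 < c * (b * L'') ->
  `|n2 / (b * L'') - c| <= eps.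
Proof.
move=> b0 c0 e0 et0 s1 L's sL'' L''e ce h hj h1 h2.
have L''0 : 0 < L'' by exact: lt_le_trans (lt_le_trans ltr01 s1) sL''.
have bL : 0 < b * L'' by rewrite mulr_gt0.
rewrite ler_norml; apply/andP; split; last first.
  rewrite lerBlDr ler_pdivrMr // mulrDl; apply: ltW; apply: lt_le_trans h2 _.
  by rewrite lerDr mulr_ge0 // ltW.
rewrite lerBrDr ler_pdivlMr //.
have b1 : b * (c * (L'' - L')) <= b * (2 * (eps / 4)).
  rewrite ler_pM2l //; apply: (@le_trans _ _ (c * (2 * et))); last by clear -ce; lra.
  by rewrite ler_pM2l //; clear -L's L''e et0; lra.
have b3 : b * eps * s <= b * eps * L'' by rewrite ler_pM2l ?mulr_gt0.
have b2 : b * eps * 1 <= b * eps * s by rewrite ler_pM2l ?mulr_gt0.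
move: b1 b2 b3 h hj h1; clear; lra.
Qed.

(** Take a high scale and a later low one. If the low one is not yet within [eps] of [c], look at
    the last crossing [s]: very close to it the window can lose only the one point with $r_m^k=s$,
    hence by [crowd_bound] a negligible number of pairs, and just after [s] the value lies slightly
    below [c]. *)
Lemma level_crossing alpha (a c : R) : 0 < a -> 0 < c -> injective (ldist alpha) ->
  (forall M eps : R, 0 < eps -> exists2 L, M <= L & R2 alpha (- a) a L <= c + eps) ->
  (forall M : R, exists2 L, M <= L & M <= R2 alpha (- a) a L) ->
  forall M eps : R, 0 < eps -> exists2 L, M <= L & `|R2 alpha (- a) a L - c| <= eps.
Proof.
move=> a0 c0 inj; move: (R2E k0 alpha (- a) a); move: (R2 alpha (- a) a) => g gE.
move=> lowR highR M eps e0; have [B0 _] := lattice_count_ball R k.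
have e1 : 0 < eps * B / 4 by rewrite divr_gt0 ?mulr_gt0.
have [s0 Hs0] := crowd_bound alpha a0 e1.
pose M1 := Num.max (Num.max M 1) (Num.max s0 c).
have [MM1 M11 M1s M1c] : [/\ M <= M1, 1 <= M1, s0 <= M1 & c <= M1].
  by rewrite !le_max !lexx !orbT.
have [L1 L1M gL1] := highR M1; have [L2 L2M gL2] := lowR L1 eps e0.
have [cg|gc] := leP c (g L2).
  exists L2; first by rewrite (le_trans MM1) // (le_trans L1M).
  by rewrite ler_norml; apply/andP; split; clear -cg gL2 e0; lra.
have [s L1s Hs] := last_crossing L2M (le_trans M1c gL1) gc.
have [eta et0 Heta] := isolated_value alpha s.
pose et := Num.min eta (eps / (4 * c)).
have et1 : 0 < et by rewrite lt_min et0 divr_gt0 ?mulr_gt0.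
have [L' [L'' [/andP[L's L's'] /andP[sL'' L''e] L'L1 cg' gL'']]] := Hs et et1.
have sM : M1 <= s by exact: le_trans L1s.
exists L''; first by rewrite (le_trans MM1) // (le_trans sM).
have [fJ cJ] := Hs0 s (le_trans M1s sM).
have L'0 : 0 < L' by move: L'L1 L1M M11; clear; lra.
have [ete etc] : et <= eta /\ et <= eps / (4 * c) by rewrite !ge_min !lexx orbT.
have := count_drop a0 inj (ltW L'0) L's' sL'' fJ.
have Hw m : L' <= ldist alpha m ^+ k < L'' -> ldist alpha m ^+ k = s.
  move=> /andP[h1 h2]; apply: Heta; rewrite ltr_norml.
  by clear -h1 h2 L's L''e ete; apply/andP; split; lra.
move=> /(_ Hw); rewrite -(ler_nat R) natrD natrM => hc.
move: cg' gL''; rewrite !gE ler_pdivlMr ?mulr_gt0 // => cg'.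
have L''0 : 0 < L'' by exact: lt_le_trans (lt_le_trans L'0 L's') sL''.
rewrite ltr_pdivrMr ?mulr_gt0 // => gL''.
have ec : c * et <= eps / 4.
  by move: etc; rewrite ler_pdivlMr ?mulr_gt0 //; clear; lra.
exact: (crossing_arith B0 c0 e0 et1 (le_trans M11 sM) L's sL'' L''e ec hc cJ cg' gL'').
Qed.

Lemma sequence_to_level (g : R -> R) (c : R) :
  (forall M eps : R, 0 < eps -> exists2 L, M <= L & `|g L - c| <= eps) ->
  exists L : nat -> R, [/\ {homo L : i j / (i < j)%N >-> i < j},
    L j @[j --> \oo] --> +oo & g (L j) @[j --> \oo] --> c].
Proof.
move=> H; have H' (n : nat) : exists L, n%:R <= L /\ `|g L - c| <= n.+1%:R^-1.
  have [|L h1 h2] := H n%:R n.+1%:R^-1; first by rewrite invr_gt0.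
  by exists L.
have [h Hh] := choice H'.
(* As [h n >= n], jumping beyond [h (N j)] makes the sequence strictly increasing. *)
pose N := fix N j := if j is j'.+1 then (Num.bound (h (N j')) + N j').+1 else 0%N.
have Nj j : (j <= N j)%N.
  by elim: j => // j IH /=; rewrite ltnS (leq_trans IH) // leq_addl.
have hN j : h (N j) < h (N j.+1).
  apply: lt_le_trans (Hh (N j.+1)).1; have h0 : 0 <= h (N j).
    by rewrite (le_trans _ (Hh (N j)).1).
  by rewrite (lt_trans (archi_boundP h0)) // ltr_nat /= ltnS leq_addr.
have Lj j : j%:R <= h (N j) by rewrite (le_trans _ (Hh (N j)).1) // ler_nat.
exists (fun j => h (N j)); split.
- exact: homo_ltn (fun _ _ _ => @lt_trans _ _ _ _ _) hN.
- apply/cvgryPge => A; near=> j; apply: le_trans (Lj j).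
  by near: j; exact: nbhs_infty_ger.
- apply/cvgrPdist_lt => e e0; near=> j.
  rewrite distrC (le_lt_trans (Hh (N j)).2) //.
  apply: (@le_lt_trans _ _ j.+1%:R^-1).
    by rewrite lef_pV2 ?posrE // ler_nat ltnS.
  near: j; exact: (near_infty_natSinv_lt (PosNum e0)) .
Unshelve. all: by end_near.
Qed.

End LevelCrossing.

(** * Coincidences at rational points, k > 2 *)

Section RationalHigh.
Variable R : realType.

Lemma cntX (T U : choiceType) (A : set T) (A' : set U) : finite_set A -> finite_set A' ->
  cnt (A `*` A') = (cnt A * cnt A')%N.
Proof.
move=> fA fA'; rewrite (@cnt_pairs _ _ (fset_set A)); last first.
- by move=> p [p1 _]; rewrite in_fset_set //; apply/mem_set.
- exact: finite_setX.
transitivity (\sum_(d <- fset_set A) cnt A')%N; last first.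
  by rewrite big_const_seq count_predT iter_addn_0 mulnC.
apply: eq_big_seq => d; rewrite in_fset_set // => /set_mem dA.
by congr cnt; apply/seteqP; split => x /=; [case|].
Qed.

(** Cauchy-Schwarz on the fibre sizes of [h]: their squares add up to the number of ordered pairs
    with equal values, diagonal included. *)
Lemma pair_energy (T : choiceType) (A : set T) (h : T -> nat) (V : nat) : finite_set A ->
  (forall x, A x -> (h x < V)%N) ->
  (cnt A)%:R ^+ 2 <= V%:R *
   ((cnt [set p : T * T | [/\ A p.1, A p.2, p.1 <> p.2 & h p.1 = h p.2]])%:R + (cnt A)%:R) :> R.
Proof.
move=> fA hV; set S := [set p | _].
pose E := [set p : T * T | [/\ A p.1, A p.2 & h p.1 = h p.2]].
have fAA : finite_set (A `*` A) by exact: finite_setX.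
have fE : finite_set E by apply: sub_finite_set fAA => p [].
have fS : finite_set S by apply: sub_finite_set fAA => p [].
pose D := [set p : T * T | A p.1 /\ p.1 = p.2].
have iD p p' : D p -> D p' -> p.1 = p'.1 -> p = p'.
  by case: p p' => [x y] [x' y'] [/= _ <-] [/= _ <-] ->.
have fD : finite_set D by apply: (finite_inj fA _ iD) => p [].
have cE : (cnt E <= cnt S + cnt A)%N.
  apply: (@leq_trans (cnt S + cnt D)); last by rewrite leq_add2l (cnt_inj fA _ iD) // => p [].
  apply: leq_trans (cntU fS fD); apply: cnt_sub; first by rewrite finite_setU.
  move=> p [p1 p2 hp]; have [e|/eqP e] := eqVneq p.1 p.2; first by right.
  by left; split.
apply: (@le_trans _ _ (V%:R * (cnt E)%:R)); last by rewrite ler_wpM2l // -natrD ler_nat.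
pose N j := cnt [set x | A x /\ h x = j].
have -> : cnt E = (\sum_(j < V) N j * N j)%N.
  rewrite (@cnt_fiber _ E (fun p => h p.1) V) //; last by move=> p [p1 _ _]; exact: hV.
  apply: eq_bigr => j _; set F := [set x | _]; set Aj := [set x | A x /\ h x = j].
  have fj : finite_set Aj by apply: sub_finite_set fA => x [].
  rewrite -[RHS](cntX fj fj); congr cnt; apply/seteqP; split => p /=.
    by move=> [[p1 p2 e] h1]; split; split; rewrite // -e.
  by move=> [[p1 h1] [p2 h2]]; split => //; split; rewrite // h1 h2.
rewrite (cnt_fiber fA hV) -!natrX.
have := @cauchy_schwarz R 'I_V (fun=> 1) (fun j => (N j)%:R).
under eq_bigr do rewrite mul1r; rewrite [\sum_(i < V) 1 ^+ 2](eq_bigr (fun=> 1)); last first.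
  by move=> i _; rewrite expr1n.
rewrite sumr_const card_ord -natr_sum natrX => h1; apply: le_trans h1 _.
rewrite ler_wpM2l // natr_sum; apply: ler_sum => j _.
by rewrite natrM.
Qed.

Variable n : nat.
Notation k := n.+3.
Notation B := (unit_ball_volume R k).

(** The integer [v m] is $(qr_m)^2$ and takes $O(\rho^2)$ values on about $\rho^k$ points, which
    gives $\rho^{2k-2}$ equal pairs. Because $k>2$, the points eventually outnumber twice the
    values, so the diagonal can be discarded. *)
Lemma rational_high (alpha : 'rV[R]_k) (q : nat) : (0 < q)%N ->
  (forall i, exists z : int, q%:R * alpha 0 i = z%:~R) ->
  exists2 c : R, 0 < c & exists rho0 : R, forall rho, rho0 <= rho ->
    c * rho ^+ k * rho ^+ n.+1 <= (cnt (strict_pairs alpha (rho ^+ k)))%:R.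
Proof.
move=> q0 /choice[p hp]; have [B0 [C C0 HC]] := lattice_count_ball R k.
have qr : 0 < q%:R :> R by rewrite ltr0n.
pose v (m : 'rV[int]_k) : int := \sum_i (q%:Z * m 0 i - p i) ^+ 2.
have v0 m : 0 <= v m by apply: sumr_ge0 => i _; exact: sqr_ge0.
have vE m : (v m)%:~R = (q%:R * ldist alpha m) ^+ 2.
  rewrite exprMn ldist_sqr mulr_sumr rmorph_sum; apply: eq_bigr => i _ /=.
  by rewrite rmorphXn rmorphB rmorphM /= -hp -mulrBr exprMn.
(* Only $r^k\le\frac32X$ is counted, to stay strictly below the end [2 X] of the window. *)
have [y y0 yk] := @root_exists R k isT (3 / 2) ltac:(lra).
have y1 : 1 <= y by apply: (@ge_of_exp_ge R k isT) => //; rewrite yk expr1n; lra.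
have C2 : 0 <= 2 * C by rewrite mulr_ge0 // ltW.
have B4 : 0 < B / 4 by rewrite divr_gt0.
have [r0 r01 Hr] := small_power C2 (@ler01 R) y0 B4 (isT : (0 < k)%N).
exists (B ^+ 2 / (160 * q%:R ^+ 2)); first by rewrite divr_gt0 ?mulr_gt0 ?exprn_gt0.
exists (Num.max r0 (40 * q%:R ^+ 2 / B)) => rho; rewrite ge_max => /andP[hr0 hrB].
have r1 : 1 <= rho by apply: le_trans hr0.
have rp : 0 < rho by apply: lt_le_trans r1.
set X := rho ^+ k; have X0 : 0 < X by rewrite exprn_gt0.
pose A := [set m | X < ldist alpha m ^+ k < 2 * X].
have rk : (y * rho) ^+ k = 3 / 2 * X by rewrite exprMn yk.
have fA : finite_set A.
  apply: sub_finite_set (finite_nball alpha (2 * rho)) => m /andP[_ h].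
  apply: (@ge_of_exp_ge R k isT); rewrite ?ldist_ge0 ?mulr_ge0 // 1?ltW //.
  apply: (lt_le_trans h); rewrite exprMn ler_wpM2r // ?(ltW X0) //.
  by rewrite -[leLHS]expr1; apply: ler_weXn2l; rewrite ?ler1n.
have NB : B / 4 * X <= (cnt A)%:R.
  apply: (@le_trans _ _ (cnt (annulus alpha rho (y * rho)))%:R); last first.
    rewrite ler_nat; apply: cnt_sub => // m /andP[h1 h2]; apply/andP; split.
      by rewrite ltrXn2r // ?ldist_ge0 // ltW.
    apply: (@le_lt_trans _ _ ((y * rho) ^+ k)); first by rewrite lerXn2r ?nnegrE ?ldist_ge0 ?mulr_ge0 // ltW.
    by rewrite rk ltr_pM2r //; lra.
  have := annulus_count C0 HC alpha (ltW rp) (ler_peMl (ltW rp) y1).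
  have := Hr rho hr0; rewrite rk -/X ler_norml => h /andP[h' _].
  by move: h h'; clear; lra.
pose V := (Num.trunc (4 * q%:R ^+ 2 * rho ^+ 2)).+1.
have V0 : 0 <= 4 * q%:R ^+ 2 * rho ^+ 2 by rewrite !mulr_ge0 // ?exprn_ge0 // ltW.
have VE : V%:R <= 5 * q%:R ^+ 2 * rho ^+ 2 :> R.
  have /andP[h _] := truncn_itv V0.
  have : 1 <= q%:R ^+ 2 * rho ^+ 2 by apply: mulr_ege1; apply: exprn_ege1 => //; rewrite ler1n.
  by rewrite /V -natr1; move: h; clear; lra.
have hV m : A m -> (`|v m|%N < V)%N.
  move=> /andP[_ h]; rewrite -(ltr_nat R).
  have -> : (`|v m|%N)%:R = (q%:R * ldist alpha m) ^+ 2 by rewrite -vE -[in RHS](gez0_abs (v0 m)).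
  have lr : ldist alpha m <= 2 * rho.
    apply: (@ge_of_exp_ge R k isT); rewrite ?ldist_ge0 ?mulr_ge0 // 1?ltW //.
    apply: (lt_le_trans h); rewrite exprMn ler_wpM2r // ?(ltW X0) //.
    by rewrite -[leLHS]expr1; apply: ler_weXn2l; rewrite ?ler1n.
  apply: (@le_lt_trans _ _ (4 * q%:R ^+ 2 * rho ^+ 2)); last by have /andP[] := truncn_itv V0.
  have -> : 4 * q%:R ^+ 2 * rho ^+ 2 = (q%:R * (2 * rho)) ^+ 2 by ring.
  by rewrite lerXn2r ?nnegrE ?mulr_ge0 ?ldist_ge0 // ?ler_pM2l // ltW.
have := pair_energy fA hV; set S := [set _ | _].
have fS : finite_set (strict_pairs alpha X) by exact: finite_strict_pairs.
have SS : (cnt S <= cnt (strict_pairs alpha X))%N.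
  apply: cnt_sub => // -[m m'] [/= h1 h2 mm e]; split => //=.
  apply: (@pexpIrn R 2); rewrite ?nnegrE ?ldist_ge0 //.
  have := congr1 (fun j : nat => j%:R : R) e; rewrite !natr_absz !ger0_norm // !vE !exprMn.
  by apply: mulfI; rewrite expf_neq0 // gt_eqF.
move: SS; rewrite -(ler_nat R); set s := (cnt S)%:R; set N := (cnt A)%:R; set t := (cnt _)%:R.
move=> st hN; have N0 : 0 < N by apply: lt_le_trans NB; rewrite mulr_gt0.
suff : B ^+ 2 / (160 * q%:R ^+ 2) * X * rho ^+ n.+1 <= s by move=> h; exact: le_trans st.
have Q0 : 0 < q%:R ^+ 2 :> R by rewrite exprn_gt0.
have N2V : 2 * V%:R <= N.
  apply: (@le_trans _ _ (2 * (5 * q%:R ^+ 2 * rho ^+ 2))); first by rewrite ler_pM2l.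
  apply: le_trans NB; move: hrB; rewrite ler_pdivrMr // => hrB.
  apply: (@le_trans _ _ (B / 4 * (rho * rho ^+ 2))).
    rewrite [leLHS]mulrA [leRHS]mulrA ler_pM2r ?exprn_gt0 //; move: hrB; clear; lra.
  rewrite ler_pM2l // -exprS; apply: ler_weXn2l => //.
have sV : N ^+ 2 / 2 <= V%:R * s.
  have : V%:R * N <= N ^+ 2 / 2 by rewrite expr2 mulrAC ler_pM2r //; move: N2V; clear; lra.
  by move: hN; clear; lra.
have s0 : 0 <= s by [].
have h1 : N ^+ 2 / 2 <= 5 * q%:R ^+ 2 * rho ^+ 2 * s by apply: (le_trans sV); rewrite ler_wpM2r.
have h2 : (B / 4 * X) ^+ 2 <= N ^+ 2 by rewrite lerXn2r ?nnegrE // ltW // mulr_gt0.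
have Xr : X = rho ^+ 2 * rho ^+ n.+1 by rewrite -exprD.
have P0 : 0 < 5 * q%:R ^+ 2 * rho ^+ 2 by rewrite !mulr_gt0 // exprn_gt0.
rewrite -(ler_pM2l P0); apply: le_trans h1.
apply: (@le_trans _ _ ((B / 4 * X) ^+ 2 / 2)); last by rewrite ler_pM2r.
rewrite Xr; move: (rho ^+ n.+1) => r; clear -Q0.
have -> // : 5 * q%:R ^+ 2 * rho ^+ 2 * (B ^+ 2 / (160 * q%:R ^+ 2) * (rho ^+ 2 * r) * r) =
  (B / 4 * (rho ^+ 2 * r)) ^+ 2 / 2.
by field; move: Q0; rewrite exprn_even_gt0 //.
Qed.

End RationalHigh.

(** * Coincidences at rational points, k = 2 *)

Section CoprimeCount.
Variable R : realType.

Lemma nat_itvE (a b : nat) : finite_set [set i | (a <= i < b)%N] /\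
  cnt [set i | (a <= i < b)%N] = (b - a)%N.
Proof.
have inj i j : (a <= i < b)%N -> (a <= j < b)%N -> (i - a = j - a)%N -> i = j by lia.
have fin : finite_set [set i | (a <= i < b)%N].
  by apply: (finite_inj (finite_II (b - a)) _ inj) => i /=; lia.
split=> //; apply/eqP; rewrite eqn_leq -{2}(cnt_II (b - a)) -[X in (_ <= X)%N](cnt_II (b - a)).
apply/andP; split; first by apply: (cnt_inj (finite_II _) _ inj) => i /=; lia.
by apply: (@cnt_inj _ _ (addn a)) => // [i|i j _ _] /=; lia.
Qed.

Lemma residue_count (q : nat) (p : int) (T g : nat) : (0 < g)%N -> coprime g q ->
  (cnt [set i | (T <= i < T + T)%N /\ (g %| (q%:Z * i%:Z + p)%R)%Z] <= (T %/ g).+1)%N.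
Proof.
move=> g0 cgq.
rewrite -[X in (_ <= X)%N](cnt_II (T %/ g).+1).
apply: (@cnt_inj _ _ (fun i => (i - T) %/ g)%N).
- exact: finite_II.
- move=> i [/andP[h1 h2] _] /=; rewrite ltnS leq_div2r //; lia.
suff H i j : (i <= j)%N -> (T <= i)%N -> (g %| (q%:Z * i%:Z + p)%R)%Z -> (g %| (q%:Z * j%:Z + p)%R)%Z ->
    ((i - T) %/ g = (j - T) %/ g)%N -> i = j.
  move=> i j [/andP[hi _] di] [/andP[hj _] dj] e.
  by case/orP: (leq_total i j) => ij; [exact: H|apply/esym; exact: H].
move=> ij Ti di dj; have : (g %| (q%:Z * (j%:Z - i%:Z))%R)%Z.
  have -> : q%:Z * (j%:Z - i%:Z) = (q%:Z * j%:Z + p) - (q%:Z * i%:Z + p) by ring.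
  exact: rpredB.
rewrite Gauss_dvdzr; last by rewrite /coprimez /gcdz /= eqz_nat.
rewrite subzn // => /dvdnP[t] ; rewrite absz_nat => e.
have -> : (j - T = t * g + (i - T))%N by lia.
rewrite divnMDl //; lia.
Qed.

Lemma sum_inv_consecutive (J : nat) :
  \sum_(j < J) (j.+1%:R * j.+2%:R)^-1 = 1 - J.+1%:R^-1 :> R.
Proof.
elim: J => [|J IH]; first by rewrite big_ord0 invr1 subrr.
rewrite big_ord_recr /= IH -[J.+2%:R]natr1.
have : J.+1%:R + 1 != 0 :> R by rewrite natr1 pnatr_eq0.
have : J.+1%:R != 0 :> R by rewrite pnatr_eq0.
by move: J.+1%:R => x x0 x1; field; rewrite x0 x1.
Qed.

Definition grid (T : nat) : set (nat * nat) := [set i | (T <= i < T + T)%N] `*` [set i | (T <= i < T + T)%N].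

(** Union bound over the common divisor [g]. As [q] is even and [p2] odd, [g] is odd, coprime to [q]
    and at least 3, and it occurs at most $(T/g+1)^2\le2T^2/g^2+2$ times. With $g=2j+3$,
    $4/g^2\le1/((j+1)(j+2))$ telescopes to a total of at most $T^2/2$; the terms 2 cost at most
    $T^2/4$ since $16q\le T$. If even [g] were allowed, the same bound would exceed $T^2$. *)
Lemma coprime_count (e : nat) (p1 p2 : int) (T : nat) : (0 < e)%N -> odd `|p2| ->
  (16 * 2 ^ e <= T)%N -> (`|p1| + `|p2| < T)%N ->
  T%:R ^+ 2 / 4 <= (cnt [set d | grid T d /\
    coprime `|((2 ^ e)%N%:Z * d.1%:Z + p2)%R| `|((2 ^ e)%N%:Z * d.2%:Z + p1)%R|])%:R :> R.
Proof.
move=> e0 op Te Tp; set q := (2 ^ e)%N.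
have q1 : (0 < q)%N by rewrite expn_gt0.
pose y (d : nat * nat) := `|(q%:Z * d.1%:Z + p2)%R|%N.
pose z (d : nat * nat) := `|(q%:Z * d.2%:Z + p1)%R|%N.
set S := [set d | _]; pose N := [set d | grid T d /\ ~~ coprime (y d) (z d)].
have [fI cI] := nat_itvE T (T + T).
have fG : finite_set (grid T) by exact: finite_setX.
have cG : cnt (grid T) = (T * T)%N by rewrite cntX // cI addnK.
have fS : finite_set S by apply: sub_finite_set fG => d [].
have fN : finite_set N by apply: sub_finite_set fG => d [].
have cSN : (T * T <= cnt S + cnt N)%N.
  rewrite -cG; apply: leq_trans (cntU fS fN); apply: cnt_sub; first by rewrite finite_setU.
  by move=> d Gd; have [h|h] := boolP (coprime (y d) (z d)); [left|right].
have oy d : odd (y d).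
  have qe : exists t, q = t.*2 by exists (2 ^ e.-1)%N; rewrite -mul2n -expnS prednK.
  by case: qe => t qE; rewrite /y qE; move: op; lia.
have yT d : grid T d -> (0 < y d < 4 * (q * T))%N.
  move=> [/andP[h1 h2] _]; rewrite /y; move: (d.1) h1 h2 => i h1 h2.
  have b1 : (q * T <= q * i)%N by rewrite leq_mul2l h1 orbT.
  have b2 : (q * i <= q * (T + T))%N by rewrite leq_mul2l (ltnW h2) orbT.
  have b3 : (T <= q * T)%N by rewrite leq_pmull.
  by move: b1 b2 b3 Tp; rewrite mulnDr -PoszM; lia.
pose h d := ((gcdn (y d) (z d)) - 3)./2.
have hE d : N d -> gcdn (y d) (z d) = (h d).*2.+3 /\ (h d < 2 * (q * T))%N.
  move=> [Gd nc]; have /andP[y0 y4] := yT d Gd.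
  have : (gcdn (y d) (z d) <= y d)%N by rewrite dvdn_leq // dvdn_gcdl.
  have : odd (gcdn (y d) (z d)) by apply: dvdn_odd (dvdn_gcdl _ _) (oy d).
  by move: nc; rewrite /coprime /h; move: (gcdn _ _) => g; lia.
have cN : (cnt N)%:R <= \sum_(j < 2 * (q * T)) (T%:R ^+ 2 / 2 * (j.+1%:R * j.+2%:R)^-1 + 2) :> R.
  rewrite (@cnt_fiber _ N h (2 * (q * T)) fN); last by move=> d /hE[].
  rewrite natr_sum; apply: ler_sum => j _; set g := j.*2.+3.
  have cgq : coprime g q by rewrite coprimeXr // coprimen2 /g /= odd_double.
  have fA p : finite_set [set i | (T <= i < T + T)%N /\ (g %| (q%:Z * i%:Z + p)%R)%Z].
    by apply: sub_finite_set fI => i [].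
  apply: (@le_trans _ _ ((T %/ g).+1 * (T %/ g).+1)%:R).
    rewrite ler_nat; apply: (@leq_trans (cnt (
       [set i | (T <= i < T + T)%N /\ (g %| (q%:Z * i%:Z + p2)%R)%Z] `*`
       [set i | (T <= i < T + T)%N /\ (g %| (q%:Z * i%:Z + p1)%R)%Z]))); last first.
      by rewrite cntX // leq_mul // residue_count.
    apply: cnt_sub; first exact: finite_setX.
    move=> d [Nd hd]; have [ge _] := hE d Nd; have [[d1 d2] _] := Nd.
    have gE : g = gcdn (y d) (z d) by rewrite ge hd.
    by split; (split; first by []); rewrite dvdzE absz_nat gE; [exact: dvdn_gcdl|exact: dvdn_gcdr].
  have tg : (T %/ g)%:R <= T%:R / g%:R :> R.
    by rewrite ler_pdivlMr ?ltr0n // -natrM ler_nat leq_trunc_div.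
  rewrite natrM -expr2 -natr1; set t := (T %/ g)%:R in tg *.
  have t0 : 0 <= t by [].
  apply: (@le_trans _ _ (2 * (T%:R / g%:R) ^+ 2 + 2)).
    have : t ^+ 2 <= (T%:R / g%:R) ^+ 2 by rewrite lerXn2r ?nnegrE // (le_trans t0).
    have := sqr_ge0 (t - 1); move: (T%:R / g%:R) => u; rewrite !expr2; clear; nra.
  rewrite lerD2r exprMn mulrCA -mulrA ler_wpM2l ?exprn_ge0 //.
  have jj : 0 < j.+1%:R * j.+2%:R :> R by rewrite mulr_gt0.
  rewrite exprVn -invfM ler_pdivrMr ?exprn_gt0 ?ltr0n // ler_pdivlMl ?mulr_gt0 //.
  rewrite -natrX -!natrM ler_nat.
  by rewrite /g; nia.
move: cN; rewrite big_split /= -mulr_sumr sum_inv_consecutive sumr_const card_ord.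
have T0 : 0 < T%:R :> R by rewrite ltr0n; lia.
have i0 : 0 < (2 * (q * T)).+1%:R^-1 :> R by rewrite invr_gt0.
have b1 : T%:R ^+ 2 / 2 * (1 - (2 * (q * T)).+1%:R^-1) <= T%:R ^+ 2 / 2 :> R.
  by rewrite ger_pMr ?divr_gt0 ?exprn_gt0 //; move: i0; clear; lra.
have b2 : 2 *+ (2 * (q * T)) <= T%:R ^+ 2 / 4 :> R.
  rewrite -mulr_natr -natrM ler_pdivlMr // -natrM -natrX ler_nat.
  have -> : (2 * (2 * (q * T)) * 4 = 16 * q * T)%N by ring.
  by rewrite expnS expn1 leq_mul2r Te orbT.
have b3 : T%:R ^+ 2 <= (cnt S)%:R + (cnt N)%:R :> R by rewrite -natrD expr2 -natrM ler_nat.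
move: b1 b2 b3; clear; move: (_ *+ _) (_ / 2 * (1 - _)) => u v; lra.
Qed.

End CoprimeCount.

Lemma nat_between (R : realType) (u v theta : R) : 0 <= theta -> theta <= u ->
  finite_set [set t : nat | u < t%:R + theta < v] /\
  v - u - 2 <= (cnt [set t : nat | u < t%:R + theta < v])%:R.
Proof.
move=> th0 thu; have fin : finite_set [set t : nat | u < t%:R + theta < v].
  apply: sub_finite_set (finite_II (Num.bound v)) => t /= /andP[_ h].
  have t0 : 0 <= t%:R :> R by [].
  rewrite -(ltr_nat R); apply: (@lt_trans _ _ v); first lra.
  apply: archi_boundP; lra.
split => //; have [h|h] := leP (v - u - 2) 0; first exact: le_trans h _.
have v0 : 0 <= v - u - 1 by lra.
have ut0 : 0 <= u - theta by lra.
have /andP[n1 n2] := truncn_itv v0; have /andP[a1 a2] := truncn_itv ut0.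
set n := Num.trunc _ in n1 n2; set a := Num.trunc _ in a1 a2.
apply: (@le_trans _ _ n%:R); first by move: n2; rewrite -natr1; lra.
rewrite ler_nat -[X in (X <= _)%N](cnt_II n).
apply: (@cnt_inj _ _ (addn a.+1)) => // [i|i j _ _]; last by move/addnI.
rewrite /= natrD -(ler_nat R) -!natr1 => hi; move: a2; rewrite -natr1 => a2.
have i0 : 0 <= i%:R :> R by [].
by apply/andP; split; clear -a1 a2 n1 hi i0; lra.
Qed.

Lemma scale_margin (R : realType) (s : R) : 16 <= s -> 1 <= 3 / 4 * s /\ s / 8 <= s - 3 / 4 * s - 2.
Proof. by move=> s16; split; lra. Qed.

Lemma half_log_arith (R : realType) (a b c d f : R) :
  a - b <= d * c -> 2 * (b + f * c) <= a -> a / 2 <= (d - f) * c.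
Proof. lra. Qed.

(** * Products of Gaussian integers *)

Section PlaneQuadruples.
Variables (R : realType) (e : nat) (p1 p2 : int) (alpha : 'rV[R]_2).
Notation q := (2 ^ e)%N.
Hypothesis e0 : (0 < e)%N.
Hypothesis op2 : odd `|p2|.
Hypothesis alpha0 : alpha 0 0 = - (p1%:~R / q%:R).
Hypothesis alpha1 : alpha 0 1 = - (p2%:~R / q%:R).

Let qr : 0 < q%:R :> R. Proof. by rewrite ltr0n expn_gt0. Qed.

Definition ycoord (i : int) : int := q%:Z * i + p2.
Definition zcoord (j : int) : int := q%:Z * j + p1.

(** Subtracting [alpha] turns [j] into $z/q$ and [i] into $y/q$, so the coordinates become the real
    and imaginary parts of $(z+iy)(w+1/q-ix)$. Changing the sign of [x] keeps the norm: this
    produces the coincidences. *)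
Definition quad_pt (x w i j : int) : 'rV[int]_2 :=
  \row_c (if c == 0 then x * ycoord i + j + zcoord j * w
          else i + ycoord i * w - x * zcoord j).

(* |z + iy|^2 |w + ix|^2 = |(z + iy)(w + ix)|^2 with [w + 1 / q] in place of [w] *)
Lemma ldist_quad_pt (x w i j : int) : ldist alpha (quad_pt x w i j) ^+ 2 =
  (x%:~R ^+ 2 + (w%:~R + q%:R^-1) ^+ 2) * (ycoord i ^+ 2 + zcoord j ^+ 2)%:~R.
Proof.
rewrite ldist_sqr !big_ord_recl big_ord0 addr0 !mxE /=.
have -> : lift ord0 ord0 = 1 :> 'I_2 by exact: val_inj.
rewrite alpha0 alpha1 /ycoord /zcoord !(rmorphD, rmorphN, rmorphM, rmorphXn) /=.
move: qr; rewrite -[Posz q]/(q%:Z) -[(Posz q)%:~R]/(q%:R : R); move: (q%:R : R) => Q Q0.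
by field; rewrite gt_eqF.
Qed.

(** The two points determine $xy$ and $xz$ through their differences; coprimality recovers $x$ as a
    greatest common divisor, then $y$, $z$, and finally $w$. *)
Lemma quad_pt_inj (x w i j x' w' i' j' : nat) : (0 < x)%N -> (0 < x')%N ->
  0 < ycoord i -> 0 < zcoord j -> 0 < ycoord i' -> 0 < zcoord j' ->
  coprime `|ycoord i| `|zcoord j| -> coprime `|ycoord i'| `|zcoord j'| ->
  quad_pt x w i j = quad_pt x' w' i' j' -> quad_pt (- x%:Z) w i j = quad_pt (- x'%:Z) w' i' j' ->
  [/\ x = x', w = w', i = i' & j = j'].
Proof.
move=> x0 x0' y0 z0 y0' z0' cop cop' /rowP h1 /rowP h2.
have := h1 0; have := h1 1; have := h2 0; have := h2 1; rewrite !mxE /= => e1 e2 e3 e4.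
have ey : x%:Z * ycoord i = x'%:Z * ycoord i' by lia.
have ez : x%:Z * zcoord j = x'%:Z * zcoord j' by lia.
have ex : x = x'.
  have := congr1 absz ey; have := congr1 absz ez; rewrite !abszM !absz_nat => ez' ey'.
  have : (x * gcdn `|ycoord i| `|zcoord j| = x' * gcdn `|ycoord i'| `|zcoord j'|)%N.
    by rewrite !muln_gcdr ey' ez'.
  by rewrite (eqP cop) (eqP cop') !muln1.
have x1 : x%:Z != 0 by rewrite eqz_nat -lt0n.
move: ey ez; rewrite -ex => /(mulfI x1) ey /(mulfI x1) ez.
have q0 : q%:Z != 0 by rewrite eqz_nat -lt0n expn_gt0.
have [ei] : i%:Z = i'%:Z by apply: (mulfI q0); move: ey; rewrite /ycoord => /addIr.
have [ej] : j%:Z = j'%:Z by apply: (mulfI q0); move: ez; rewrite /zcoord => /addIr.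
split => //; move: e4; rewrite -ex -ey -ez -ej => /addrI.
by move/(mulfI (lt0r_neq0 z0)) => -[].
Qed.

Definition quad_scale (X : R) (d : nat * nat) : R :=
  Num.sqrt (X / (ycoord d.1 ^+ 2 + zcoord d.2 ^+ 2)%:~R).

(** With both factors in $(\frac34s,s)$ the sum $x^2+(w+1/q)^2$ lies in $(\frac98s^2,2s^2)$, which
    places the product with $y^2+z^2$ strictly inside $(X,2X)$. *)
Definition quads (X : R) (T : nat) : set ((nat * nat) * (nat * nat)) := [set f |
  [/\ grid T f.1, coprime `|ycoord f.1.1| `|zcoord f.1.2|,
     3 / 4 * quad_scale X f.1 < f.2.1%:R < quad_scale X f.1
   & 3 / 4 * quad_scale X f.1 < f.2.2%:R + q%:R^-1 < quad_scale X f.1]].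

Lemma grid_coords T d : (`|p1| + `|p2| < T)%N -> grid T d ->
  0 < ycoord d.1 <= (3 * q * T)%N%:Z /\ 0 < zcoord d.2 <= (3 * q * T)%N%:Z.
Proof.
move=> Tp [/andP[h1 h2] /andP[h3 h4]]; have q1 : (0 < q)%N by rewrite expn_gt0.
have b0 : (T <= q * T)%N by rewrite leq_pmull.
have b1 : (q * T <= q * d.1)%N by rewrite leq_mul2l h1 orbT.
have b2 : (q * d.1 <= q * (T + T))%N by rewrite leq_mul2l (ltnW h2) orbT.
have b3 : (q * T <= q * d.2)%N by rewrite leq_mul2l h3 orbT.
have b4 : (q * d.2 <= q * (T + T))%N by rewrite leq_mul2l (ltnW h4) orbT.
rewrite /ycoord /zcoord -!PoszM -mulnA; move: b0 b1 b2 b3 b4 Tp; rewrite mulnDr.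
move: (q * d.1)%N (q * d.2)%N (q * T)%N => u v t; clear; lia.
Qed.

Lemma quads_strict (X : R) T f : 0 < X -> (`|p1| + `|p2| < T)%N -> quads X T f ->
  strict_pairs alpha X (quad_pt f.2.1 f.2.2 f.1.1 f.1.2, quad_pt (- f.2.1%:Z) f.2.2 f.1.1 f.1.2).
Proof.
case: f => -[i j] [x w] X0 Tp [/= G cop]; set s := quad_scale X (i, j) => /andP[x1 x2] /andP[w1 w2].
have [/andP[/= y0 _] /andP[z0 _]] := grid_coords Tp G.
set Y : R := (ycoord i ^+ 2 + zcoord j ^+ 2)%:~R.
have Y0 : 0 < Y by rewrite ltr0z addr_gt0 // exprn_gt0.
have s0 : 0 < s by rewrite sqrtr_gt0 divr_gt0.
have sY : s ^+ 2 * Y = X by rewrite sqr_sqrtr ?divfK ?gt_eqF // divr_ge0 // ltW.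
have E (x' : int) : x' ^+ 2 = x%:Z ^+ 2 ->
    ldist alpha (quad_pt x' w i j) ^+ 2 = (x%:R ^+ 2 + (w%:R + q%:R^-1) ^+ 2) * Y.
  by move=> h; rewrite ldist_quad_pt -rmorphXn h rmorphXn.
have hx : 9 / 16 * s ^+ 2 < x%:R ^+ 2 < s ^+ 2.
  by clear -x1 x2 s0; move: (x%:R : R) x1 x2 => t x1 x2; apply/andP; split; nra.
have hw : 9 / 16 * s ^+ 2 < (w%:R + q%:R^-1) ^+ 2 < s ^+ 2.
  by clear -w1 w2 s0; move: (w%:R + q%:R^-1) w1 w2 => t w1 w2; apply/andP; split; nra.
split => /=.
- move/rowP/(_ 0); rewrite !mxE /= => h.
  have : x%:Z * ycoord i = 0 by move: h; clear; lia.
  move/eqP; rewrite mulf_eq0 (gt_eqF y0) orbF eqz_nat => /eqP x00.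
  by move: x1; rewrite x00; clear -s0; lra.
- rewrite E // -sY mulrA !ltr_pM2r //; move: hx hw => /andP[a1 a2] /andP[a3 a4].
  have S0 : 0 < s ^+ 2 by rewrite exprn_gt0.
  by apply/andP; split; clear -a1 a2 a3 a4 S0; lra.
- by apply: (@pexpIrn R 2); rewrite ?nnegrE ?ldist_ge0 // !E // sqrrN.
Qed.

(** There are at least $T^2/4$ pairs $(i,j)$, each with at least $(s/8)^2$ choices of $(x,w)$, where
    $s^2\ge X/(18q^2T^2)$. The size $T$ cancels, so every dyadic scale contributes the same multiple
    of $X$. The constants are $18=2\cdot3^2$ and $16^2=4\cdot8^2$; the hypothesis on [X] says that
    $s\ge16$, which gives $s/4-2\ge s/8$. *)
Lemma quads_count (X : R) T : (16 * q <= T)%N -> (`|p1| + `|p2| < T)%N ->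
  18 * 16 ^+ 2 * q%:R ^+ 2 * T%:R ^+ 2 <= X -> finite_set (quads X T) ->
  X / (18 * 16 ^+ 2 * q%:R ^+ 2) <= (cnt (quads X T))%:R.
Proof.
move=> Tq Tp TX fQ; pose D := [set d | grid T d /\ coprime `|ycoord d.1| `|zcoord d.2|].
have T0 : 0 < T%:R :> R by rewrite ltr0n; lia.
have qT : 0 < q%:R ^+ 2 * T%:R ^+ 2 :> R by rewrite mulr_gt0 // exprn_gt0.
have X0 : 0 < X by apply: lt_le_trans TX; rewrite !mulr_gt0 ?exprn_gt0.
have fD : finite_set D.
  have fG : finite_set (grid T) by apply: finite_setX; exact: (nat_itvE _ _).1.
  by apply: sub_finite_set fG => d [].
have cD : T%:R ^+ 2 / 4 <= (cnt D)%:R :> R by exact: coprime_count.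
rewrite (@cnt_pairs _ _ (fset_set D) _ fQ); last first.
  by move=> f [h1 h2 _ _]; rewrite in_fset_set //; apply/mem_set.
have K0 : 0 < 18 * 8 ^+ 2 * (q%:R ^+ 2 * T%:R ^+ 2) :> R by rewrite !mulr_gt0 ?exprn_gt0.
apply: (@le_trans _ _ (\sum_(d <- fset_set D) X / (18 * 8 ^+ 2 * (q%:R ^+ 2 * T%:R ^+ 2)))).
  rewrite big_const_seq count_predT -/(cnt D) iter_addr_0 -[leRHS]mulr_natr.
  apply: (@le_trans _ _ (X / (18 * 8 ^+ 2 * (q%:R ^+ 2 * T%:R ^+ 2)) * (T%:R ^+ 2 / 4))).
    rewrite le_eqVlt; apply/orP; left; apply/eqP.
    by field; rewrite !gt_eqF.
  by rewrite ler_wpM2l // divr_ge0 // ltW.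
rewrite natr_sum !big_seq; apply: ler_sum => d; rewrite in_fset_set // => /set_mem[Gd cop].
have [/andP[y0 y1] /andP[z0 z1]] := grid_coords Tp Gd.
have [s sdef] : exists s, s = quad_scale X d by exists (quad_scale X d).
pose Y : R := (ycoord d.1 ^+ 2 + zcoord d.2 ^+ 2)%:~R.
have Y0 : 0 < Y by rewrite ltr0z addr_gt0 // exprn_gt0.
have YT : Y <= 18 * (q%:R ^+ 2 * T%:R ^+ 2).
  have b t : 0 < t <= (3 * q * T)%N%:Z -> (t ^+ 2)%:~R <= 9 * (q%:R ^+ 2 * T%:R ^+ 2) :> R.
    move=> /andP[t0 t1]; rewrite rmorphXn /=.
    have -> : 9 * (q%:R ^+ 2 * T%:R ^+ 2) = (3 * q%:R * T%:R) ^+ 2 :> R by ring.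
    have tT : t%:~R <= 3 * q%:R * T%:R :> R by move: t1; rewrite -(ler_int R) -pmulrn !natrM.
    have t0' : 0 <= t%:~R :> R by rewrite ler0z ltW.
    by rewrite lerXn2r ?nnegrE // (le_trans t0').
  have -> : 18 * (q%:R ^+ 2 * T%:R ^+ 2) = 9 * (q%:R ^+ 2 * T%:R ^+ 2) + 9 * (q%:R ^+ 2 * T%:R ^+ 2) :> R.
    by ring.
  by rewrite /Y rmorphD; apply: lerD; apply: b; apply/andP.
have sE : s ^+ 2 = X / Y by rewrite sdef sqr_sqrtr // divr_ge0 // ltW.
have s0 : 0 <= s by rewrite sdef sqrtr_ge0.
have s2 : X / (18 * (q%:R ^+ 2 * T%:R ^+ 2)) <= s ^+ 2.
  by rewrite sE ler_pM2l // lef_pV2 ?posrE // mulr_gt0.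
have s16 : 16 <= s.
  rewrite -(@ler_pXn2r R 2) ?nnegrE //; apply: le_trans s2.
  rewrite ler_pdivlMr ?mulr_gt0 //; apply: le_trans TX.
  by rewrite le_eqVlt; apply/orP; left; apply/eqP; ring.
have q1 : 0 <= q%:R^-1 :> R by rewrite invr_ge0 ltW.
have q2 : q%:R^-1 <= 3 / 4 * s.
  by apply: le_trans (scale_margin s16).1; rewrite invf_le1 // ler1n expn_gt0.
have s34 : 0 <= 3 / 4 * s by rewrite mulr_ge0.
have [fx cx] := @nat_between R (3 / 4 * s) s 0 (lexx 0) s34.
have [fw cw] := @nat_between R (3 / 4 * s) s q%:R^-1 q1 q2.
apply: (@le_trans _ _ (cnt ([set t : nat | 3 / 4 * s < t%:R + 0 < s] `*`
    [set t : nat | 3 / 4 * s < t%:R + q%:R^-1 < s]))%:R); last first.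
  rewrite ler_nat; apply: cnt_sub.
    apply: (@sub_finite_set _ _ ([set t : nat | 3 / 4 * s < t%:R + 0 < s] `*`
      [set t : nat | 3 / 4 * s < t%:R + q%:R^-1 < s])); last exact: finite_setX.
    by move=> -[x w] [/= _ _]; rewrite -sdef => h1 h2; split => //=; rewrite addr0.
  by move=> -[x w] [/= h1 h2]; split => //=; rewrite -sdef //; move: h1; rewrite addr0.
rewrite cntX // natrM; apply: (@le_trans _ _ (s / 8 * (s / 8))).
  apply: (@le_trans _ _ (s ^+ 2 / 64)); last by rewrite mulf_div -expr2 -natrM.
  rewrite ler_pdivlMr //; apply: le_trans s2.
  rewrite le_eqVlt; apply/orP; left; apply/eqP.
  by field; rewrite !gt_eqF.
have s8 : 0 <= s / 8 by rewrite divr_ge0.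
by apply: ler_pM => //; apply: le_trans (scale_margin s16).2 _.
Qed.

(** Different scales give different pairs because the scale is recovered from [i] as its binary
    logarithm. *)
Lemma quads_total (X : R) (l0 l1 : nat) : 0 < X -> (16 * q <= 2 ^ l0)%N ->
  (`|p1| + `|p2| < 2 ^ l0)%N ->
  18 * 16 ^+ 2 * q%:R ^+ 2 * (2 ^ l1)%N%:R ^+ 2 <= X ->
  (l1.+1 - l0)%N%:R * (X / (18 * 16 ^+ 2 * q%:R ^+ 2)) <= (cnt (strict_pairs alpha X))%:R.
Proof.
move=> X0 l0q l0p l1X.
pose F := [set f | exists2 l, (l0 <= l <= l1)%N & quads X (2 ^ l) f].
have l0T l : (l0 <= l)%N -> (2 ^ l0 <= 2 ^ l)%N by move=> h; rewrite leq_exp2l.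
have fS : finite_set (strict_pairs alpha X) by exact: finite_strict_pairs.
pose P (f : (nat * nat) * (nat * nat)) :=
  (quad_pt f.2.1 f.2.2 f.1.1 f.1.2, quad_pt (- f.2.1%:Z) f.2.2 f.1.1 f.1.2).
have FP f : F f -> strict_pairs alpha X (P f).
  by move=> [l /andP[h _]]; apply: quads_strict => //; exact: leq_trans (l0T _ h).
have pos f : F f -> [/\ (0 < f.2.1)%N, 0 < ycoord f.1.1, 0 < zcoord f.1.2 &
    coprime `|ycoord f.1.1| `|zcoord f.1.2|].
  move=> [l /andP[h _] [G cop /andP[hx _] _]].
  have [/andP[y0 _] /andP[z0 _]] := grid_coords (leq_trans l0p (l0T _ h)) G.
  split => //; rewrite -(ltr0n R); apply: le_lt_trans hx.
  by rewrite mulr_ge0 // sqrtr_ge0.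
have Pinj f f' : F f -> F f' -> P f = P f' -> f = f'.
  move=> /pos + /pos; case: f => -[i j] [x w]; case: f' => -[i' j'] [x' w'] /=.
  move=> [x0 y0 z0 c0] [x0' y0' z0' c0'] [h1 h2].
  by have [-> -> -> ->] := quad_pt_inj x0 x0' y0 z0 y0' z0' c0 c0' h1 h2.
have fF : finite_set F by exact: finite_inj fS FP Pinj.
apply: (@le_trans _ _ (cnt F)%:R); last by rewrite ler_nat; exact: cnt_inj fS FP Pinj.
have hF l f : quads X (2 ^ l) f -> trunc_log 2 f.1.1 = l.
  move=> [[/andP[h1 h2] _] _ _ _]; apply: trunc_log_eq => //.
  by rewrite h1 expnS mul2n -addnn.
rewrite (@cnt_fiber _ F (fun f => trunc_log 2 f.1.1) l1.+1 fF); last first.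
  by move=> f [l /andP[_ h]] /hF ->.
rewrite natr_sum -(big_mkord xpredT (fun l =>
  (cnt [set f | F f /\ trunc_log 2 f.1.1 = l])%:R)) /=.
have [l01|l01] := leqP l0 l1.+1; last first.
  by rewrite (eqP (ltnW l01 : _ - _ == 0)%N) mul0r sumr_ge0.
rewrite (@big_cat_nat _ _ _ l0) //=; apply: (@le_trans _ _ (\sum_(l0 <= l < l1.+1) (X / (18 * 16 ^+ 2 * q%:R ^+ 2)))).
  by rewrite sumr_const_nat [leLHS]mulr_natl.
rewrite ler_wpDl ?sumr_ge0 //; apply: ler_sum_nat => l /andP[h1 h2].
have fl : finite_set [set f | F f /\ trunc_log 2 f.1.1 = l].
  by apply: sub_finite_set fF => f [].
have sub : quads X (2 ^ l) `<=` [set f | F f /\ trunc_log 2 f.1.1 = l].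
  by move=> f Qf; split; [exists l; rewrite // h1|exact: hF].
apply: (@le_trans _ _ (cnt (quads X (2 ^ l)))%:R); last by rewrite ler_nat; exact: cnt_sub.
apply: quads_count; last exact: sub_finite_set sub fl.
- exact: leq_trans (l0T _ h1).
- exact: leq_trans (l0T _ h1).
apply: le_trans l1X; rewrite ler_pM2l; last by rewrite !mulr_gt0 ?exprn_gt0.
by rewrite lerXn2r ?nnegrE // ler_nat leq_exp2l.
Qed.

(** The scales up to $2^{l_1}$, with $4^{l_1}\le X/K$, number about $\log X/\log4$. For large [X] at
    least half of that remains after dropping those below $2^{l_0}$, hence the 2 in the constant. *)
Lemma rational_high2 : exists2 c : R, 0 < c & exists X0 : R, forall X, X0 <= X ->
  c * X * ln X <= (cnt (strict_pairs alpha X))%:R.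
Proof.
pose K : R := 18 * 16 ^+ 2 * q%:R ^+ 2.
have K0 : 0 < K by rewrite !mulr_gt0 ?exprn_gt0.
have l4 : 0 < ln 4 :> R by rewrite ln_gt0 //; lra.
pose l0 := (16 * q + (`|p1| + `|p2|))%N.
exists (2 * ln 4 * K)^-1; first by rewrite invr_gt0 !mulr_gt0.
exists (Num.max K (expR (2 * (ln K + l0%:R * ln 4)))) => X; rewrite ge_max => /andP[KX eX].
have X0 : 0 < X by apply: lt_le_trans KX.
have XK : 0 < X / K by rewrite divr_gt0.
have lX : 0 <= ln (X / K) by rewrite ln_ge0 // ler_pdivlMr // mul1r.
have t0 : 0 <= ln (X / K) / ln 4 by rewrite divr_ge0 // ltW.
have /andP[t1 t2] := truncn_itv t0; set l1 := Num.trunc _ in t1 t2.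
have lel : (l0 < 2 ^ l0)%N by exact: ltn_expl.
apply: (@le_trans _ _ ((l1.+1 - l0)%N%:R * (X / K))); last first.
  apply: quads_total => //; rewrite ?/l0.
  - by apply: leq_trans (ltnW lel); rewrite leq_addr.
  - by apply: leq_ltn_trans lel; rewrite leq_addl.
  have -> : (2 ^ l1)%N%:R ^+ 2 = 4 ^+ l1 :> R.
    by rewrite natrX exprAC; congr (_ ^+ _); ring.
  have P0 : 0 < 4 ^+ l1 :> R by rewrite exprn_gt0.
  rewrite -/K mulrC -ler_pdivlMr // -ler_ln ?posrE // lnXn //.
  by move: t1; rewrite ler_pdivlMr // mulr_natl.
have -> : (2 * ln 4 * K)^-1 * X * ln X = (ln X / 2 / ln 4) * (X / K).
  by field; rewrite !gt_eqF.
rewrite ler_pM2r // ler_pdivrMr //.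
have h1 : l1.+1%:R - l0%:R <= (l1.+1 - l0)%N%:R :> R.
  by rewrite lerBlDr -natrD ler_nat addnC -leq_subLR.
apply: (@le_trans _ _ ((l1.+1%:R - l0%:R) * ln 4)); last by rewrite ler_pM2r.
have : 2 * (ln K + l0%:R * ln 4) <= ln X by rewrite -ler_expR lnK.
have : ln (X / K) <= l1.+1%:R * ln 4 by rewrite -ler_pdivrMr // ltW.
by rewrite ln_div ?posrE //; exact: half_log_arith.
Qed.

End PlaneQuadruples.

(** * The generic set *)

Section GenericSets.
Variables (R : realType) (n : nat) (a : R).
Notation k := n.+2.
Notation B := (unit_ball_volume R k).
Hypothesis a0 : 0 < a.

Definition growth (X : R) : R := if k == 2%N then ln X else X `^ ((k%:R - 2) / k%:R).

Definition growth_bound (X : R) : R :=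
  if k == 2%N then ln X / ln (ln (ln X))
  else X `^ ((k%:R - 2) / k%:R) / ln (ln (ln X)).

(** The second bound records that the correlation is unbounded along these scales, which is the
    upper end that [level_crossing] starts from. *)
Definition high_set (N : R) : set 'rV[R]_k := [set alpha | exists2 X : R, N <= X &
  growth_bound X <= R2 alpha (- a) a X /\ N <= R2 alpha (- a) a X].

Definition low_set (N eps : R) : set 'rV[R]_k := [set alpha | exists2 L : R, N <= L &
  R2 alpha (- a) a L <= 2 * a * B + eps].

Lemma low_set_dense (N eps : R) : 0 < eps -> dense (low_set N eps)°.
Proof.
move=> e0; have [B0 _] := lattice_count_ball R k.
apply: dense_interior_near => alpha d d0.
have [beta [hb [L LN hL]]] := low_R2 alpha (Num.max N 1) a0 e0 d0.
move: LN; rewrite ge_max => /andP[LN L1].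
exists beta => //; have := lpairs_usc (ltn0Sn n.+1) beta a L.
apply: (@filterS _ _ (nbhs_filter beta)) => gam h.
exists L; first exact: LN.
have i0 : 0 < (B * L)^-1 by rewrite invr_gt0 mulr_gt0 // (lt_le_trans ltr01).
apply: le_trans (ltW hL); rewrite !(R2E (ltn0Sn n.+1)) (ler_pM2r i0) ler_nat; exact: h.
Qed.

End GenericSets.

(** * Density of the high sets *)

Section HighSets.
Variable R : realType.

Lemma frac_approx (x y delta : R) (q : nat) : delta^-1 < q%:R -> 0 < delta ->
  `|q%:R * x - y| <= 1 -> `|x - y / q%:R| < delta.
Proof.
move=> qd d0 h; have q0 : 0 < q%:R :> R by apply: lt_trans qd; rewrite invr_gt0.
have -> : x - y / q%:R = (q%:R * x - y) / q%:R by field; rewrite gt_eqF.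
rewrite normrM [X in _ * X]gtr0_norm ?invr_gt0 // ltr_pdivrMr //.
by apply: le_lt_trans h _; rewrite -ltr_pdivrMl // mulr1.
Qed.

Lemma floor_approx (x delta : R) (q : nat) : delta^-1 < q%:R -> 0 < delta ->
  `|x - (Num.floor (q%:R * x))%:~R / q%:R| < delta.
Proof.
move=> qd d0; apply: frac_approx => //.
have /andP[h1 h2] := floor_itv (q%:R * x); move: h2; rewrite rmorphD /= => h2.
by rewrite ler_norml; move: h1 h2; clear; lra.
Qed.

Lemma odd_approx (x delta : R) (q : nat) : delta^-1 < q%:R -> 0 < delta ->
  exists2 p : int, odd `|p| & `|x - - (p%:~R / q%:R)| < delta.
Proof.
move=> qd d0; set f := Num.floor (- (q%:R * x) / 2); exists (f + f + 1); first by lia.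
have /andP[h1 h2] := floor_itv (- (q%:R * x) / 2); move: h2; rewrite rmorphD /= => h2.
rewrite -mulNr; apply: frac_approx => //; rewrite ler_norml.
by move: h1 h2; rewrite -/f !rmorphD /=; clear; lra.
Qed.

Lemma dense_rational_high (n : nat) (alpha0 : 'rV[R]_n.+2) (delta : R) : 0 < delta ->
  exists2 alpha : 'rV[R]_n.+2, (forall i, `|alpha0 0 i - alpha 0 i| < delta) &
  exists2 c : R, 0 < c & exists X0 : R, forall X, X0 <= X ->
    c * X * growth n X <= (cnt (strict_pairs alpha X))%:R.
Proof.
move=> d0; pose N := (Num.bound delta^-1).+1.
have dN : delta^-1 < N%:R.
  apply: (@lt_trans _ _ (Num.bound delta^-1)%:R); last by rewrite ltr_nat.
  by apply: archi_boundP; rewrite invr_ge0 ltW.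
case: n alpha0 => [|n] alpha0.
  (* In the plane the denominator is a power of 2 and the second numerator is odd, as
     [coprime_count] requires; such points are still dense. *)
  have d2 : delta^-1 < (2 ^ N)%N%:R by rewrite (lt_trans dN) // ltr_nat ltn_expl.
  have [p2 op2 h2] := odd_approx (alpha0 0 1) d2 d0.
  have [p1 _ h1] := odd_approx (alpha0 0 0) d2 d0.
  pose alpha : 'rV[R]_2 := \row_i (- ((if i == 0 then p1 else p2)%:~R / (2 ^ N)%N%:R)).
  exists alpha.
    move=> i; rewrite !mxE; have [->|i0] := eqVneq i 0; first exact: h1.
    by have -> : i = 1 by apply/val_inj; case: i i0 => -[|[|]].
  by apply: (@rational_high2 R N p1 p2 alpha); rewrite ?mxE.
pose alpha : 'rV[R]_n.+3 := \row_i ((Num.floor (N%:R * alpha0 0 i))%:~R / N%:R).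
exists alpha; first by move=> i; rewrite mxE; exact: floor_approx.
have [//|i|c c0 [r0 H]] := @rational_high R n alpha N.
  by exists (Num.floor (N%:R * alpha0 0 i)); rewrite mxE mulrC divfK // pnatr_eq0.
exists c => //; exists (Num.max 0 r0 ^+ n.+3) => X hX.
have m0 : 0 <= Num.max 0 r0 by rewrite le_max lexx.
have X0 : 0 <= X by apply: le_trans hX; rewrite exprn_ge0.
have [rho rho0 rhoX] := @root_exists R n.+3 isT X X0.
have r0r : r0 <= rho.
  apply: (@le_trans _ _ (Num.max 0 r0)); first by rewrite le_max lexx orbT.
  by apply: (@ge_of_exp_ge R n.+3 isT) => //; rewrite rhoX.
have := H rho r0r; rewrite rhoX /growth; suff -> : X `^ ((n.+3%:R - 2) / n.+3%:R) = rho ^+ n.+1 by [].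
rewrite -rhoX -powR_mulrn // -powRrM mulrCA divff ?pnatr_eq0 // mulr1.
have -> : n.+3%:R - 2 = n.+1%:R :> R by rewrite -addn2 natrD addrK.
by rewrite powR_mulrn.
Qed.

Lemma growth_unbounded (n : nat) : exists2 p : R, 0 < p & forall u, 0 < u ->
  p * u <= growth n (expR (expR (expR u))).
Proof.
have e v : v <= expR v :> R by apply: le_trans (expR_ge1Dx _); rewrite lerDr.
have ee u : u <= expR (expR u) :> R by exact: le_trans (e _) (e _).
rewrite /growth; have [n0|n0] := boolP (n.+2 == 2%N).
  by exists 1 => // u u0; rewrite expRK mul1r.
have p0 : 0 < (n.+2%:R - 2) / n.+2%:R :> R.
  by rewrite divr_gt0 // subr_gt0 ltr_nat; move: n0; case: n.
exists ((n.+2%:R - 2) / n.+2%:R) => // u u0; rewrite /powR gt_eqF ?expR_gt0 // expRK.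
apply: (@le_trans _ _ ((n.+2%:R - 2) / n.+2%:R * expR (expR u))); first by rewrite ler_pM2l.
by apply: le_trans (expR_ge1Dx _); rewrite lerDr.
Qed.

Lemma high_set_dense (n : nat) (a N : R) : 0 < a -> dense (@high_set R n a N)°.
Proof.
move=> a0; have [B0 _] := lattice_count_ball R n.+2.
apply: dense_interior_near => alpha0 d d0.
have [alpha ha [c c0 [X0 HX]]] := dense_rational_high alpha0 d0.
exists alpha => //; have [p p0 Hp] := growth_unbounded n.
set B := unit_ball_volume R n.+2 in B0 *.
(* The constant [c] is known only now. With [X = exp (exp (exp u))] the triple logarithm equals [u],
   so [u >= B / c] gives the growth bound; the last entry of the maximum gives the bound by [N]. *)
pose u := Num.max 1 (Num.max (Num.max N X0) (Num.max (B / c) (N * B / (c * p)))).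
have [u1 uN uX uB uNB] : [/\ 1 <= u, N <= u, X0 <= u, B / c <= u & N * B / (c * p) <= u].
  by rewrite !le_max !lexx !orbT.
have u0 : 0 < u by apply: lt_le_trans u1.
pose X := expR (expR (expR u)).
have Xu : u <= X.
  have e v : v <= expR v :> R by apply: le_trans (expR_ge1Dx _); rewrite lerDr.
  by rewrite (le_trans (e _)) // (le_trans (e _)) // e.
have X1 : 0 < X by exact: expR_gt0.
have := strict_pairs_lsc (ltn0Sn n.+1) alpha X a0; apply: (@filterS _ _ (nbhs_filter alpha)) => beta hb.
have gu := Hp u u0; have g0 : 0 <= growth n X by apply: le_trans gu; rewrite mulr_ge0 // ltW.
have hR : c / B * growth n X <= R2 beta (- a) a X.
  rewrite R2E // -/B ler_pdivlMr ?mulr_gt0 //; apply: (@le_trans _ _ (cnt (strict_pairs alpha X))%:R).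
    apply: le_trans (HX X (le_trans uX Xu)); rewrite le_eqVlt; apply/orP; left; apply/eqP.
    by field; rewrite gt_eqF.
  by rewrite ler_nat.
exists X; first exact: le_trans uN Xu.
split; apply: le_trans hR.
  have -> : growth_bound n X = growth n X / u by rewrite /growth_bound /growth /X !expRK; case: (n.+2 == 2%N).
  rewrite mulrC ler_wpM2r // -[c / B]invrK lef_pV2 ?posrE ?invr_gt0 ?divr_gt0 //.
  by rewrite invf_div.
apply: (@le_trans _ _ (c / B * (p * u))); last by rewrite ler_pM2l ?divr_gt0.
move: uNB; rewrite ler_pdivrMr ?mulr_gt0 // => uNB.
by rewrite mulrAC ler_pdivlMr //; move: uNB; clear; lra.
Qed.

End HighSets.

Theorem theorem1p8 (R : realType) (k : nat) (hk : (2 <= k)%N)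
    (a : R) (ha : 0 < a) :
  exists C : set (torus R k),
    [/\ second_category C,
        forall alpha : 'rV[R]_k, C (\pi_(torus R k) alpha) ->
          lin_indep_over_rat (row_mx alpha (1%:M : 'rV[R]_1)),
        forall alpha : 'rV[R]_k, C (\pi_(torus R k) alpha) ->
          forall M : R, exists2 X : R, M <= X &
            (if k == 2%N then ln X / ln (ln (ln X))
             else X `^ ((k%:R - 2) / k%:R) / ln (ln (ln X)))
            <= R2 alpha (- a) a X
      & forall alpha : 'rV[R]_k, C (\pi_(torus R k) alpha) ->
          exists L : nat -> R,
            [/\ {homo L : i j / (i < j)%N >-> i < j},
                L j @[j --> \oo] --> +oo
              & R2 alpha (- a) a (L j) @[j --> \oo]
                  --> 2 * a * unit_ball_volume R k]].
Proof.
case: k hk => [//|[//|n]] _; have [B0 _] := lattice_count_ball R n.+2.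
have c0 : 0 < 2 * a * unit_ball_volume R n.+2 by rewrite !mulr_gt0.
pose off (q : 'rV[rat]_(n.+2 + 1)) := [set alpha : 'rV[R]_n.+2 |
  \sum_i ratr (q 0 i) * (row_mx alpha (1%:M : 'rV[R]_1)) 0 i <> 0].
pose I : countType := (nat + nat + 'rV[rat]_(n.+2 + 1))%type.
pose G' (i : I) := match i with
  | inl (inl N) => @high_set R n a N%:R
  | inl (inr N) => @low_set R n a N%:R N.+1%:R^-1
  | inr q => if q == 0 then setT else off q end.
pose G j := if choice.unpickle j is Some i then (G' i)° else setT.
have HG j : open (G j) /\ dense (G j).
  rewrite /G; case: (choice.unpickle j) => [i|]; last first.
    by split; [exact: openT|move=> O [x Ox] _; exists x].
  split; first exact: open_interior.
  case: i => [[N|N]|q]; rewrite /G'.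
  - exact: high_set_dense.
  - by apply: low_set_dense; rewrite ?invr_gt0.
  - case: eqVneq => [_|q0]; last exact: off_hyperplane_dense.
    by rewrite interiorT => O [x Ox] _; exists x.
have CG := torus_second_category HG; set C := [set x | _] in CG.
have GE alpha : C (\pi_(torus R n.+2) alpha) -> forall i, G' i alpha.
  move=> Ca i; apply: interior_subset.
  by have := Ca alpha erefl (choice.pickle i); rewrite /G choice.pickleK.
have hi alpha : C (\pi_(torus R n.+2) alpha) -> forall M : R, exists2 X : R, M <= X &
    growth_bound n X <= R2 alpha (- a) a X /\ M <= R2 alpha (- a) a X.
  move=> /GE Ga M; have [X MX [h1 h2]] := Ga (inl (inl (Num.bound M))).
  have MB : M <= (Num.bound M)%:R.
    have [M0|M0] := leP 0 M; first exact/ltW/archi_boundP.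
    exact: le_trans (ltW M0) _.
  exists X; first exact: le_trans MX.
  split; [exact: h1|exact: le_trans h2].
have li alpha : C (\pi_(torus R n.+2) alpha) ->
    lin_indep_over_rat (row_mx alpha (1%:M : 'rV[R]_1)).
  move=> /GE Ga q hq; have := Ga (inr q); rewrite /G'.
  by case: eqVneq => // _ /(_ hq).
exists C; split => //.
  by move=> alpha /hi H M; have [X MX [h _]] := H M; exists X.
move=> alpha Ca; apply: sequence_to_level.
apply: (level_crossing (ltn0Sn n.+1) ha c0).
- exact: ldist_inj (li alpha Ca).
(* One index of [low_set] controls both the scale and the precision, hence the maximum. *)
- move=> M eps e0; pose N := maxn (Num.bound `|M|) (Num.bound eps^-1).
  have [L NL hL] := GE alpha Ca (inl (inr N)).
  have MN : M <= N%:R.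
    apply: le_trans (ler_norm M) _; apply: le_trans (ltW (archi_boundP (normr_ge0 M))) _.
    by rewrite ler_nat leq_maxl.
  have eN : N.+1%:R^-1 <= eps.
    rewrite invf_ple ?posrE //; apply: (@le_trans _ _ (Num.bound eps^-1)%:R).
      by apply/ltW/archi_boundP; rewrite invr_ge0 ltW.
    by rewrite ler_nat leqW // leq_maxr.
  exists L; first exact: le_trans NL.
  by apply: le_trans hL _; rewrite lerD2l.
- by move=> M; have [X MX [_ h]] := hi alpha Ca M; exists X.
Qed.
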